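(* Let $(M,g)$ be a compact Riemannian manifold of dimension $n\ge 2$, possibly with boundary, and let $\mathcal R_0$ be the set of positive smooth functions $\phi$ on $M$ with $\frac{1}{|M|_g}\int_M\phi\,v_g=1$. For every positive integer $k$ and every real $p>0$: (i) $\inf_{\rho\in\mathcal R_0}\mu_k(\rho,1)=0$; (ii) $\inf_{\sigma\in\mathcal R_0}\mu_k(1,\sigma)=0$; (iii) $\inf_{\rho\in\mathcal R_0}\mu_k(\rho,\rho^p)=0$.
   Context: $v_g$ is the Riemannian volume element of $g$ and $|M|_g$ the volume of $M$. For positive functions $\rho,\sigma$ on $M$ and $k\ge0$, $$\mu_k(\rho,\sigma)=\mu_k^g(\rho,\sigma)=\inf_{E\in S_{k+1}}\sup_{u\in E\setminus\{0\}}\frac{\int_M|\nabla u|^2\sigma\,v_g}{\int_Mu^2\rho\,v_g},$$ where $S_k$ is the set of $k$-dimensional vector subspaces of $H^1(M)$ (numbering starts at $0$, so $\mu_0=0$). *)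

(* Defs.v *)
From HB Require Import structures.
From mathcomp Require Import all_boot all_order all_algebra.
From mathcomp Require Import all_classical all_reals all_analysis.
Set Implicit Arguments.
Unset Strict Implicit.
Unset Printing Implicit Defensive.
Import Order.TTheory GRing.Theory Num.Theory.
Import numFieldNormedType.Exports.
Local Open Scope classical_set_scope.
Local Open Scope ring_scope.

(* Lebesgue measure on R^n, as the n-fold product of the Lebesgue measure on
   the line, carried by n.-tuple R with its product (= Borel) sigma-algebra. *)
Section lebesgue_measure_tuple.
Variable R : realType.
Local Notation RM := (measurableTypeR R).

Definition tcons n (p : RM * n.-tuple RM) : n.+1.-tuple RM :=
  [the n.+1.-tuple RM of p.1 :: p.2].

Let measurable_tcons n : measurable_fun setT (@tcons n).
Proof. exact: measurable_cons. Qed.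

HB.instance Definition _ n :=
  isMeasurableFun.Build _ _ _ _ (@tcons n) (@measurable_tcons n).

Definition leb_cons n (mu : {sigma_finite_measure set (n.-tuple RM) -> \bar R}) :
    set (n.+1.-tuple RM) -> \bar R :=
  pushforward (@lebesgue_measure R \x mu)%E (@tcons n).

Section leb_cons_measure.
Variables (n : nat) (mu : {sigma_finite_measure set (n.-tuple RM) -> \bar R}).

Let leb_cons0 : leb_cons mu set0 = 0%E.
Proof. exact: measure0. Qed.

Let leb_cons_ge0 A : (0 <= leb_cons mu A)%E.
Proof. exact: measure_ge0. Qed.

Let leb_cons_sigma_additive : semi_sigma_additive (leb_cons mu).
Proof. exact: measure_semi_sigma_additive. Qed.

HB.instance Definition _ := isMeasure.Build _ _ _ (leb_cons mu)
  leb_cons0 leb_cons_ge0 leb_cons_sigma_additive.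

Let leb_cons_sigma_finite : sigma_finite setT (leb_cons mu).
Proof.
pose h (t : n.+1.-tuple RM) : RM * n.-tuple RM :=
  (tnth t ord0, [tuple of behead t]).
have mh : measurable_fun setT h.
  apply/measurable_fun_pairP; split.
    exact: (measurable_tnth ord0).
  exact: measurable_behead.
have hK p : h (tcons p) = p.
  by case: p => a t; congr pair; apply: val_inj.
have /sigma_finiteP[F [TF ndF Foo]] := sigma_finiteT (@lebesgue_measure R).
have /sigma_finiteP[G [TG ndG Goo]] := sigma_finiteT mu.
exists (fun i => h @^-1` (F i `*` G i)).
  rewrite -preimage_bigcup; apply/esym/seteqP; split=> // t _ /=.
  have [i _ Fi] : (\bigcup_i F i) (h t).1 by rewrite -TF.
  have [j _ Gj] : (\bigcup_i G i) (h t).2 by rewrite -TG.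
  exists (maxn i j) => //; split.
  - by move: Fi; exact/subsetPset/ndF/leq_maxl.
  - by move: Gj; exact/subsetPset/ndG/leq_maxr.
move=> i; have [mF Fi] := Foo i; have [mG Gi] := Goo i; split.
  by rewrite -[X in measurable X]setTI; apply: mh => //; exact: measurableX.
rewrite /leb_cons /pushforward.
have -> : @tcons n @^-1` (h @^-1` (F i `*` G i)) = F i `*` G i.
  by apply/funext => p; rewrite /preimage/mkset hK.
by rewrite product_measure1E// lte_mul_pinfty// ge0_fin_numE.
Qed.

HB.instance Definition _ :=
  Measure_isSigmaFinite.Build _ _ _ (leb_cons mu) leb_cons_sigma_finite.

End leb_cons_measure.

Fixpoint leb n : {sigma_finite_measure set (n.-tuple RM) -> \bar R} :=
  match n with
  | 0 => \d_ ([tuple] : 0.-tuple RM)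
  | m.+1 => leb_cons (leb m)
  end.

Definition vec n (t : n.-tuple RM) : 'rV[R]_n := \row_i tnth t i.

End lebesgue_measure_tuple.

(* Smooth functions on open subsets of R^n, and on arbitrary subsets by local
   smooth extension. *)
Section smooth_functions.
Variables (R : realType) (n : nat).
Implicit Types (f F : 'rV[R]_n -> R) (O V : set 'rV[R]_n).

Definition std (i : 'I_n) : 'rV[R]_n := delta_mx 0 i.

Definition iter_partial (s : seq 'I_n) F : 'rV[R]_n -> R :=
  foldr (fun i f => 'D_(std i) f) F s.

Definition smooth_open O F := forall (s : seq 'I_n) y, O y ->
  {for y, continuous (iter_partial s F)} /\
  forall i, derivable (iter_partial s F) y (std i).

Definition smooth_on V f := forall y, V y ->
  exists O F, [/\ open O, O y, smooth_open O F &
                  forall z, O z -> V z -> F z = f z].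

Definition test_function V f := [/\ smooth_open setT f,
  compact (closure [set y | f y != 0]) & closure [set y | f y != 0] `<=` V].

(* The model half-space {y_0 >= 0}. *)
Definition halfspace : set 'rV[R]_n :=
  [set y | forall i : 'I_n, val i = 0%N -> 0 <= y 0 i].

(* Right partial derivative: at every point of a relatively open subset of the
   half-space, boundary points included, it only uses values of f inside that
   subset, and it is the usual partial derivative of any smooth extension. *)
Definition rpartial f (y : 'rV[R]_n) (i : 'I_n) : R :=
  lim ((f (y + h *: std i) - f y) / h @[h --> 0^'+]).

End smooth_functions.

(* Smooth n-dimensional manifolds with (possibly empty) boundary, given by an
   atlas of charts onto relatively open subsets of the half-space; a chart into
   the interior of the half-space is allowed, so that the boundary may be
   empty.  M is pointed, hence nonempty. *)
Record manifold (R : realType) (n : nat) (M : ptopologicalType) := Manifold {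
  chart : Type;
  dom : chart -> set M;
  coord : chart -> M -> 'rV[R]_n;
  param : chart -> 'rV[R]_n -> M;
  chart_at : M -> chart;
  manifold_hausdorff : hausdorff_space M;
  manifold_second_countable : @second_countable M;
  dom_chart_at : forall x, dom (chart_at x) x;
  dom_open : forall c, open (dom c);
  coord_dom : forall c, exists2 O : set 'rV[R]_n,
    open O & coord c @` dom c = O `&` @halfspace R n;
  coordK : forall c x, dom c x -> param c (coord c x) = x;
  coord_continuous : forall c, {within dom c, continuous (coord c)};
  param_continuous : forall c,
    {within coord c @` dom c, continuous (param c)};
  transition_smooth : forall c d (j : 'I_n),
    smooth_on (coord c @` (dom c `&` dom d))
      (fun y => coord d (param c y) 0 j)
}.

Section manifold_theory.
Variables (R : realType) (n : nat) (M : ptopologicalType).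
Variable X : manifold R n M.

Definition smooth (f : M -> R) := forall c : chart X,
  smooth_on (coord c @` dom c) (fun y => f (param c y)).

(* Jacobian at x of the change of coordinates from c to d, acting on row
   vectors on the right. *)
Definition jac (c d : chart X) (x : M) : 'M[R]_n :=
  \matrix_(i, j) rpartial (fun y => coord d (param c y) 0 j) (coord c x) i.

Record metric := Metric {
  gmx : chart X -> M -> 'M[R]_n;
  gmx_smooth : forall c (i j : 'I_n),
    smooth_on (coord c @` dom c) (fun y => gmx c (param c y) i j);
  gmx_sym : forall c x, dom c x -> (gmx c x)^T = gmx c x;
  gmx_pos : forall c x, dom c x ->
    forall v : 'rV[R]_n, v != 0 -> 0 < (v *m gmx c x *m v^T) 0 0;
  gmx_change : forall c d x, dom c x -> dom d x ->
    gmx c x = jac c d x *m gmx d x *m (jac c d x)^T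
}.

(* A (not necessarily continuous) tangent vector field, by its components in
   each chart. *)
Definition vector_field (w : chart X -> M -> 'rV[R]_n) :=
  forall c d x, dom c x -> dom d x -> w d x = w c x *m jac c d x.

Definition borel := g_sigma_algebraType (@open M).

End manifold_theory.

Section riemannian.
Variables (R : realType) (n : nat) (M : ptopologicalType).
Variables (X : manifold R n M) (g : metric X).
Variable vol : {measure set (borel M) -> \bar R}.

(* v_g is the Borel measure which equals sqrt(det g) dy in every chart. *)
Definition is_riemannian_volume := forall (c : chart X) (A : set (borel M)),
  measurable A -> A `<=` dom c ->
  vol A = (\int[leb R n]_(t in [set t | (coord c @` A) (vec t)])
             (Num.sqrt (\det (gmx g c (param c (vec t)))))%:E)%E.

(* |w|_g^2; for a vector field it does not depend on the chart used. *)
Definition gnorm2 (w : chart X -> M -> 'rV[R]_n) (x : M) : R :=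
  let c := chart_at X x in (w c x *m gmx g c x *m (w c x)^T) 0 0.

(* w is the square-integrable weak gradient of u.  In a chart, w *m g is the
   row of components of the differential of u, which is tested against
   functions supported away from the boundary. *)
Definition weak_gradient (u : M -> R) (w : chart X -> M -> 'rV[R]_n) :=
  [/\ vector_field w,
      forall (c : chart X) (i : 'I_n),
        measurable_fun (dom c : set (borel M)) (fun x : borel M => w c x 0 i),
      (\int[vol]_x (gnorm2 w x)%:E < +oo)%E &
      forall (c : chart X) (i : 'I_n) (eta : 'rV[R]_n -> R),
        let V := interior (coord c @` dom c) in
        test_function V eta ->
        \int[leb R n]_(t in [set t | V (vec t)])
          (u (param c (vec t)) * 'D_(std R i) eta (vec t))
        = - \int[leb R n]_(t in [set t | V (vec t)])
          ((w c (param c (vec t)) *m gmx g c (param c (vec t))) 0 i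
            * eta (vec t))].

(* Elements of H^1(M) are represented by functions; classes are taken modulo
   almost everywhere equality, see [subspaces]. *)
Definition H1 : set (M -> R) :=
  [set u | (u : borel M -> R) \in Lfun vol 2%:E /\
           exists w, weak_gradient u w].

(* A choice of weak gradient; weak gradients are unique almost everywhere. *)
Definition grad (u : M -> R) : chart X -> M -> 'rV[R]_n :=
  xget (fun _ _ => 0) [set w | weak_gradient u w].

Definition ae_zero (u : M -> R) := (u : borel M -> R) = cst 0 %[ae vol].

(* k-dimensional subspaces of H^1(M), each given by the linear combinations of
   representatives of a basis: linear independence is modulo a.e. equality. *)
Definition subspaces (k : nat) : set (set (M -> R)) :=
  [set E | exists b : 'I_k -> M -> R,
    [/\ forall i, H1 (b i),
        forall a : 'I_k -> R, ae_zero (fun x => \sum_i a i * b i x) ->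
          forall i, a i = 0 &
        E = [set u | exists a : 'I_k -> R, u = fun x => \sum_i a i * b i x]]].

Definition rayleigh (rho sigma u : M -> R) : \bar R :=
  ((\int[vol]_x (gnorm2 (grad u) x * sigma x)%:E)
   / (\int[vol]_x (u x ^+ 2 * rho x)%:E))%E.

Definition mu_k (k : nat) (rho sigma : M -> R) : \bar R :=
  ereal_inf [set ereal_sup [set rayleigh rho sigma u |
                              u in [set u | E u /\ ~ ae_zero u]]
            | E in subspaces k.+1].

Definition R0 : set (M -> R) :=
  [set phi | [/\ forall x, 0 < phi x, smooth X phi &
    ((vol [set: borel M])^-1 * \int[vol]_x (phi x)%:E = 1)%E]].

End riemannian.

(* Main.v *)
(* In dimension n >= 2 the cutoffs eta_j(x) = eta(2^j l |x - z|), with eta = 1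
   on [0, 1] and 0 on [2, oo), have a Dirichlet energy bounded uniformly in j,
   and their gradients live on pairwise disjoint annuli.  The average u of
   eta_0, ..., eta_{N-1} therefore has energy O(1/N), while u = 1 on the support
   of psi = eta_N, where eta_N is a cutoff at a smaller scale.  Take k + 1 such
   pairs (u_i, psi_i) around distinct points of one chart, with disjoint
   supports, so that numerator and denominator of the Rayleigh quotient are both
   diagonal on the span of the u_i.  The density
     phi = eps + sum_i (1 - eps) |M| / ((k + 1) int psi_i) psi_i
   belongs to R_0, equals eps wherever some grad u_i is nonzero, and gives each
   u_i^2 a mass at least (1 - eps) |M| / (k + 1).  Hence, up to constants,
   mu_k(phi, 1) <= 1/N for eps = 1/2, while, for N = 1, mu_k(1, phi) <= eps and
   mu_k(phi, phi^p) <= eps^p. *)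
From HB Require Import structures.
From Pilot Require Import Defs.
From mathcomp Require Import all_boot all_order all_algebra.
From mathcomp Require Import all_classical all_reals all_analysis.
From mathcomp Require Import measurable_realfun.
From mathcomp Require Import ring lra.
Import Order.TTheory GRing.Theory Num.Theory.
Import numFieldNormedType.Exports.
Import Pilot.Defs.
Set Implicit Arguments.
Unset Strict Implicit.
Unset Printing Implicit Defensive.
Local Open Scope classical_set_scope.
Local Open Scope ring_scope.

(** * Calculus on R^n *)

(** The Rayleigh quotient is formed with [grad], an arbitrary weak gradient picked by [xget], so
    even the energy of a smooth function is known only once the norms of any two weak gradients
    agree almost everywhere. Hence the du Bois-Reymond lemma on R^n and the transfer of null sets
    through charts. Near the boundary, functions are smooth only through local extensions, so first
    order calculus on the manifold is done with right partial derivatives. A cutoff at scale l has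
    gradient O(l) on a set of volume O(l^-n), hence energy O(l^2 l^-n), which is bounded for l >= 1
    when n >= 2. For n = 2 this bound does not tend to 0, which is why cutoffs are averaged over
    many scales. The average matters for (i) only, where the numerator has weight 1 everywhere; in
    (ii) and (iii) the weight is itself small where the gradients live, so a single scale is enough.
    That each infimum is at least 0 is soft: every admissible subspace contains a function that is
    not almost everywhere 0, so its supremum is nonnegative. *)

Section rV_norm.
Variables (R : realType) (n : nat).
Implicit Types (v w : 'rV[R]_n).

Lemma rV_norm_leP v (e : R) : 0 <= e -> reflect (forall i, `|v 0 i| <= e) (`|v| <= e).
Proof.
move=> e0; rewrite /Num.Def.normr/= mx_normrE; apply: (iffP idP) => [h i|h].
  by apply: le_trans h; apply: (@le_trans _ _ `|v (0, i).1 (0, i).2|) => //; exact: le_bigmax.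
by apply: bigmax_le => // -[i j] _ /=; rewrite (ord1 i); exact: h.
Qed.

Lemma rV_norm_ltP v (e : R) : 0 < e -> reflect (forall i, `|v 0 i| < e) (`|v| < e).
Proof.
move=> e0; rewrite /Num.Def.normr/= mx_normrE; apply: (iffP idP) => [h i|h].
  by apply: le_lt_trans h; apply: (@le_trans _ _ `|v (0, i).1 (0, i).2|) => //; exact: le_bigmax.
by apply: bigmax_lt => // -[i j] _ /=; rewrite (ord1 i); exact: h.
Qed.

Lemma rV_coord_le v i : `|v 0 i| <= `|v|.
Proof. by move: i; apply/rV_norm_leP. Qed.

Lemma cvg_rV (T : Type) (F : set_system T) (FF : Filter F) (p : T -> 'rV[R]_n) (z : 'rV[R]_n) :
  (forall j, p t 0 j @[t --> F] --> z 0 j) -> p t @[t --> F] --> z.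
Proof.
move=> h; apply/cvgrPdist_le => e e0.
have : \forall t \near F, forall j, `|z 0 j - p t 0 j| <= e.
  by apply: filter_forall => j; move/cvgrPdist_le : (h j); apply.
apply: filterS => t ht; apply/rV_norm_leP; first exact: ltW.
by move=> j; rewrite !mxE.
Qed.

Lemma continuous_rV (T : topologicalType) (Phi : T -> 'rV[R]_n) y :
  (forall j, {for y, continuous (fun x => Phi x 0 j)}) -> {for y, continuous Phi}.
Proof. by move=> h; exact: (@cvg_rV T (nbhs y) _ Phi (Phi y) h). Qed.

End rV_norm.

(** * Mean value theorem along a line *)

Section mean_value.
Variable R : realType.

Lemma derivable_line (V W : normedModType R) (F : V -> W) (y v : V) (s : R) :
  derivable F (y + s *: v) v ->
  is_derive s 1 (fun t => F (y + t *: v)) ('D_v F (y + s *: v)).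
Proof.
move=> dF.
have E : (fun h : R => h^-1 *: (F (y + (h *: (1:R) + s) *: v) - F (y + s *: v))) =
         (fun h : R => h^-1 *: (F (h *: v + (y + s *: v)) - F (y + s *: v))).
  by apply/funext => h; congr (_ *: (F _ - _)); rewrite [h *: 1]mulr1 scalerDl addrCA.
apply: DeriveDef; first exact: (eq_ind_r (fun g : R -> W => cvg (g @ 0^')) dF E).
exact: (congr1 (fun g : R -> W => lim (g @ 0^')) E).
Qed.

(** The bounds by absolute values treat both signs of [a] at once, at the price of locating [t] only
    in a symmetric interval. *)
Lemma mean_value_line (V : normedModType R) (F : V -> R) (y v : V) (a : R) :
  (forall t : R, `|t| <= `|a| -> derivable F (y + t *: v) v) ->
  exists2 t, `|t| <= `|a| & F (y + a *: v) - F y = a * 'D_v F (y + t *: v).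
Proof.
move=> dF; pose f t := F (y + t *: v).
have df (t : R) : `|t| <= `|a| -> is_derive t 1 f ('D_v F (y + t *: v)).
  by move=> /dF; exact: derivable_line.
have cf (I : interval R) : (forall t : R, t \in I -> `|t| <= `|a|) ->
    {within [set` I], continuous f}.
  move=> h; apply: derivable_within_continuous => t /h /df d.
  exact: (@ex_derive _ _ _ _ _ _ _ d).
have f0 : F y = f 0 by rewrite /f scale0r addr0.
have [a0|a0] := leP 0 a.
  have h (t : R) : t \in `[0, a]%R -> `|t| <= `|a|.
    by rewrite in_itv/= => /andP[t0 ta]; rewrite !ger0_norm.
  have h' (t : R) : t \in `]0, a[%R -> `|t| <= `|a|.
    by rewrite in_itv/= => /andP[t0 ta]; rewrite !ger0_norm// ltW.
  have [c ca E] := MVT_segment a0 (fun t ht => df t (h' t ht)) (cf _ h).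
  by exists c; [exact: h|rewrite f0 -[F (y + a *: v)]/(f a) E subr0 mulrC].
have h (t : R) : t \in `[a, 0]%R -> `|t| <= `|a|.
  by rewrite in_itv/= => /andP[t0 ta]; rewrite !ler0_norm ?lerN2// ltW.
have h' (t : R) : t \in `]a, 0[%R -> `|t| <= `|a|.
  by rewrite in_itv/= => /andP[t0 ta]; apply: h; rewrite in_itv/= !ltW.
have [c ca E] := MVT_segment (ltW a0) (fun t ht => df t (h' t ht)) (cf _ h).
exists c; first exact: h.
by rewrite f0 -[F (y + a *: v)]/(f a) -opprB E sub0r mulrN opprK mulrC.
Qed.

End mean_value.

(** * Chain rule from continuous partial derivatives *)

Section chain_rule.
Variables (R : realType) (m : nat).
Implicit Types (G : 'rV[R]_m -> R) (z : 'rV[R]_m).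

(** Only partial derivatives appear, because [smooth_open] provides nothing else; this much already
    yields the chain rule. *)
Definition C1_at G z := (\forall w \near z, forall i, derivable G w (std R i)) /\
  forall i, {for z, continuous ('D_(std R i) G)}.

(** Move from [z] to [w] one coordinate at a time and apply the mean value theorem to each leg. In
    the maximum norm, no leg goes farther from [z] than [w] does. *)
Lemma C1_expansion G z e : (forall w, `|w - z| < e -> forall i, derivable G w (std R i)) ->
  forall w, `|w - z| < e -> exists xi : 'I_m -> 'rV[R]_m,
    (forall j, `|xi j - z| <= `|w - z|) /\
    G w - G z = \sum_j (w 0 j - z 0 j) * 'D_(std R j) G (xi j).
Proof.
move=> dG w we; pose v := w - z.
pose p (k : nat) : 'rV[R]_m := \row_i (if (i < k)%N then v 0 i else 0).
have pS (j : 'I_m) : p j.+1 = p j + v 0 j *: std R j.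
  apply/rowP => i; rewrite !mxE eqxx/= ltnS leq_eqVlt -val_eqE/=.
  by case: eqP => [/val_inj ->|_]; rewrite /= ?mulr1 ?mulr0 ?ltnn ?add0r ?addr0.
have pt (j : 'I_m) t : `|t| <= `|v 0 j| -> `|p j + t *: std R j| <= `|v|.
  move=> tv; apply/rV_norm_leP => // i.
  have -> : (p j + t *: std R j) 0 i = (if (i < j)%N then v 0 i else 0) + t * (i == j)%:R.
    by rewrite !mxE eqxx.
  have [->|ij] := eqVneq i j.
    by rewrite ltnn add0r mulr1 (le_trans tv)// rV_coord_le.
  by rewrite mulr0 addr0; case: ifP => _; [exact: rV_coord_le|rewrite normr0].
have ex (j : 'I_m) : exists x : 'rV[R]_m, `|x - z| <= `|v| /\
    G (z + p j.+1) - G (z + p j) = v 0 j * 'D_(std R j) G x.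
  have [t|t tv E] := @mean_value_line R _ G (z + p j) (std R j) (v 0 j).
    move=> tv; apply: dG; rewrite -(addrA z) [z + _]addrC addrK.
    exact: le_lt_trans (pt _ _ tv) we.
  exists (z + p j + t *: std R j); split; last by rewrite pS addrA.
  by rewrite -(addrA z) [z + _]addrC addrK pt.
have [xi hxi] := choice ex.
exists xi; split; first by move=> j; case: (hxi j).
have p0 : p 0%N = 0 by apply/rowP => i; rewrite !mxE.
have pm : p m = v by apply/rowP => i; rewrite !mxE ltn_ord.
have -> : G w - G z = G (z + p m) - G (z + p 0%N).
  by rewrite p0 pm addr0 /v [z + _]addrC subrK.
rewrite -(telescope_sumr (fun k => G (z + p k)))// big_mkord.
by apply: eq_bigr => j _; case: (hxi j) => _ ->; rewrite !mxE.
Qed.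

(** The filter and the factor [a] are left general so that one statement covers two-sided difference
    quotients (at [0^']) and right ones (at [0^'+]). *)
Lemma chain_rule_filter (T : Type) (F : set_system T) (FF : Filter F) G z
    (p : T -> 'rV[R]_m) (a : T -> R) (v : 'I_m -> R) :
  C1_at G z -> p t @[t --> F] --> z ->
  (forall j, a t * (p t 0 j - z 0 j) @[t --> F] --> v j) ->
  a t * (G (p t) - G z) @[t --> F] --> \sum_j v j * 'D_(std R j) G z.
Proof.
move=> [/nbhs_ballP[e /= e0 dG] cG] pz av.
have dG' w : `|w - z| < e -> forall i, derivable G w (std R i).
  by move=> we; apply: dG; rewrite -ball_normE/= distrC.
have ex w : exists xi : 'I_m -> 'rV[R]_m, `|w - z| < e ->
    (forall j, `|xi j - z| <= `|w - z|) /\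
    G w - G z = \sum_j (w 0 j - z 0 j) * 'D_(std R j) G (xi j).
  have [we|we] := boolP (`|w - z| < e).
    by have [xi hxi] := C1_expansion dG' we; exists xi.
  by exists (fun=> 0).
have [xi hxi] := choice ex.
have near_p d : 0 < d -> \forall t \near F, `|p t - z| < d.
  by move=> d0; move/cvgrPdist_lt : pz => /(_ _ d0); apply: filterS => t; rewrite distrC.
have xiz j : xi (p t) j @[t --> F] --> z.
  apply/cvgrPdist_lt => d d0.
  near=> t.
  have pe : `|p t - z| < e by near: t; exact: near_p.
  have [/(_ j) h _] := hxi _ pe.
  by rewrite distrC (le_lt_trans h)//; near: t; exact: near_p.
have : (fun t => \sum_j (a t * (p t 0 j - z 0 j)) * 'D_(std R j) G (xi (p t) j)) @ F
    --> \sum_j v j * 'D_(std R j) G z.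
  apply: cvg_big => [|j _]; first exact: add_continuous.
  apply: cvgM; first exact: av.
  exact: (cvg_comp _ _ (xiz j) (cG j)).
apply: cvg_trans; apply: near_eq_cvg; near=> t.
have pe : `|p t - z| < e by near: t; exact: near_p.
have [_ ->] := hxi _ pe.
by rewrite mulr_sumr; apply: eq_bigr => j _; rewrite mulrA.
Unshelve. all: by end_near. Qed.

End chain_rule.

(** * Functions of class C^k and their closure properties *)

Section Ck_functions.
Variable R : realType.

(** A product or a composition has no simple formula for its iterated partials, so [smooth_open] is
    awkward to propagate directly. Recursion on the order needs only the formula for one
    derivative. *)
Fixpoint Ck n (k : nat) (O : set 'rV[R]_n) (F : 'rV[R]_n -> R) : Prop :=
  (forall y, O y -> {for y, continuous F}) /\
  if k is k'.+1 then forall i, (forall y, O y -> derivable F y (std R i)) /\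
                        Ck k' O ('D_(std R i) F)
  else True.

Section one_space.
Variable n : nat.
Implicit Types (O : set 'rV[R]_n) (F G : 'rV[R]_n -> R).

Lemma Ck_continuous k O F : Ck k O F -> forall y, O y -> {for y, continuous F}.
Proof. by case: k => [|k] []. Qed.

Lemma Ck_derivable k O F i : Ck k.+1 O F -> forall y, O y -> derivable F y (std R i).
Proof. by case=> _ /(_ i)[]. Qed.

Lemma Ck_partial k O F i : Ck k.+1 O F -> Ck k O ('D_(std R i) F).
Proof. by case=> _ /(_ i)[]. Qed.

Lemma smooth_openP O F : smooth_open O F <-> forall k, Ck k O F.
Proof.
(* [foldr] differentiates first in the last direction of the list, whereas [Ck] peels off the first
   derivative taken; hence the induction from the right end. *)
have E s i G : iter_partial (rcons s i) G = iter_partial s ('D_(std R i) G).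
  by rewrite /iter_partial foldr_rcons.
split=> [sF k|cF s].
  elim: k F sF => [|k IH] F sF; first by split=> // y Oy; case: (sF [::] y Oy).
  split=> [y Oy|i]; first by case: (sF [::] y Oy).
  split=> [y Oy|]; first by case: (sF [::] y Oy).
  by apply: IH => s; rewrite -E; exact: sF.
elim/last_ind: s F cF => [|s i IH] F cF y Oy.
  split=> [|i]; first exact: (Ck_continuous (cF 0%N)).
  exact: (Ck_derivable (cF 1%N) Oy).
by rewrite E; apply: IH => // k; exact: (Ck_partial i (cF k.+1)).
Qed.

Lemma Ck_sub k O O' F : O' `<=` O -> Ck k O F -> Ck k O' F.
Proof.
move=> OO; elim: k F => [|k IH] F [cF dF].
  by split=> // y /OO; exact: cF.
split=> [y /OO|i]; first exact: cF.
by case: (dF i) => ? ?; split=> [y /OO|]; [auto|exact: IH].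
Qed.

Lemma CkW k O F : Ck k.+1 O F -> Ck k O F.
Proof.
elim: k F => [|k IH] F [cF dF]; first by [].
by split=> // i; case: (dF i) => ? ?; split=> //; exact: IH.
Qed.

Lemma Ck_eq k O F G : open O -> (forall y, O y -> F y = G y) -> Ck k O F -> Ck k O G.
Proof.
move=> oO; elim: k F G => [|k IH] F G FG.
all: have nFG y : O y -> {near y, F =1 G} by
  move=> Oy; apply: filterS (open_nbhs_nbhs (conj oO Oy)) => z /FG.
all: have cG : (forall y, O y -> {for y, continuous F}) ->
    forall y, O y -> {for y, continuous G} by
  move=> cF y Oy; rewrite /prop_for /continuous_at -(FG _ Oy);
  exact: cvg_trans (near_eq_cvg (nFG _ Oy)) (cF _ Oy).
  by case=> cF _; split=> //; exact: cG.
case=> cF dF; split=> [|i]; first exact: cG.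
case: (dF i) => dFi cFi; split=> [y Oy|].
  exact: near_eq_derivable (nFG _ Oy) (dFi _ Oy).
by apply: IH cFi => y Oy; apply: near_eq_derive; exact: nFG.
Qed.

Lemma Ck_cst k O (c : R) : Ck k O (fun=> c).
Proof.
elim: k c => [|k IH] c; first by split=> // y Oy; exact: cst_continuous.
split=> [y Oy|i]; first exact: cst_continuous.
split=> [y Oy|]; first exact: derivable_cst.
by rewrite (_ : 'D__ _ = fun=> 0)//; apply/funext => y; exact: derive_cst.
Qed.

Lemma Ck_add k O F G : open O -> Ck k O F -> Ck k O G -> Ck k O (fun y => F y + G y).
Proof.
move=> oO; elim: k F G => [|k IH] F G [cF dF] [cG dG].
  split=> // y Oy; apply: (@continuousD _ _ _ F G y); [exact: cF|exact: cG].
split=> [y Oy|i]; first by apply: (@continuousD _ _ _ F G y); [exact: cF|exact: cG].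
have [[dFi cFi] [dGi cGi]] := (dF i, dG i).
split=> [y Oy|]; first by apply: derivableD; auto.
apply: Ck_eq (IH _ _ cFi cGi) => // y Oy.
by rewrite (_ : (fun y => F y + G y) = F + G)// deriveD; auto.
Qed.

Lemma Ck_mul k O F G : open O -> Ck k O F -> Ck k O G -> Ck k O (fun y => F y * G y).
Proof.
move=> oO; elim: k F G => [|k IH] F G [cF dF] [cG dG].
  by split=> // y Oy; apply: (@continuousM _ _ F G y); [exact: cF|exact: cG].
split=> [y Oy|i]; first by apply: (@continuousM _ _ F G y); [exact: cF|exact: cG].
have [[dFi cFi] [dGi cGi]] := (dF i, dG i).
split=> [y Oy|]; first by apply: derivableM; auto.
apply: (@Ck_eq _ _ (fun y => F y * 'D_(std R i) G y + G y * 'D_(std R i) F y)) => //.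
  by move=> y Oy; rewrite (_ : (fun y => F y * G y) = F * G)// deriveM; auto.
by apply: Ck_add => //; apply: IH => //; apply: CkW; split.
Qed.

Lemma Ck_sum k O (I : finType) (P : pred I) (F : I -> 'rV[R]_n -> R) : open O ->
  (forall i, P i -> Ck k O (F i)) -> Ck k O (fun y => \sum_(i | P i) F i y).
Proof.
move=> oO cF; elim: (index_enum I) => [|i r IH].
  rewrite (_ : (fun y => _) = fun=> 0); first exact: Ck_cst.
  by apply/funext => y; rewrite big_nil.
have [Pi|Pi] := boolP (P i).
  rewrite (_ : (fun y => _) = fun y => F i y + \sum_(j <- r | P j) F j y).
    by apply: Ck_add => //; exact: cF.
  by apply/funext => y; rewrite big_cons Pi.
rewrite (_ : (fun y => _) = fun y => \sum_(j <- r | P j) F j y)//.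
by apply/funext => y; rewrite big_cons (negbTE Pi).
Qed.

Lemma Ck_prod k O (I : finType) (P : pred I) (F : I -> 'rV[R]_n -> R) : open O ->
  (forall i, P i -> Ck k O (F i)) -> Ck k O (fun y => \prod_(i | P i) F i y).
Proof.
move=> oO cF; elim: (index_enum I) => [|i r IH].
  rewrite (_ : (fun y => _) = fun=> 1); first exact: Ck_cst.
  by apply/funext => y; rewrite big_nil.
have [Pi|Pi] := boolP (P i).
  rewrite (_ : (fun y => _) = fun y => F i y * \prod_(j <- r | P j) F j y).
    by apply: Ck_mul => //; exact: cF.
  by apply/funext => y; rewrite big_cons Pi.
rewrite (_ : (fun y => _) = fun y => \prod_(j <- r | P j) F j y)//.
by apply/funext => y; rewrite big_cons (negbTE Pi).
Qed.

Lemma is_derive_coord (y v : 'rV[R]_n) j : is_derive y v (fun y => y 0 j) (v 0 j).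
Proof.
have E : (fun h : R => h^-1 *: ((h *: v + y) 0 j - y 0 j)) @ 0^' --> v 0 j.
  apply: cvg_near_cst; near=> h.
  rewrite !mxE addrK scalerA mulVf ?scale1r//.
  by near: h; exact: nbhs_dnbhs_neq.
by apply: DeriveDef; [apply/cvg_ex; exists (v 0 j)|exact: cvg_lim].
Unshelve. all: by end_near. Qed.

Lemma Ck_coord k O j : Ck k O (fun y : 'rV[R]_n => y 0 j).
Proof.
have c : forall y, O y -> {for y, continuous (fun y : 'rV[R]_n => y 0 j)}.
  by move=> y _; exact: matrix_normedtype.coord_continuous.
case: k => [|k]; first by split.
split=> // i; split=> [y _|]; first exact: (@ex_derive _ _ _ _ _ _ _ (is_derive_coord y _ j)).
rewrite (_ : 'D__ _ = fun=> std R i 0 j); first exact: Ck_cst.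
by apply/funext => y; exact: (@derive_val _ _ _ _ _ _ _ (is_derive_coord y _ j)).
Qed.

Lemma Ck_C1_at k O F y : open O -> Ck k.+1 O F -> O y -> C1_at F y.
Proof.
move=> oO cF Oy; split=> [|i]; last exact: (Ck_continuous (Ck_partial i cF)).
apply: filterS (open_nbhs_nbhs (conj oO Oy)) => w Ow i.
exact: (Ck_derivable cF).
Qed.

End one_space.

Lemma is_derive_comp n m (G : 'rV[R]_m -> R) (Phi : 'rV[R]_n -> 'rV[R]_m) (y v : 'rV[R]_n) :
  C1_at G (Phi y) -> {for y, continuous Phi} ->
  (forall j, derivable (fun y => Phi y 0 j) y v) ->
  is_derive y v (fun y => G (Phi y))
    (\sum_j 'D_v (fun y => Phi y 0 j) y * 'D_(std R j) G (Phi y)).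
Proof.
move=> cG cPhi dPhi.
have E : (fun h : R => h^-1 *: (G (Phi (h *: v + y)) - G (Phi y))) @ 0^' -->
    \sum_j 'D_v (fun y => Phi y 0 j) y * 'D_(std R j) G (Phi y).
  have c : (h *: v + y) @[h --> (0:R)^'] --> y.
    have c0 : (h *: v + y) @[h --> (0:R)] --> (0:R) *: v + y.
      by apply: cvgD; [exact: scalel_continuous|exact: cvg_cst].
    by rewrite scale0r add0r in c0; exact: cvg_within_filter.
  apply: (@chain_rule_filter R m R (0^') _ G (Phi y) (fun h => Phi (h *: v + y)) (fun h => h^-1)) => //.
  exact: (cvg_comp _ _ c cPhi).
by apply: DeriveDef; [apply/cvg_ex; eexists; exact: E|exact: cvg_lim].
Qed.

Lemma Ck_comp n m k (O : set 'rV[R]_n) (O' : set 'rV[R]_m) G (Phi : 'rV[R]_n -> 'rV[R]_m) :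
  open O -> open O' -> (forall y, O y -> O' (Phi y)) ->
  (forall j, Ck k O (fun y => Phi y 0 j)) -> Ck k O' G -> Ck k O (fun y => G (Phi y)).
Proof.
move=> oO oO' OO'; elim: k G => [|k IH] G cPhi cG.
all: have cP y : O y -> {for y, continuous Phi} by
  move=> Oy; apply: continuous_rV => j; exact: (Ck_continuous (cPhi j) Oy).
all: have cGP y : O y -> {for y, continuous (fun y => G (Phi y))} by
  move=> Oy; apply: (cvg_comp _ _ (cP _ Oy)); exact: (Ck_continuous cG (OO' _ Oy)).
  by split.
have dG i y : O y -> is_derive y (std R i) (fun y => G (Phi y))
    (\sum_j 'D_(std R i) (fun y => Phi y 0 j) y * 'D_(std R j) G (Phi y)).
  move=> Oy; apply: is_derive_comp => [|//|j]; last exact: (Ck_derivable (cPhi j)).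
    exact: (Ck_C1_at oO' cG (OO' _ Oy)).
  exact: cP.
split=> // i; split=> [y Oy|]; first exact: (@ex_derive _ _ _ _ _ _ _ (dG i _ Oy)).
apply: (@Ck_eq _ _ _ (fun y => \sum_j 'D_(std R i) (fun y => Phi y 0 j) y * 'D_(std R j) G (Phi y))) => //.
  by move=> y Oy; rewrite (@derive_val _ _ _ _ _ _ _ (dG i _ Oy)).
apply: Ck_sum => // j _; apply: Ck_mul => //; first exact: Ck_partial.
by apply: (IH ('D_(std R j) G)) => [j'|]; [exact: CkW|exact: Ck_partial].
Qed.

End Ck_functions.

(** * The flat function exp(-1/x) *)

Section flat_function.
Variable R : realType.

(** The polynomial factor in 1/x makes the family closed under differentiation, so that smoothness
    follows by induction on the order. *)
Definition flat (p : {poly R}) (x : R) : R :=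
  if 0 < x then p.[x^-1] * expR (- x^-1) else 0.

(** With s = 1/x >= 1 and m the size of p, |p(s)| <= S s^m and exp(s) >= s^(m+1)/(m+1)!, so the
    quotient is at most S (m+1)!/s. *)
Lemma flat_bound p : exists C, forall x, `|x| <= 1 -> `|flat p x| <= C * `|x|.
Proof.
pose m := size p; pose S := \sum_(i < m) `|p`_i|.
have S0 : 0 <= S by exact: sumr_ge0.
exists (S * m.+1`!%:R) => x; rewrite /flat; case: ifPn => [x0 x1|_ _]; last first.
  by rewrite normr0 !mulr_ge0.
rewrite ger0_norm in x1; last exact: ltW.
rewrite normrM (ger0_norm (expR_ge0 _)) (ger0_norm (ltW x0)).
set s := x^-1; have s1 : 1 <= s by rewrite /s invf_ge1.
have s0 : 0 < s by exact: lt_le_trans s1.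
have ps : `|p.[s]| <= S * s ^+ m.
  rewrite horner_coef (le_trans (ler_norm_sum _ _ _))// mulr_suml ler_sum// => i _.
  rewrite normrM ler_wpM2l// normrX gtr0_norm//.
  by apply: ler_weXn2l => //; exact: ltnW.
have es : s ^+ m.+1 / m.+1`!%:R <= expR s.
  by apply: le_trans (expR_ge1Dxn m (ltW s0)); rewrite lerDr.
have f0 : 0 < m.+1`!%:R :> R by rewrite ltr0n fact_gt0.
rewrite expRN; apply: (@le_trans _ _ (S * s ^+ m * (s ^+ m.+1 / m.+1`!%:R)^-1)).
  by apply: ler_pM => //; rewrite lef_pV2 ?posrE ?expR_gt0 ?divr_gt0 ?exprn_gt0.
rewrite invfM invrK exprS invfM.
have sm0 : s ^+ m != 0 by rewrite expf_neq0// gt_eqF.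
by rewrite -/s -[x]invrK -/s; rewrite le_eqVlt; apply/orP; left; apply/eqP; field; rewrite sm0 gt_eqF.
Qed.

Lemma is_derive_flat p (x : R) : is_derive x 1 (flat p) (flat ('X^2 * (p - p^`())) x).
Proof.
have [x0|x0|->] := ltgtP x 0.
- have E : {near x, cst 0 =1 flat p}.
    near=> z; rewrite /flat ifF//; apply/negbTE; rewrite -leNgt ltW//.
    by near: z; exact: lt_nbhsl.
  rewrite {2}/flat ltNge (ltW x0)/=.
  by apply: near_eq_is_derive E _; exact: is_derive_cst.
- pose f := (fun z : R => p.[z^-1] * expR (- z^-1)).
  have E : {near x, f =1 flat p}.
    near=> z; rewrite /flat ifT//.
    by near: z; exact: lt_nbhsr.
  rewrite {2}/flat x0.
  apply: near_eq_is_derive E _.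
  have xn0 : x != 0 by rewrite gt_eqF.
  have dV : is_derive x 1 (fun z : R => z^-1) (- x^-2).
    by have := @is_deriveV R id x 1 1 xn0 (is_derive_id _ _); rewrite [_ *: _]mulr1.
  have dp : is_derive x^-1 1 (horner p) p^`().[x^-1].
    by apply: DeriveDef; [exact: derivable_horner|rewrite derivE derive1E].
  have dpV := @is_derive1_comp R (horner p) (fun z => z^-1) x _ _ dp dV.
  have dNV : is_derive x 1 (fun z : R => - z^-1) (- - x^-2) by exact: is_deriveN.
  have deV := @is_derive1_comp R expR (fun z => - z^-1) x _ _ (is_derive_expR _) dNV.
  have h : is_derive x 1 f _ := is_deriveM dpV deV.
  apply: (is_derive_eq h) => /=; rewrite !hornerE /= /GRing.scale /=.
  by field.
(* At 0 the difference quotient of [flat p] is [flat ('X * p)], which tends to 0 by its linear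
   bound. *)
- have [C hC] := flat_bound p; have [D hD] := flat_bound ('X * p).
  rewrite {2}/flat ltxx.
  have E : (fun h : R => h^-1 *: (flat p (h *: (1:R) + 0) - flat p 0)) @ 0^' --> (0 : R).
    have : (fun h : R => `|flat ('X * p) h|) @ 0^' --> (0:R).
      apply: (@squeeze_cvgr _ _ _ _ (fun=> 0) (fun h : R => D * `|h|)).
      - near=> h; rewrite normr_ge0/=; apply: hD.
        by near: h; apply: dnbhs0_le.
      - exact: cvg_cst.
      - have n0 : (`|h| @[h --> (0:R)^'] --> `|0:R|)%R.
          by apply: (@cvg_norm R R R (0^') _ id 0); exact: cvg_within.
        rewrite normr0 in n0; rewrite -[X in _ --> X](mulr0 D).
        by apply: cvgM; first exact: cvg_cst.
    move/norm_cvg0P.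
    apply: cvg_trans; apply: near_eq_cvg; near=> h.
    rewrite [h *: 1]mulr1 addr0 {3}/flat ltxx subr0 /flat; case: ifP => _; rewrite ?scaler0//.
    by rewrite hornerM hornerX /GRing.scale /= ?mulrA.
  by apply: DeriveDef; [apply/cvg_ex; exists 0|exact: cvg_lim].
Unshelve. all: by end_near. Qed.

Lemma is_derive_comp1 (V : normedModType R) (f : R -> R) (F : V -> R) (y v : V) df :
  is_derive (F y) 1 f df -> derivable F y v ->
  is_derive y v (fun y => f (F y)) (df * 'D_v F y).
Proof.
move=> df' dF.
have d1 : is_derive (0 : R) 1 (fun h => F (y + h *: v)) ('D_v F y).
  have := @derivable_line R V R F y v 0; rewrite scale0r addr0; exact.
have := @is_derive1_comp R f (fun h => F (y + h *: v)) 0 df ('D_v F y).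
rewrite scale0r addr0 => /(_ df' d1)[d2 d3].
have E : (fun h : R => h^-1 *: (((f \o (fun h => F (y + h *: v))) (h *: (1:R) + 0)) -
             (f \o (fun h => F (y + h *: v))) 0)) =
         (fun h : R => h^-1 *: (f (F (h *: v + y)) - f (F y))).
  by apply/funext => h /=; rewrite [h *: 1]mulr1 addr0 scale0r addr0 [y + _]addrC.
apply: DeriveDef; first exact: (eq_ind _ (fun g : R -> R => cvg (g @ 0^')) d2 _ E).
rewrite -d3; exact: (congr1 (fun g : R -> R => lim (g @ 0^')) (esym E)).
Qed.

Lemma Ck_flat n p k (O : set 'rV[R]_n) F : open O -> Ck k O F -> Ck k O (fun y => flat p (F y)).
Proof.
move=> oO; elim: k p F => [|k IH] p F cF.
all: have c y : O y -> {for y, continuous (fun y => flat p (F y))} by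
  move=> Oy; apply: (cvg_comp _ _ (Ck_continuous cF Oy));
  apply/differentiable_continuous/derivable1_diffP;
  exact: (@ex_derive _ _ _ _ _ _ _ (is_derive_flat p (F y))).
  by split.
split=> // i.
have d y : O y -> is_derive y (std R i) (fun y => flat p (F y))
    (flat ('X^2 * (p - p^`())) (F y) * 'D_(std R i) F y).
  by move=> Oy; apply: is_derive_comp1 (is_derive_flat _ _) (Ck_derivable cF Oy).
split=> [y Oy|]; first exact: (@ex_derive _ _ _ _ _ _ _ (d _ Oy)).
apply: (@Ck_eq _ _ _ _ (fun y => flat ('X^2 * (p - p^`())) (F y) * 'D_(std R i) F y)) => //.
  by move=> y Oy; rewrite (@derive_val _ _ _ _ _ _ _ (d _ Oy)).
by apply: Ck_mul => //; [apply: IH; exact: CkW|exact: Ck_partial].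
Qed.

End flat_function.

(** * Lebesgue measure on R^n and the du Bois-Reymond lemma *)

Section measurability.
Variable R : realType.
Local Notation RM := (measurableTypeR R).

Lemma measurable_fun_open_itv d (T : measurableType d) (D : set T) (f : T -> R) :
  (forall a b, measurable (D `&` f @^-1` `]a, b[%classic)) -> measurable_fun D f.
Proof.
move=> h mD; apply: (measurability _ (RGenOpens.measurableE R)) => //.
by move=> _ [_ [a [b ->]] <-]; exact: h.
Qed.

Variable n : nat.

Lemma invS_lt (e : R) : 0 < e -> exists m : nat, m.+1%:R^-1 < e.
Proof.
by move=> e0; exists (Num.truncn e^-1); rewrite invf_plt ?posrE ?truncnS_gt.
Qed.

(** Cubes are kept when their closure lies in [O]: the open cubes still cover [O], and bumps
    supported in the closed ones are test functions on [O]. Rejected indices contribute the empty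
    set, so that the union runs over a fixed countable type. *)
Lemma open_rational_cover (O : set 'rV[R]_n) : open O ->
  O = \bigcup_k (if `[< [set y : 'rV[R]_n | forall i, `|y 0 i - ratr ((k : 'rV[rat]_n * nat).1 0 i)| <= k.2.+1%:R^-1] `<=` O >]
      then [set y : 'rV[R]_n | forall i, `|y 0 i - ratr (k.1 0 i)| < k.2.+1%:R^-1] else set0).
Proof.
move=> oO; apply/seteqP; split=> [y Oy|y [k _]]; last by case: asboolP => // kO h; apply: kO => i; exact/ltW/h.
have /nbhs_ballP[e /= e0 eO] := open_nbhs_nbhs (conj oO Oy).
have e20 : 0 < e / 2 by rewrite divr_gt0.
have [m me] := invS_lt e20.
have : 0 < m.+1%:R^-1 :> R by rewrite invr_gt0.
set d := m.+1%:R^-1 in me * => d0.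
have ex i : exists q : rat, `|y 0 i - ratr q| < d.
  have : y 0 i - d < y 0 i + d by clearbody d; lra.
  move=> /rat_in_itvoo[q]; rewrite in_itv/= => /andP[q1 q2]; exists q.
  by rewrite ltr_norml; apply/andP; clearbody d; split; lra.
have [q hq] := choice ex.
exists (\row_i q i, m) => //=; rewrite -/d.
case: asboolP => [_ i|[]]; first by rewrite mxE.
move=> z hz; apply: eO; rewrite -ball_normE/=; apply/rV_norm_ltP => // i.
have := hz i; have := hq i; rewrite !mxE/=; clearbody d.
rewrite ltr_norml ler_norml => /andP[? ?] /andP[? ?]; rewrite ltr_norml; apply/andP; split; lra.
Qed.

Lemma measurable_box (I : 'I_n -> set RM) : (forall i, measurable (I i)) ->
  measurable [set t : n.-tuple RM | forall i, I i (tnth t i)].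
Proof.
move=> mI; rewrite (_ : [set t | _] = \big[setI/setT]_(i < n) [set t : n.-tuple RM | I i (tnth t i)]); last first.
  apply/seteqP; split=> t /=; rewrite -bigcap_seq/=; first by move=> h i _; exact: h.
  by move=> h i; apply: h => /=; rewrite mem_index_enum.
apply: big_ind => [//|A B|i _]; first exact: measurableI.
have := @measurable_tnth _ RM n i measurableT (I i) (mI i).
by rewrite setTI.
Qed.

(** Tuples carry the product sigma-algebra, which is not defined from the topology of ['rV]; the
    countable cover by cubes links the two. *)
Lemma measurable_vec_open (O : set 'rV[R]_n) : open O ->
  measurable [set t : n.-tuple RM | O (vec t)].
Proof.
move=> oO; rewrite {1}(open_rational_cover oO).
rewrite (_ : [set t | _] = \bigcup_(k : 'rV[rat]_n * nat)
   (if `[< [set y : 'rV[R]_n | forall i, `|y 0 i - ratr ((k : 'rV[rat]_n * nat).1 0 i)| <= k.2.+1%:R^-1] `<=` O >]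
      then [set t : n.-tuple RM | forall i, `|tnth t i - ratr (k.1 0 i)| < k.2.+1%:R^-1] else set0)); last first.
  apply/seteqP; split=> t /= [k _]; case: asboolP => // h hk; exists k => //; rewrite asboolT// => i.
    by have := hk i; rewrite mxE.
  by rewrite mxE; exact: hk.
apply: countable_bigcupT_measurable => [|k]; first exact: countableP.
case: ifP => _ //.
apply: (@measurable_box (fun i => [set x : RM | `|x - ratr (k.1 0 i)| < k.2.+1%:R^-1])) => i.
rewrite (_ : [set x | _] = `]ratr (k.1 0 i) - k.2.+1%:R^-1, ratr (k.1 0 i) + k.2.+1%:R^-1[%classic); first exact: measurable_itv.
by apply/seteqP; split=> x /=; rewrite in_itv/= ltr_distl.
Qed.

Lemma measurable_vec_closed (O : set 'rV[R]_n) : closed O ->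
  measurable [set t : n.-tuple RM | O (vec t)].
Proof.
move=> cO; rewrite -[X in measurable X]setCK; apply: measurableC.
by apply: (@measurable_vec_open (~` O)); exact: closed_openC.
Qed.

Lemma measurable_fun_vec (V : set 'rV[R]_n) (f : 'rV[R]_n -> R) : open V ->
  (forall y, V y -> {for y, continuous f}) ->
  measurable_fun [set t : n.-tuple RM | V (vec t)] (fun t => f (vec t)).
Proof.
move=> oV cf; apply: measurable_fun_open_itv => a b.
rewrite (_ : _ `&` _ = [set t | (V `&` f @^-1` `]a, b[%classic) (vec t)])//.
apply: measurable_vec_open; rewrite openE => y [Vy fy].
apply: filterI; first exact: open_nbhs_nbhs.
by apply: (cf _ Vy); apply: open_nbhs_nbhs; split=> //; exact: interval_open.
Qed.

Definition obox (a b : 'I_n -> R) : set (n.-tuple RM) :=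
  [set t | forall i, a i < tnth t i < b i].

Lemma measurable_obox a b : measurable (obox a b).
Proof.
apply: (@measurable_box (fun i => `]a i, b i[%classic : set RM)) => i.
exact: measurable_itv.
Qed.

Definition oboxes := [set A | exists a b, A = obox a b].

Lemma oboxes_setI : setI_closed oboxes.
Proof.
move=> _ _ [a [b ->]] [c [d ->]].
exists (fun i => Num.max (a i) (c i)), (fun i => Num.min (b i) (d i)).
apply/seteqP; split=> t /=.
  by move=> [h1 h2] i; move: (h1 i) (h2 i); rewrite gt_max lt_min => /andP[-> ->] /andP[-> ->].
by move=> h; split=> i; move: (h i); rewrite gt_max lt_min => /andP[/andP[? ?] /andP[? ?]]; apply/andP.
Qed.

Lemma oboxes_cover : \bigcup_k obox (fun=> - k%:R) (fun=> k%:R) = setT.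
Proof.
apply/seteqP; split=> // t _.
pose s := \sum_i `|tnth t i|.
exists (Num.truncn s).+1 => //= i.
rewrite -ltr_norml; apply: le_lt_trans (truncnS_gt _).
by rewrite /s (bigD1 i)//= lerDl sumr_ge0.
Qed.

(** Together with [oboxes_setI] and [oboxes_cover], this is what uniqueness of measures asks of the
    open boxes. *)
Lemma measurable_tupleE : @measurable _ (n.-tuple RM) = <<s oboxes >>.
Proof.
apply/seteqP; split; last first.
  apply: smallest_sub; first exact: sigma_algebra_measurable.
  by move=> _ [a [b ->]]; exact: measurable_obox.
apply: smallest_sub; first exact: smallest_sigma_algebra.
rewrite -bigcup_seq/= => A [i _ [B mB <-]]; rewrite setTI.
have mi : measurable_fun (setT : set (g_sigma_algebraType oboxes)) (fun t : g_sigma_algebraType oboxes => tnth t i : R).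
  apply: measurable_fun_open_itv => a b.
  rewrite setTI (_ : _ @^-1` _ = \bigcup_k obox (fun j => if j == i then a else - k%:R) (fun j => if j == i then b else k%:R)).
    by apply: bigcupT_measurable => k; apply: sub_sigma_algebra; eexists; eexists.
  apply/seteqP; split=> t /=; rewrite in_itv/=.
    move=> tab; have [k _ /= hk] : (\bigcup_k obox (fun=> - k%:R) (fun=> k%:R)) t by rewrite oboxes_cover.
    by exists k => //= j; have [->//|_] := eqVneq j i; exact: hk.
  by move=> [k _ /(_ i)/=]; rewrite eqxx.
by have := mi measurableT B mB; rewrite setTI.
Qed.

End measurability.

(** * Fubini, cubes and lines for Lebesgue measure on tuples *)

Section leb_theory.
Variable R : realType.
Local Notation RM := (measurableTypeR R).
Local Notation mu1 := (@lebesgue_measure R).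

Section pushforward.
Variable n : nat.

Lemma measurable_tcons : measurable_fun setT (@tcons R n).
Proof. exact: measurable_cons. Qed.

Lemma ge0_integral_leb_cons (f : n.+1.-tuple RM -> \bar R) :
  measurable_fun setT f -> (forall t, 0 <= f t)%E ->
  (\int[leb R n.+1]_t f t = \int[mu1 \x leb R n]_p f (tcons p))%E.
Proof.
move=> mf f0.
by have := @ge0_integral_pushforward _ _ _ _ R _ measurable_tcons
  (mu1 \x leb R n)%E setT f measurableT mf (fun t _ => f0 t).
Qed.

Lemma integrable_leb_cons (f : n.+1.-tuple RM -> \bar R) :
  (leb R n.+1).-integrable setT f ->
  (mu1 \x leb R n)%E.-integrable setT (fun p => f (tcons p)).
Proof.
move=> /integrableP[mf fi]; apply/integrableP; split.
  exact: (measurableT_comp mf measurable_tcons).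
rewrite -(@ge0_integral_leb_cons (fun t => `|f t|%E))//.
exact: measurableT_comp mf.
Qed.

Lemma integral_leb_cons (f : n.+1.-tuple RM -> \bar R) :
  (leb R n.+1).-integrable setT f ->
  (\int[leb R n.+1]_t f t = \int[mu1 \x leb R n]_p f (tcons p))%E.
Proof.
move=> fi; have /integrableP[mf _] := fi.
have gi := integrable_leb_cons fi.
by have := @integral_pushforward _ _ _ _ R _ measurable_tcons
  (mu1 \x leb R n)%E setT f mf gi measurableT.
Qed.

Lemma integral_leb_cons12 (f : n.+1.-tuple RM -> \bar R) :
  (leb R n.+1).-integrable setT f ->
  (\int[leb R n.+1]_t f t = \int[mu1]_x \int[leb R n]_t f (tcons (x, t)))%E.
Proof.
move=> fi; rewrite integral_leb_cons// -integral12_prod_meas1//.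
exact: integrable_leb_cons.
Qed.

Lemma integral_leb_cons21 (f : n.+1.-tuple RM -> \bar R) :
  (leb R n.+1).-integrable setT f ->
  (\int[leb R n.+1]_t f t = \int[leb R n]_t \int[mu1]_x f (tcons (x, t)))%E.
Proof.
move=> fi; rewrite integral_leb_cons// -integral21_prod_meas1//.
exact: integrable_leb_cons.
Qed.

Lemma leb_consX (A : set RM) (B : set (n.-tuple RM)) (C : set (n.+1.-tuple RM)) :
  measurable A -> measurable B -> @tcons R n @^-1` C = A `*` B ->
  leb R n.+1 C = (mu1 A * leb R n B)%E.
Proof.
by move=> mA mB CE; rewrite -(product_measure1E _ _ mA mB) -CE.
Qed.

End pushforward.

Definition cube n (z : 'I_n -> R) (r : R) : set (n.-tuple RM) :=
  [set t | forall i, `|tnth t i - z i| <= r].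

Lemma measurable_cube n z r : measurable (@cube n z r).
Proof.
apply: (@measurable_box R n (fun i => [set x : RM | `|x - z i| <= r])) => i.
rewrite (_ : [set x | _] = `[z i - r, z i + r]%classic); first exact: measurable_itv.
by apply/seteqP; split=> x /=; rewrite in_itv/= ler_distl.
Qed.

Lemma leb_cube n z r : 0 <= r -> leb R n (cube z r) = ((2 * r) ^+ n)%:E.
Proof.
move=> r0; elim: n z => [|n IH] z.
  rewrite expr0 /= /cube diracE mem_set// => -[]//.
rewrite (@leb_consX n `[z ord0 - r, z ord0 + r]%classic (cube (fun i => z (lift ord0 i)) r)).
- rewrite IH exprS lebesgue_measure_itv/= lte_fin EFinM; congr (_ * _)%E.
  case: ifPn => [_|]; first by rewrite EFinN -EFinB; congr (_%:E); ring.
  by rewrite -leNgt => h; congr (_%:E); lra.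
- exact: measurable_itv.
- exact: measurable_cube.
apply/seteqP; split=> -[x t] /=; rewrite in_itv/=.
  move=> h; split; first by have := h ord0; rewrite tnth0 ler_distl.
  by move=> i; have := h (lift ord0 i); rewrite tnthS.
rewrite -ler_distl => -[h0 h] i; case: (unliftP ord0 i) => [j|] ->; last by rewrite tnth0.
by rewrite tnthS; exact: h.
Qed.

(** Coordinate 0 is the one that bounds the model half-space, so this hyperplane (with c = 0)
    contains the boundary points of every chart. *)
Lemma leb_hyperplane n (i : 'I_n) c : val i = 0%N -> leb R n [set t | tnth t i = c] = 0%E.
Proof.
case: n i => [[]//|n] i i0.
rewrite (@leb_consX n [set c] setT)//; first by rewrite lebesgue_measure_set1 mul0e.
have -> : i = ord0 by apply: val_inj.
by apply/seteqP; split=> -[x t] /=; rewrite tnth0 => // -[].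
Qed.

Definition upd n (i : 'I_n) (s : R) (t : n.-tuple RM) : n.-tuple RM :=
  [tuple if j == i then s else tnth t j | j < n].

Lemma upd_tcons0 n s x (t : n.-tuple RM) : upd ord0 s (tcons (x, t)) = tcons (s, t).
Proof.
apply: eq_from_tnth => j; rewrite tnth_mktuple.
by case: (unliftP ord0 j) => [k|] ->; rewrite ?tnth0 ?tnthS.
Qed.

Lemma upd_tconsS n (i : 'I_n) s x (t : n.-tuple RM) :
  upd (lift ord0 i) s (tcons (x, t)) = tcons (x, upd i s t).
Proof.
apply: eq_from_tnth => j; rewrite tnth_mktuple.
case: (unliftP ord0 j) => [k|] ->; rewrite ?tnth0 ?tnthS//.
by rewrite (inj_eq (lift_inj (h := ord0))) tnth_mktuple.
Qed.

Lemma bounded_cube_integrable n (f : n.-tuple RM -> R) (C B : R) : 0 <= B ->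
  measurable_fun setT f -> (forall t, `|f t| <= C) ->
  (forall t, ~ cube (fun=> 0) B t -> f t = 0) ->
  (leb R n).-integrable setT (EFin \o f).
Proof.
move=> B0 mf fC f0; apply/integrableP; split; first exact/measurable_EFinP.
have C0 : 0 <= C by apply: le_trans (fC [tuple 0 | i < n]).
apply: (@le_lt_trans _ _ (\int[leb R n]_t ((C%:E) * (\1_(cube (fun=> 0) B) t)%:E))%E).
  have m1 : measurable_fun setT (fun t => `|(f t)%:E|%E).
    by apply: measurableT_comp => //; exact/measurable_EFinP.
  have m2 : measurable_fun setT (fun t : n.-tuple RM => (C%:E * (\1_(cube (fun=> 0) B) t)%:E)%E).
    apply/measurable_EFinP; apply: measurable_funM => //.
    exact: measurable_indic (measurable_cube _ _).
  apply: ge0_le_integral => //.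
  move=> t _ /=; rewrite -EFinM lee_fin indicE.
  have [/set_mem tc|/negP tc] := boolP (t \in cube (fun=> 0) B); first by rewrite mulr1.
  by rewrite f0 ?normr0 ?mulr0// => h; apply: tc; rewrite inE.
rewrite ge0_integralZl_EFin//; last first.
  by apply/measurable_EFinP; apply: measurable_indic; exact: measurable_cube.
rewrite integral_indic ?setIT//; last exact: measurable_cube.
by rewrite [X in (_ * X)%E](leb_cube (fun=> 0) B0) -EFinM ltry.
Qed.

(** [leb] only splits off the head coordinate, hence the induction: coordinates before [i] become
    outer integrals, and at [i] itself the order is exchanged so that the integral along the line is
    innermost. *)
Lemma integral_line_eq0 n (i : 'I_n) (f : n.-tuple RM -> R) (C B : R) : 0 <= B ->
  measurable_fun setT f -> (forall t, `|f t| <= C) ->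
  (forall t, ~ cube (fun=> 0) B t -> f t = 0) ->
  (forall t, \int[mu1]_s (f (upd i s t))%:E = 0)%E ->
  (\int[leb R n]_t (f t)%:E = 0)%E.
Proof.
move=> B0; elim: n i f => [[]//|n IH] i f mf fC f0.
have fi := bounded_cube_integrable B0 mf fC f0.
case: (unliftP ord0 i) => [j|] -> line.
  rewrite (integral_leb_cons12 fi); apply: integral0_eq => x _ /=.
  apply: (IH j) => //.
  - apply: (measurableT_comp mf); apply: (measurableT_comp (@measurable_tcons n)).
    exact: measurable_pair1.
  - move=> t tc; apply: f0 => h; apply: tc => k; have := h (lift ord0 k).
    by rewrite tnthS.
  - by move=> t; have := line (tcons (x, t)); under eq_integral do rewrite upd_tconsS.
rewrite (integral_leb_cons21 fi); apply: integral0_eq => t _ /=.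
by have := line (tcons (0, t)); under eq_integral do rewrite upd_tcons0.
Qed.

End leb_theory.

(** * The integral of a compactly supported partial derivative vanishes *)

Section partial_integral.
Variable R : realType.
Local Notation RM := (measurableTypeR R).
Local Notation mu1 := (@lebesgue_measure R).
Variable n : nat.
Implicit Types (V K : set 'rV[R]_n) (f u : 'rV[R]_n -> R).

Lemma cube_normP (B : R) (t : n.-tuple RM) : 0 <= B ->
  cube (fun=> 0) B t <-> `|vec t| <= B.
Proof.
move=> B0; split=> [h|/rV_norm_leP h i].
  by apply/rV_norm_leP => // i; have := h i; rewrite subr0 mxE.
by have := h B0 i; rewrite mxE subr0.
Qed.

Lemma compact_norm_bounded K : compact K -> exists2 B, 0 <= B & forall y, K y -> `|y| <= B.
Proof.
move=> /compact_bounded[B [_ hB]]; exists (`|B| + 1) => [|y Ky]; first by rewrite addr_ge0.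
by apply: (hB (`|B| + 1)) => //; rewrite (le_lt_trans (ler_norm B))// ltrDl.
Qed.

Lemma continuous_compact_bound K f : compact K -> {within K, continuous f} ->
  exists2 C, 0 <= C & forall y, K y -> `|f y| <= C.
Proof.
move=> cK cf; have /compact_bounded[C [_ hC]] := continuous_compact cf cK.
exists (`|C| + 1) => [|y Ky]; first by rewrite addr_ge0.
by apply: (hC (`|C| + 1)); [rewrite (le_lt_trans (ler_norm C))// ltrDl|exists y].
Qed.

Lemma continuous_support_bound K f : compact K -> continuous f ->
  (forall y, ~ K y -> f y = 0) -> exists2 C, 0 <= C & forall y, `|f y| <= C.
Proof.
move=> cK cf f0.
have [C C0 hC] := continuous_compact_bound cK (continuous_subspaceT cf).
exists C => // y; have [/hC//|/f0 ->] := pselect (K y).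
by rewrite normr0.
Qed.

Lemma continuous_support_integrable K f : compact K -> continuous f ->
  (forall y, ~ K y -> f y = 0) -> (leb R n).-integrable setT (fun t => (f (vec t))%:E).
Proof.
move=> cK cf f0.
have [C C0 hC] := continuous_support_bound cK cf f0.
have [B B0 hB] := compact_norm_bounded cK.
apply: (@bounded_cube_integrable R n _ C B) => //.
- have := @measurable_fun_vec R n setT f openT (fun y _ => cf y).
  by rewrite (_ : [set t | _] = setT)//; apply/seteqP.
- move=> t tB; apply: f0 => /hB; exact/cube_normP.
Qed.

Lemma integral_partial_eq0 K (i : 'I_n) f : compact K ->
  (forall y, derivable f y (std R i)) -> continuous ('D_(std R i) f) ->
  (forall y, ~ K y -> f y = 0) -> (forall y, ~ K y -> 'D_(std R i) f y = 0) ->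
  (\int[leb R n]_t ('D_(std R i) f (vec t))%:E = 0)%E.
Proof.
move=> cK df cD f0 D0.
have [C C0 hC] := continuous_support_bound cK cD D0.
have [B B0 hB] := compact_norm_bounded cK.
have big y : B < `|y| -> ~ K y by move=> By /hB; rewrite leNgt By.
apply: (@integral_line_eq0 R n i _ C B) => //.
- have := @measurable_fun_vec R n setT ('D_(std R i) f) openT (fun y _ => cD y).
  by rewrite (_ : [set t | _] = setT)//; apply/seteqP.
- by move=> t tB; apply: D0 => /hB; exact/cube_normP.
move=> t; pose y0 := vec (upd i 0 t).
have E s : vec (upd i s t) = y0 + s *: std R i.
  apply/rowP => j; rewrite !mxE eqxx !tnth_mktuple/=.
  by have [ji|ji] := eqVneq j i; rewrite ?ji ?add0r ?mulr1 ?mulr0 ?addr0.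
transitivity (\int[mu1]_s ('D_(std R i) f (y0 + (s : R) *: std R i))%:E)%E.
  by apply: eq_integral => s _; rewrite E.
(* [y0] has i-th coordinate 0, so [s] is a coordinate of the point on the line. *)
have ls (s : R) : `|s| <= `|y0 + s *: std R i|.
  apply: (@le_trans _ _ `|(y0 + s *: std R i) 0 i|); last exact: rV_coord_le.
  by rewrite !mxE !eqxx tnth_mktuple eqxx add0r mulr1.
pose g (s : R) := f (y0 + s *: std R i).
have dg (s : R) : is_derive s 1 g ('D_(std R i) f (y0 + s *: std R i)).
  by apply: derivable_line; exact: df.
have cg' : continuous (fun s : R => 'D_(std R i) f (y0 + s *: std R i)).
  move=> s; apply: (@continuous_comp _ _ _ (fun s : R => y0 + s *: std R i) ('D_(std R i) f)); last exact: cD.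
  by apply: continuousD; [exact: cst_continuous|exact: scalel_continuous].
have cg : continuous g.
  by move=> s; apply/differentiable_continuous/derivable1_diffP; exact: (@ex_derive _ _ _ _ _ _ _ (dg s)).
(* The endpoints must lie strictly outside the ball of radius [B] that contains the support; then
   [f] is 0 at both. *)
have B1 : - (B + 1) < B + 1 by lra.
have := @continuous_FTC2 R _ g _ _ B1 (continuous_subspaceT cg').
rewrite [g (B + 1)]f0 ?[g (- (B + 1))]f0 ?subee//; last 2 first.
- by apply: big; apply: lt_le_trans (ls _); rewrite normrN ger0_norm; lra.
- by apply: big; apply: lt_le_trans (ls _); rewrite ger0_norm; lra.
move=> <-; last 2 first.
- split=> [s _||]; first exact: (@ex_derive _ _ _ _ _ _ _ (dg s)).
  + exact/cvg_at_right_filter/cg.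
  + exact/cvg_at_left_filter/cg.
- by move=> s _; rewrite derive1E (@derive_val _ _ _ _ _ _ _ (dg s)).
rewrite [RHS]integral_mkcond; apply: eq_integral => s _; rewrite patchE.
case: ifPn => // /negP sB; rewrite D0//; apply: big.
apply: lt_le_trans (ls s); rewrite ltNge; apply/negP; rewrite ler_norml => /andP[s1 s2].
by apply: sB; rewrite inE/= in_itv/=; apply/andP; split; lra.
Qed.

End partial_integral.

(** * Integration by parts against test functions *)

Section integration_by_parts.
Variable R : realType.
Local Notation RM := (measurableTypeR R).
Variable n : nat.
Implicit Types (V K : set 'rV[R]_n) (f u : 'rV[R]_n -> R).

Lemma rV_hausdorff : hausdorff_space 'rV[R]_n.
Proof. exact: norm_hausdorff. Qed.

Lemma partial_out_closed K f (v : 'rV[R]_n) y : closed K -> (forall z, ~ K z -> f z = 0) ->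
  ~ K y -> derivable f y v /\ 'D_v f y = 0.
Proof.
move=> cK f0 Ky; have E : {near y, cst 0 =1 f}.
  apply: filterS (open_nbhs_nbhs (conj (closed_openC cK) Ky)) => z /f0 -> //.
split; first by apply: near_eq_derivable E _; exact: derivable_cst.
by rewrite -(near_eq_derive _ E) derive_cst.
Qed.

Lemma patch_continuous V K f : open V -> closed K -> K `<=` V ->
  (forall y, V y -> {for y, continuous f}) -> (forall y, V y -> ~ K y -> f y = 0) ->
  continuous (f \_ V).
Proof.
move=> oV cK KV cf f0 y; have [Vy|Vy] := pselect (V y).
  have E : {near y, f =1 (f \_ V)}.
    apply: filterS (open_nbhs_nbhs (conj oV Vy)) => z Vz; by rewrite patchE mem_set.
  rewrite /continuous_at patchE mem_set//.
  exact: cvg_trans (near_eq_cvg E) (cf _ Vy).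
have Ky : ~ K y by move=> /KV.
have E : {near y, cst 0 =1 (f \_ V)}.
  apply: filterS (open_nbhs_nbhs (conj (closed_openC cK) Ky)) => z Kz.
  by rewrite patchE; case: ifPn => // /set_mem Vz; rewrite f0.
rewrite /continuous_at patchE memNset//.
by apply: cvg_trans (near_eq_cvg E) _; exact: cvg_cst.
Qed.

(** The support of [eta] is compact in [V], so [u * eta] extended by 0 has a continuous i-th partial
    on the whole space, and this partial integrates to 0. *)
Lemma integral_by_parts V (i : 'I_n) u eta : open V ->
  (forall y, V y -> {for y, continuous u}) ->
  (forall y, V y -> derivable u y (std R i)) ->
  (forall y, V y -> {for y, continuous ('D_(std R i) u)}) ->
  test_function V eta ->
  \int[leb R n]_(t in [set t | V (vec t)]) (u (vec t) * 'D_(std R i) eta (vec t))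
  = - \int[leb R n]_(t in [set t | V (vec t)]) ('D_(std R i) u (vec t) * eta (vec t)).
Proof.
move=> oV cu du cdu [seta cK KV]; set K := closure _ in cK KV.
have clK : closed K by exact: closed_closure.
have eta0 y : ~ K y -> eta y = 0.
  by move=> Ky; apply: contrapT => /eqP e; apply: Ky; exact: subset_closure.
have deta y : derivable eta y (std R i) by have [_] := seta [::] y I; exact.
have ceta y : {for y, continuous eta} by have [] := seta [::] y I.
have cdeta y : {for y, continuous ('D_(std R i) eta)} by have [] := seta [:: i] y I.
have deta0 y : ~ K y -> 'D_(std R i) eta y = 0.
  by move=> Ky; have [] := partial_out_closed (std R i) clK eta0 Ky.
pose q1 y := u y * 'D_(std R i) eta y.
pose q2 y := 'D_(std R i) u y * eta y.
pose P := (fun y => u y * eta y) \_ V.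
have P0 y : ~ K y -> P y = 0.
  by move=> Ky; rewrite /P patchE; case: ifP => // _; rewrite eta0 ?mulr0.
have DP y : derivable P y (std R i) /\ 'D_(std R i) P y = (q1 \_ V) y + (q2 \_ V) y.
  have [Vy|Vy] := pselect (V y).
    have E : {near y, (u * eta) =1 P}.
      apply: filterS (open_nbhs_nbhs (conj oV Vy)) => z Vz; by rewrite /P patchE mem_set.
    split; first by apply: near_eq_derivable E _; apply: derivableM => //; exact: du.
    rewrite -(near_eq_derive _ E) deriveM//; last exact: du.
    by rewrite !patchE mem_set//= /q1 /q2 /GRing.scale /= [X in _ + X]mulrC.
  have Ky : ~ K y by move=> /KV.
  have [? ->] := partial_out_closed (std R i) clK P0 Ky; split=> //.
  by rewrite !patchE memNset// addr0.
have c1 : continuous (q1 \_ V).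
  apply: (patch_continuous oV clK KV) => [y Vy|y _ Ky]; last by rewrite /q1 deta0 ?mulr0.
  by apply: (@continuousM _ _ u ('D_(std R i) eta) y) => //; exact: cu.
have c2 : continuous (q2 \_ V).
  apply: (patch_continuous oV clK KV) => [y Vy|y _ Ky]; last by rewrite /q2 eta0 ?mulr0.
  by apply: (@continuousM _ _ ('D_(std R i) u) eta y) => //; exact: cdu.
have q10 y : ~ K y -> (q1 \_ V) y = 0.
  by move=> Ky; rewrite patchE /q1 deta0// mulr0; case: ifP.
have q20 y : ~ K y -> (q2 \_ V) y = 0.
  by move=> Ky; rewrite patchE /q2 eta0// mulr0; case: ifP.
have i1 := continuous_support_integrable cK c1 q10.
have i2 := continuous_support_integrable cK c2 q20.
have DPE : 'D_(std R i) P = (fun y => (q1 \_ V) y + (q2 \_ V) y).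
  by apply/funext => y; case: (DP y).
have cD : continuous ('D_(std R i) P).
  by rewrite DPE => y; exact: (@continuousD _ _ _ (q1 \_ V) (q2 \_ V) y (c1 y) (c2 y)).
have D0 y : ~ K y -> 'D_(std R i) P y = 0.
  by move=> Ky; have [_ ->] := DP y; rewrite q10// q20// addr0.
have I0 := @integral_partial_eq0 R n K i P cK (fun y => proj1 (DP y)) cD P0 D0.
have : \int[leb R n]_t ((q1 \_ V) (vec t) + (q2 \_ V) (vec t)) = 0.
  rewrite /Rintegral -[RHS](congr1 fine I0); congr fine.
  by apply: eq_integral => t _; have [_ ->] := DP (vec t).
rewrite RintegralD// => /eqP; rewrite addr_eq0 => /eqP E.
rewrite [LHS]Rintegral_mkcond [X in _ = - X]Rintegral_mkcond.
have pE (q : 'rV[R]_n -> R) : (fun t : n.-tuple RM => q (vec t)) \_ [set t | V (vec t)] = fun t => (q \_ V) (vec t).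
  apply/funext => t; rewrite !patchE.
  by rewrite (_ : (t \in _) = (vec t \in V))//; apply/idP/idP => /set_mem h; exact/mem_set.
by rewrite (pE q1) (pE q2).
Qed.

End integration_by_parts.

(** * The measure with a given density *)

Section density.
Context d (T : measurableType d) (R : realType) (mu : {measure set T -> \bar R}).
Variables (h : T -> \bar R) (mh : measurable_fun setT h) (h0 : forall x, (0 <= h x)%E).

(** The two proofs are arguments so that they can be read off the term when its measure structure is
    inferred. *)
Definition density_measure (_ : measurable_fun setT h) (_ : forall x, (0 <= h x)%E) (A : set T) : \bar R :=
  (\int[mu]_(x in A) h x)%E.

Let density0 : density_measure mh h0 set0 = 0%E.
Proof. exact: integral_set0. Qed.

Let density_ge0 A : (0 <= density_measure mh h0 A)%E.
Proof. by apply: integral_ge0 => x _; exact: h0. Qed.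

Let density_sigma_additive : semi_sigma_additive (density_measure mh h0).
Proof.
move=> /= F mF tF mUF; rewrite /density_measure; apply: cvg_toP.
  apply: ereal_nondecreasing_is_cvgn => m n mn.
  by apply: lee_sum_nneg_natr => // k _ _; apply: integral_ge0 => x _; exact: h0.
by rewrite ge0_integral_bigcup//; exact: measurable_funTS.
Qed.

HB.instance Definition _ := isMeasure.Build _ _ _ (density_measure mh h0)
  density0 density_ge0 density_sigma_additive.

End density.

(** * Smooth approximations of indicators of boxes *)

Section bump.
Variable R : realType.

Lemma flat1_ge0 (x : R) : 0 <= flat 1 x.
Proof. by rewrite /flat; case: ifP => // _; rewrite hornerC mul1r expR_ge0. Qed.

Lemma flat1_le1 (x : R) : flat 1 x <= 1.
Proof.
rewrite /flat; case: ifP => // x0; rewrite hornerC mul1r.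
by rewrite expR_le1 oppr_le0 invr_ge0 ltW.
Qed.

Lemma flat1_gt0 (x : R) : (0 < flat 1 x) = (0 < x).
Proof. by rewrite /flat; case: ifP => x0; rewrite ?ltxx// hornerC mul1r expR_gt0. Qed.

Lemma flat1_scaled_cvg (c : R) : flat 1 (k.+1%:R * c) @[k --> \oo] --> ((0 < c)%R%:R : R).
Proof.
have [c0|c0] := boolP (0 < c); last first.
  apply: cvg_near_cst; apply: nearW => k; rewrite /flat pmulr_rgt0// (negbTE c0)//.
rewrite (_ : (fun k => _) = (fun k => expR (- (k.+1%:R^-1 * c^-1)))); last first.
  by apply/funext => k; rewrite /flat pmulr_rgt0// c0 hornerC mul1r invfM.
have : (- (k.+1%:R^-1 * c^-1)) @[k --> \oo] --> (0:R).
  rewrite -oppr0; apply: cvgN; rewrite -(mul0r c^-1); apply: cvgM; last exact: cvg_cst.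
  exact: cvg_harmonic.
by move/(cvg_comp _ _)/(_ (@continuous_expR R 0)); rewrite expR0.
Qed.

Variable n : nat.

(** As k grows this tends to 1 inside the open box and stays 0 outside. The product (y - a)(b - y)
    is positive strictly between a and b even when b < a, which is why the lemmas below assume
    [a i < b i]. *)
Definition box_bump (a b : 'I_n -> R) (k : nat) (y : 'rV[R]_n) : R :=
  \prod_i flat 1 (k.+1%:R * ((y 0 i - a i) * (b i - y 0 i))).

Lemma box_bump_smooth a b k : smooth_open setT (box_bump a b k).
Proof.
apply/smooth_openP => m; apply: Ck_prod => [|i _]; first exact: openT.
have c1 : Ck m setT (fun y : 'rV[R]_n => y 0 i - a i).
  by apply: Ck_add; [exact: openT|exact: Ck_coord|exact: Ck_cst].
have c2 : Ck m setT (fun y : 'rV[R]_n => b i - y 0 i).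
  apply: Ck_add; [exact: openT|exact: Ck_cst|].
  apply: (@Ck_eq _ _ _ _ (fun y : 'rV[R]_n => -1 * y 0 i)); first exact: openT.
    by move=> y _; rewrite mulN1r.
  by apply: Ck_mul; [exact: openT|exact: Ck_cst|exact: Ck_coord].
apply: Ck_flat; first exact: openT.
apply: Ck_mul; [exact: openT|exact: Ck_cst|].
by apply: Ck_mul; [exact: openT| |].
Qed.

Lemma box_bump_bound a b k y : 0 <= box_bump a b k y <= 1.
Proof.
rewrite /box_bump; apply/andP; split; first by apply: prodr_ge0 => i _; exact: flat1_ge0.
by apply: prodr_ile1 => i _; rewrite flat1_ge0 flat1_le1.
Qed.

Lemma box_itv (a b y : R) : a < b -> (0 < (y - a) * (b - y)) = (a < y < b).
Proof.
move=> ab; apply/idP/idP => [h|/andP[ay yb]]; last by rewrite mulr_gt0 ?subr_gt0.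
apply/andP; split; rewrite ltNge; apply/negP => yx; nra.
Qed.

Lemma box_bump_cvg a b y : (forall i, a i < b i) ->
  box_bump a b k y @[k --> \oo] --> ((`[< forall i, (a i < y 0 i < b i)%R >])%:R : R).
Proof.
move=> ab; rewrite (_ : _%:R = \prod_i (0 < (y 0 i - a i) * (b i - y 0 i))%R%:R); last first.
  case: asboolP => h.
    by rewrite big1// => i _; rewrite box_itv// h.
  have [i hi] : exists i, ~ (a i < y 0 i < b i) by exact/existsNP.
  by rewrite (bigD1 i)//= box_itv// (negbTE (introN idP hi)) mul0r.
apply: cvg_big => [|i _]; first exact: mul_continuous.
exact: flat1_scaled_cvg.
Qed.

Lemma box_bump_neq0 a b k y : (forall i, a i < b i) -> box_bump a b k y != 0 ->
  forall i, a i < y 0 i < b i.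
Proof.
move=> ab; rewrite /box_bump => /prodf_neq0 h i; rewrite -box_itv//.
have : 0 < flat 1 (k.+1%:R * ((y 0 i - a i) * (b i - y 0 i))).
  by rewrite lt_neqAle flat1_ge0 eq_sym h.
by rewrite flat1_gt0 pmulr_rgt0.
Qed.

Lemma closed_ball_rV (z : 'rV[R]_n) (r : R) : closed [set y : 'rV[R]_n | forall i, `|y 0 i - z 0 i| <= r].
Proof.
rewrite (_ : [set y | _] = \bigcap_i [set y : 'rV[R]_n | `|y 0 i - z 0 i| <= r]); last first.
  by apply/seteqP; split=> [y h i _|y h i]; [exact: h|exact: (h i I)].
apply: closed_bigI => i _.
apply: (@closed_comp _ _ (fun y : 'rV[R]_n => `|y 0 i - z 0 i|) [set x | x <= r]); last exact: closed_le.
move=> y _; apply: (@continuous_comp _ _ _ (fun y : 'rV[R]_n => y 0 i - z 0 i) (fun x => `|x|)).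
  apply: (@continuousB _ _ _ (fun y : 'rV[R]_n => y 0 i) (fun=> z 0 i) y); last exact: cst_continuous.
  exact: matrix_normedtype.coord_continuous.
exact: norm_continuous.
Qed.

Lemma compact_ball_rV (z : 'rV[R]_n) (r : R) : compact [set y : 'rV[R]_n | forall i, `|y 0 i - z 0 i| <= r].
Proof.
apply: bounded_closed_compact; last exact: closed_ball_rV.
exists (`|z| + `|r|); split; first exact: num_real.
move=> x zx y h; apply: (le_trans _ (ltW zx)); apply/rV_norm_leP; first by rewrite addr_ge0.
move=> i; have -> : y 0 i = z 0 i + (y 0 i - z 0 i) by rewrite addrC subrK.
rewrite (le_trans (ler_normD _ _))// lerD ?rV_coord_le// (le_trans (h i))// ler_norm//.
Qed.

End bump.

(** * The du Bois-Reymond lemma *)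

Section du_bois_reymond.
Variable R : realType.
Local Notation RM := (measurableTypeR R).
Variable n : nat.
Implicit Types (V K : set 'rV[R]_n) (f : n.-tuple RM -> R).

Lemma test_function_box_bump V (a b : 'I_n -> R) (z : 'rV[R]_n) (r : R) k :
  [set y : 'rV[R]_n | forall i, `|y 0 i - z 0 i| <= r] `<=` V ->
  (forall i, a i < b i) -> (forall i, z 0 i - r <= a i) -> (forall i, b i <= z 0 i + r) ->
  test_function V (box_bump a b k).
Proof.
move=> QV ab za bz.
have sub : closure [set y | box_bump a b k y != 0] `<=`
    [set y : 'rV[R]_n | forall i, `|y 0 i - z 0 i| <= r].
  rewrite [X in _ `<=` X](closure_id _).1; last exact: closed_ball_rV.
  apply: closureS => y /(box_bump_neq0 ab) h i /=.
  have /andP[h1 h2] := h i; rewrite ler_distl; have := za i; have := bz i => ? ?.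
  by apply/andP; split; lra.
split; first exact: box_bump_smooth.
  apply: subclosed_compact (@compact_ball_rV _ _ z r) sub; exact: closed_closure.
exact: subset_trans QV.
Qed.

Variables (V : set 'rV[R]_n) (f : n.-tuple RM -> R).
Hypothesis oV : open V.
Local Notation VV := [set t : n.-tuple RM | V (vec t)].
Hypothesis mf : measurable_fun VV f.
Hypothesis fint : forall (z : 'rV[R]_n) r,
  [set y : 'rV[R]_n | forall i, `|y 0 i - z 0 i| <= r] `<=` V ->
  (leb R n).-integrable (cube (fun i => z 0 i) r) (EFin \o f).
Hypothesis f_test : forall eta, test_function V eta ->
  \int[leb R n]_(t in VV) (f t * eta (vec t)) = 0.

Section local.
Variables (z : 'rV[R]_n) (r : R).
Hypothesis QV : [set y : 'rV[R]_n | forall i, `|y 0 i - z 0 i| <= r] `<=` V.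
Let C := cube (fun i => z 0 i) r.
Let Q := @obox R n (fun i => z 0 i - r) (fun i => z 0 i + r).

Let mC : measurable C. Proof. exact: measurable_cube. Qed.
Let mQ : measurable Q. Proof. exact: measurable_obox. Qed.
Let QC : Q `<=` C.
Proof. by move=> t h i; have /andP[? ?] := h i; rewrite ler_distl; apply/andP; split; lra. Qed.
Let CV : C `<=` VV.
Proof. by move=> t h; apply: QV => i; rewrite mxE; exact: h. Qed.
Let mfC : measurable_fun C f.
Proof. by apply: measurable_funS mf => //; exact: measurable_vec_open. Qed.

(** Intersecting with [Q] keeps the bumps supported in the closed cube [C], on which |f| is
    integrable and dominates all the products f * eta. *)
Lemma integral_obox_eq0 a b :
  (\int[leb R n]_(t in obox a b `&` Q) (f t)%:E = 0)%E.
Proof.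
pose a' i := Num.max (a i) (z 0 i - r); pose b' i := Num.min (b i) (z 0 i + r).
have E : obox a b `&` Q = obox a' b'.
  apply/seteqP; split=> t /=.
    by move=> [h1 h2] i; move: (h1 i) (h2 i); rewrite gt_max lt_min => /andP[-> ->] /andP[-> ->].
  by move=> h; split=> i; move: (h i); rewrite gt_max lt_min => /andP[/andP[? ?] /andP[? ?]]; apply/andP.
rewrite E; have [ab|] := pselect (forall i, a' i < b' i); last first.
  move=> /existsNP[i /negP]; rewrite -leNgt => ba.
  rewrite (_ : obox a' b' = set0) ?integral_set0//; apply/seteqP; split=> // t /(_ i) /andP[t1 t2].
  by have := lt_le_trans (lt_trans t1 t2) ba; rewrite ltxx.
pose eta k := box_bump a' b' k.
have teta k : test_function V (eta k).
  apply: (test_function_box_bump _ QV ab) => i.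
    by rewrite le_max lexx orbT.
  by rewrite ge_min lexx orbT.
have eta0 k t : ~ obox a' b' t -> eta k (vec t) = 0.
  move=> h; apply: contrapT => /eqP /(box_bump_neq0 ab) h'; apply: h => i.
  by have := h' i; rewrite mxE.
have boxC : obox a' b' `<=` C by rewrite -E => t [_ /QC].
pose g k t := (f t * eta k (vec t))%:E.
have meta k : measurable_fun C (fun t => eta k (vec t)).
  have ceta y : {for y, continuous (eta k)} by have [/(_ [::] y I)[]] := teta k.
  have := @measurable_fun_vec R n setT (eta k) openT (fun y _ => ceta y).
  by rewrite (_ : [set t | _] = setT)//; exact: measurable_funTS.
have etab k t : 0 <= eta k (vec t) <= 1 by exact: box_bump_bound.
have mg k : measurable_fun C (g k).
  by apply/measurable_EFinP; apply: measurable_funM.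
have ifC := fint QV.
have gb k t : (`|g k t| <= `|(f t)%:E|)%E.
  have /andP[e0 e1] := etab k t.
  by rewrite /g /= lee_fin normrM (ger0_norm e0) ler_piMr.
have ig k : (leb R n).-integrable C (g k).
  by apply: le_integrable ifC => // t _; exact: gb.
have I0 k : (\int[leb R n]_(t in C) g k t = 0)%E.
  (* [f_test] is about real integrals, where an infinite value would read as 0, so finiteness has to
     come first. *)
  have fn : (\int[leb R n]_(t in C) g k t)%E \is a fin_num by exact: integrable_fin_num.
  rewrite -(fineK fn); congr EFin; rewrite -[RHS](f_test (teta k)) /Rintegral; congr fine.
  rewrite [LHS]integral_mkcond [RHS]integral_mkcond; apply: eq_integral => t _.
  rewrite !patchE; have [tC|tC] := boolP (t \in C).
    by rewrite ifT//; apply/mem_set/CV/set_mem.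
  case: ifP => // _; rewrite eta0 ?mulr0// => /boxC tC'.
  by move/negP: tC; apply; exact: mem_set.
pose h t := (f t * \1_(obox a' b') t)%:E.
have mh : measurable_fun C h.
  apply/measurable_EFinP; apply: measurable_funM => //.
  by apply: measurable_indic; exact: measurable_obox.
have gh t : g k t @[k --> \oo] --> h t.
  apply: cvg_EFin; first by apply: nearW.
  rewrite /= /h /=; apply: cvgM; first exact: cvg_cst.
  rewrite indicE (_ : t \in _ = `[< forall i, (a' i < vec t 0 i < b' i)%R >]).
    exact: box_bump_cvg.
  apply/idP/asboolP => [/set_mem h' i|h']; first by rewrite mxE; exact: h'.
  by apply/mem_set => i; have := h' i; rewrite mxE.
have [_ _] := @dominated_convergence _ _ _ (leb R n) C mC g h (fun t => `|(f t)%:E|%E) mg mh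
  (aeW _ (fun t _ => gh t)) (integrable_abse ifC) (aeW _ (fun t k _ => gb k t)).
rewrite (_ : [sequence _]_k = cst 0%E); last by apply/funext => k; exact: I0.
move=> /cvg_lim L.
have <- : (\int[leb R n]_(t in C) h t = 0)%E by rewrite -L// lim_cst.
rewrite [LHS]integral_mkcond [RHS]integral_mkcond; apply: eq_integral => t _.
rewrite !patchE /h indicE; have [tb|tb] := boolP (t \in obox a' b').
  by rewrite ifT ?mulr1//; apply/mem_set/boxC/set_mem.
by rewrite mulr0; case: ifP.
Qed.

(** The positive and negative parts of f on [Q] are densities of finite measures that agree on
    boxes, hence on all measurable sets. So f integrates to 0 over every measurable subset of
    [Q]. *)
Lemma negligible_local : (leb R n).-negligible (Q `&` [set t | f t != 0]).
Proof.
have ifC := fint QV.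
have ifQ : (leb R n).-integrable Q (EFin \o f) by apply: integrableS ifC.
pose h := (EFin \o f) \_ Q.
have ih : (leb R n).-integrable setT h by exact: (integrable_mkcond _ mQ).1.
have mh := measurable_int _ ih.
have mhp : measurable_fun setT (h^\+)%E by exact: measurable_funepos.
have mhn : measurable_fun setT (h^\-)%E by exact: measurable_funeneg.
have hp0 x : (0 <= (h^\+)%E x)%E by exact: funepos_ge0.
have hn0 x : (0 <= (h^\-)%E x)%E by exact: funeneg_ge0.
pose mp := density_measure (leb R n) mhp hp0.
pose mn := density_measure (leb R n) mhn hn0.
have iA A : measurable A -> (leb R n).-integrable A h by move=> mA; apply: integrableS ih.
have finp A : measurable A -> (\int[leb R n]_(x in A) (h^\+)%E x)%E \is a fin_num.
  by move=> mA; apply: integrable_fin_num => //; apply: integrable_funepos => //; exact: iA.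
have finn A : measurable A -> (\int[leb R n]_(x in A) (h^\-)%E x)%E \is a fin_num.
  by move=> mA; apply: integrable_fin_num => //; apply: integrable_funeneg => //; exact: iA.
have ob A : oboxes A -> mp A = mn A.
  move=> [a [b ->]]; have := integral_obox_eq0 a b.
  have mo := @measurable_obox R n a b.
  rewrite integral_mkcond patch_setI -integral_mkcond -/h integralE => /eqP.
  by rewrite sube_eq ?add0e ?finp ?fin_num_adde_defl ?finn// => /eqP.
have mpn A : measurable A -> mp A = mn A.
  apply: (@measure_unique _ R _ (@oboxes R n) (fun k => obox (fun=> - k%:R) (fun=> k%:R))).
  - exact: measurable_tupleE.
  - exact: oboxes_setI.
  - by move=> k; do 2 eexists.
  - exact: oboxes_cover.
  - exact: ob.
  - by move=> k; have := finp _ (@measurable_obox R n (fun=> - k%:R) (fun=> k%:R)); rewrite ge0_fin_numE ?integral_ge0.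
have : ae_eq (leb R n) setT h (cst 0%E).
  apply: integral_ae_eq => // A _ mA; rewrite integral0 integralE.
  by have := mpn A mA; rewrite /mp /mn /density_measure => ->; rewrite subee// finn.
apply: negligibleS => t /= [tQ /eqP ft] ht; apply: ft.
by have := ht I; rewrite /h patchE mem_set//= => -[].
Qed.

End local.

(* The indicator of a box is a bounded limit of test functions, so f integrates
   to 0 on all small boxes, which generate the sigma-algebra. *)
Lemma du_bois_reymond : (leb R n).-negligible (VV `&` [set t | f t != 0]).
Proof.
pose F (k : 'rV[rat]_n * nat) : set (n.-tuple RM) :=
  if `[< [set y : 'rV[R]_n | forall i, `|y 0 i - ratr (k.1 0 i)| <= k.2.+1%:R^-1] `<=` V >]
  then obox (fun i => ratr (k.1 0 i) - k.2.+1%:R^-1) (fun i => ratr (k.1 0 i) + k.2.+1%:R^-1)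
       `&` [set t | f t != 0] else set0.
have nF k : (leb R n).-negligible (F k).
  rewrite /F; case: asboolP => [kV|_]; last exact: negligible_set0.
  pose z : 'rV[R]_n := \row_i ratr (k.1 0 i).
  have := @negligible_local z k.2.+1%:R^-1.
  rewrite (_ : (fun i => z 0 i - _) = (fun i => ratr (k.1 0 i) - k.2.+1%:R^-1)); last first.
    by apply/funext => i; rewrite mxE.
  rewrite (_ : (fun i => z 0 i + _) = (fun i => ratr (k.1 0 i) + k.2.+1%:R^-1)); last first.
    by apply/funext => i; rewrite mxE.
  by apply; move=> y h; apply: kV => i; have := h i; rewrite mxE.
(* Countable unions of negligible sets are indexed by [nat], so the rational cubes are enumerated by
   [unpickle]. *)
have : (leb R n).-negligible (\bigcup_m (if unpickle m is Some k then F k else set0)).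
  by apply: negligible_bigcup => m; case: unpickle => [k|]; [exact: nF|exact: negligible_set0].
apply: negligibleS => t [/=]; rewrite {1}(open_rational_cover oV) => -[k _].
case: asboolP => // kV h ft; exists (pickle k) => //; rewrite pickleK /F asboolT//; split=> // i.
by have := h i; rewrite mxE ltr_distl.
Qed.

End du_bois_reymond.

(** * Gradients of smooth functions *)

Section right_partial.
Variables (R : realType) (n : nat).
Implicit Types (V O : set 'rV[R]_n) (f F : 'rV[R]_n -> R) (y z : 'rV[R]_n).

Definition relatively_open V := exists2 O, open O & V = O `&` @halfspace R n.

Lemma halfspace_std y (i : 'I_n) (h : R) : halfspace y -> 0 <= h -> halfspace (y + h *: std R i).
Proof.
move=> hy h0 j j0; rewrite !mxE eqxx/= addr_ge0 ?hy// mulr_ge0//.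
Qed.

Lemma cvg_line_right y (i : 'I_n) : (y + h *: std R i) @[h --> (0:R)^'+] --> y.
Proof.
have c0 : (y + h *: std R i) @[h --> (0:R)] --> y + (0:R) *: std R i.
  by apply: cvgD; [exact: cvg_cst|exact: scalel_continuous].
by rewrite scale0r addr0 in c0; exact: cvg_at_right_filter.
Qed.

(** This is the reason for right derivatives: a small step in a positive coordinate direction stays
    in the half-space, even from a boundary point. *)
Lemma relatively_open_line V y (i : 'I_n) : relatively_open V -> V y ->
  \forall h \near (0:R)^'+, V (y + h *: std R i).
Proof.
move=> [ O oO ->] [Oy hy]; near=> h; split; last first.
  by apply: halfspace_std => //; near: h; apply: filterS (nbhs_right_gt 0) => h /ltW.
near: h; apply: (@cvg_line_right y i); exact: open_nbhs_nbhs.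
Unshelve. all: by end_near. Qed.

Lemma rpartial_cvg V O f F y (i : 'I_n) : relatively_open V -> V y -> open O -> O y ->
  (forall z, O z -> V z -> F z = f z) -> derivable F y (std R i) ->
  ((f (y + h *: std R i) - f y) / h) @[h --> (0:R)^'+] --> 'D_(std R i) F y.
Proof.
move=> rV Vy oO Oy Ff dF.
have : ((F (y + h *: std R i) - F y) / h) @[h --> (0:R)^'+] --> 'D_(std R i) F y.
  have dF' : (h^-1 *: (F (h *: std R i + y) - F y)) @[h --> (0:R)^'] --> 'D_(std R i) F y.
    exact: dF.
  have E : (fun h : R => (F (y + h *: std R i) - F y) / h) = (fun h => h^-1 *: (F (h *: std R i + y) - F y)).
    by apply/funext => h; rewrite mulrC [y + _]addrC.
  rewrite E; apply: cvg_trans dF'; apply: cvg_app.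
  by move=> A [e e0 eA]; exists e => // h he h0; apply: eA => //; rewrite gt_eqF.
apply: cvg_trans; apply: near_eq_cvg; near=> h.
rewrite !Ff//; last by near: h; exact: relatively_open_line.
near: h; apply: (@cvg_line_right y i); exact: open_nbhs_nbhs.
Unshelve. all: by end_near. Qed.

(** Right partials are computed through any local smooth extension, and so do not depend on its
    choice. *)
Lemma rpartialE V O f F y (i : 'I_n) : relatively_open V -> V y -> open O -> O y ->
  (forall z, O z -> V z -> F z = f z) -> derivable F y (std R i) ->
  rpartial f y i = 'D_(std R i) F y.
Proof.
by move=> rV Vy oO Oy Ff dF; apply: cvg_lim => //; exact: (rpartial_cvg rV Vy oO Oy).
Qed.

Lemma eq_rpartial V f1 f2 y (i : 'I_n) : relatively_open V -> V y ->
  (forall z, V z -> f1 z = f2 z) -> rpartial f1 y i = rpartial f2 y i.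
Proof.
move=> rV Vy E; rewrite /rpartial; congr (lim _).
have nE : \forall h \near (0:R)^'+, (f1 (y + h *: std R i) - f1 y) / h =
    (f2 (y + h *: std R i) - f2 y) / h.
  by near=> h; rewrite !E//; near: h; exact: relatively_open_line.
by rewrite eqEsubset; split; apply/near_eq_cvg => //; near do apply/esym.
Unshelve. all: by end_near. Qed.

Lemma smooth_on_derivable O F y (i : 'I_n) : smooth_open O F -> O y -> derivable F y (std R i).
Proof. by move=> sF Oy; case: (sF [::] y Oy). Qed.

Lemma smooth_open_continuous O F y : smooth_open O F -> O y -> {for y, continuous F}.
Proof. by move=> sF Oy; case: (sF [::] y Oy). Qed.

Lemma smooth_open_partial_continuous O F y (i : 'I_n) : smooth_open O F -> O y ->
  {for y, continuous ('D_(std R i) F)}.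
Proof. by move=> sF Oy; case: (sF [:: i] y Oy). Qed.

Lemma smooth_on_rpartial_cvg V f y (i : 'I_n) : relatively_open V -> smooth_on V f -> V y ->
  ((f (y + h *: std R i) - f y) / h) @[h --> (0:R)^'+] --> rpartial f y i.
Proof.
move=> rV sf Vy; have [ O [F [oO Oy sF Ff]]] := sf y Vy.
have dF := @smooth_on_derivable O F y i sF Oy.
rewrite (rpartialE rV Vy oO Oy Ff dF); exact: (rpartial_cvg rV Vy oO Oy).
Qed.

Lemma smooth_on_line_cvg V f y (i : 'I_n) : relatively_open V -> smooth_on V f -> V y ->
  f (y + h *: std R i) @[h --> (0:R)^'+] --> f y.
Proof.
move=> rV sf Vy; have [ O [F [oO Oy sF Ff]]] := sf y Vy.
have := cvg_comp _ _ (@cvg_line_right y i) (smooth_open_continuous sF Oy).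
rewrite (Ff _ Oy Vy); apply: cvg_trans; apply: near_eq_cvg; near=> h.
rewrite /= Ff//; last by near: h; exact: relatively_open_line.
near: h; apply: (@cvg_line_right y i); exact: open_nbhs_nbhs.
Unshelve. all: by end_near. Qed.

End right_partial.

(** The curve h -> Phi(y + h e_i) is not parallel to an axis, so right partials of [G] alone do not
    control it. [G] is therefore replaced near Phi(y) by a smooth extension, to which the chain rule
    along [0^'+] applies. *)
Lemma rpartial_comp (R : realType) (n m : nat) (V : set 'rV[R]_n) (V' : set 'rV[R]_m)
    (Phi : 'rV[R]_n -> 'rV[R]_m) (G : 'rV[R]_m -> R) (y : 'rV[R]_n) (i : 'I_n) :
  relatively_open V -> relatively_open V' -> (forall z, V z -> V' (Phi z)) ->
  (forall j, smooth_on V (fun z => Phi z 0 j)) -> smooth_on V' G -> V y ->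
  rpartial (fun z => G (Phi z)) y i =
  \sum_j rpartial (fun z => Phi z 0 j) y i * rpartial G (Phi y) j.
Proof.
move=> rV rV' VV' sPhi sG Vy; apply: cvg_lim => //.
have V'y := VV' _ Vy.
have [ O [F [oO Oy sF FG]]] := sG _ V'y.
have cP : Phi (y + h *: std R i) @[h --> (0:R)^'+] --> Phi y.
  by apply: cvg_rV => j; exact: (smooth_on_line_cvg i rV (sPhi j) Vy).
have C1 : C1_at F (Phi y).
  by apply: (@Ck_C1_at R m 0%N O) => //; exact: (iffLR (smooth_openP O F)).
have := @chain_rule_filter R m R (0:R)^'+ _ F (Phi y) (fun h => Phi (y + h *: std R i)) (fun h => h^-1)
  (fun j => rpartial (fun z => Phi z 0 j) y i) C1 cP.
have dP j : h^-1 * (Phi (y + h *: std R i) 0 j - Phi y 0 j) @[h --> (0:R)^'+] -->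
    rpartial (fun z => Phi z 0 j) y i.
  have E : (fun h : R => h^-1 * (Phi (y + h *: std R i) 0 j - Phi y 0 j)) =
      (fun h => (Phi (y + h *: std R i) 0 j - Phi y 0 j) / h).
    by apply/funext => h; rewrite mulrC.
  by rewrite E; exact: (@smooth_on_rpartial_cvg R n V _ y i rV (sPhi j) Vy).
move=> /(_ _ dP).
have -> : \sum_j rpartial (fun z => Phi z 0 j) y i * 'D_(std R j) F (Phi y) =
   \sum_j rpartial (fun z => Phi z 0 j) y i * rpartial G (Phi y) j.
  apply: eq_bigr => j _; rewrite (rpartialE rV' V'y oO Oy FG)//.
  exact: smooth_on_derivable sF Oy.
apply: cvg_trans; apply: near_eq_cvg; near=> h.
rewrite mulrC !FG//; last first.
  by apply: VV'; near: h; exact: relatively_open_line.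
near: h; exact: (cP _ (open_nbhs_nbhs (conj oO Oy))).
Unshelve. all: by end_near. Qed.

(** * Differential and gradient of a smooth function in charts *)

Section smooth_gradient.
Variables (R : realType) (n : nat) (M : ptopologicalType).
Variables (X : manifold R n M) (g : metric X).
Implicit Types (c d : chart X) (u : M -> R) (x : M).

Definition img c : set 'rV[R]_n := coord c @` dom c.

Lemma img_param c y : img c y -> dom c (param c y) /\ coord c (param c y) = y.
Proof. by move=> [x cx <-]; rewrite coordK. Qed.

Lemma img_coord c x : dom c x -> img c (coord c x).
Proof. by move=> cx; exists x. Qed.

Lemma param_cvg c y : img c y -> param c z @[z --> within (img c) (nbhs y)] --> param c y.
Proof. by move=> cy; have /subspace_continuousP := @param_continuous _ _ _ X c; exact. Qed.

Lemma coord_cvg c x : dom c x -> {for x, continuous (coord c)}.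
Proof.
move=> cx; have := @coord_continuous _ _ _ X c.
by rewrite continuous_open_subspace ?inE//; [apply; exact: mem_set|exact: dom_open].
Qed.

Lemma img_open_trace c (U : set M) : open U -> exists2 O : set 'rV[R]_n, open O &
  O `&` img c = coord c @` (dom c `&` U).
Proof.
move=> oU; exists (interior [set z | img c z -> U (param c z)]); first exact: open_interior.
apply/seteqP; split=> y.
  move=> [Oy iy]; have Uy := nbhs_singleton Oy iy; have [dy <-] := img_param iy.
  by exists (param c y).
move=> [x [cx Ux] <-]; split; last exact: img_coord.
apply: (param_cvg (img_coord cx)); rewrite coordK//.
exact: open_nbhs_nbhs.
Qed.

Lemma relatively_open_img c (U : set M) : open U -> relatively_open (coord c @` (dom c `&` U)).
Proof.
move=> oU; have [ O oO OE] := img_open_trace c oU.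
have [ O' oO' O'E] := coord_dom c.
by exists (O `&` O'); [exact: openI|rewrite -OE /img O'E setIA].
Qed.

Lemma relatively_open_chart c : relatively_open (img c).
Proof. by have [ O oO E] := coord_dom c; exists O. Qed.

(** The differential of [u] as a row of components in the chart [c]. *)
Definition du u c x : 'rV[R]_n :=
  \row_i rpartial (fun y => u (param c y)) (coord c x) i.

(** Differentials are covariant, hence the transpose and the opposite direction compared with
    [vector_field]. *)
Lemma du_change u c d x : smooth X u -> dom c x -> dom d x ->
  du u c x = du u d x *m (jac c d x)^T.
Proof.
move=> su cx dx; apply/rowP => i; rewrite !mxE.
have rV := relatively_open_img c (@dom_open _ _ _ X d).
have Vy : (coord c @` (dom c `&` dom d)) (coord c x) by exists x.
have E z : (coord c @` (dom c `&` dom d)) z -> u (param c z) = u (param d (coord d (param c z))).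
  by move=> [w [cw dw] <-]; rewrite !coordK.
rewrite (eq_rpartial i rV Vy E).
rewrite (@rpartial_comp R n n _ (img d) (fun z => coord d (param c z)) (fun y => u (param d y)) _ _ rV
  (relatively_open_chart d))//.
- by apply: eq_bigr => j _; rewrite !mxE mulrC coordK.
- by move=> z [w [cw dw] <-]; rewrite coordK//; exact: img_coord.
- by move=> j; exact: transition_smooth.
- exact: su.
Qed.

Lemma gmx_unit c x : dom c x -> gmx g c x \in unitmx.
Proof.
move=> cx; rewrite unitmxE unitfE; apply/negP => /det0P[v v0 vg].
by have := gmx_pos g cx v0; rewrite vg mul0mx mxE ltxx.
Qed.

Lemma jac_unit c d x : dom c x -> dom d x -> jac c d x \in unitmx.
Proof.
move=> cx dx; have := gmx_unit cx.
by rewrite (gmx_change g cx dx) !unitmx_mul => /andP[/andP[]].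
Qed.

(** The classical gradient: the differential with its index raised by the inverse metric. *)
Definition sgrad u c x : 'rV[R]_n := du u c x *m invmx (gmx g c x).

Lemma sgrad_gmx u c x : dom c x -> sgrad u c x *m gmx g c x = du u c x.
Proof. by move=> cx; rewrite /sgrad mulmxKV// gmx_unit. Qed.

(** After multiplication by the invertible matrix g_d J^T, with J the Jacobian from c to d, both
    sides become the differential in the chart [c]. *)
Lemma sgrad_vector_field u : smooth X u -> vector_field (sgrad u).
Proof.
move=> su c d x cx dx.
have Ju := jac_unit cx dx.
have Gu : gmx g d x *m (jac c d x)^T \in unitmx.
  by rewrite unitmx_mul gmx_unit//= unitmx_tr.
apply: (can_inj (mulmxK Gu)).
rewrite !mulmxA sgrad_gmx// -du_change// -(sgrad_gmx u cx) (gmx_change g cx dx).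
by rewrite !mulmxA.
Qed.

Lemma gnorm2E (w : chart X -> M -> 'rV[R]_n) c x : vector_field w -> dom c x ->
  gnorm2 g w x = (w c x *m gmx g c x *m (w c x)^T) 0 0.
Proof.
move=> vw cx; rewrite /gnorm2; set d := chart_at X x.
have dx : dom d x by exact: dom_chart_at.
by rewrite (vw c d x cx dx) (gmx_change g cx dx) trmx_mul !mulmxA.
Qed.

Lemma gnorm2_ge0 (w : chart X -> M -> 'rV[R]_n) x : 0 <= gnorm2 g w x.
Proof.
rewrite /gnorm2; set v := w _ _; have [->|v0] := eqVneq v 0.
  by rewrite !mul0mx mxE.
by apply/ltW/gmx_pos => //; exact: dom_chart_at.
Qed.

Lemma gnorm2_sgrad u c x : smooth X u -> dom c x ->
  gnorm2 g (sgrad u) x = (du u c x *m invmx (gmx g c x) *m (du u c x)^T) 0 0.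
Proof.
move=> su cx; rewrite (gnorm2E (sgrad_vector_field su) cx) sgrad_gmx//.
by rewrite /sgrad trmx_mul trmx_inv gmx_sym// mulmxA.
Qed.

(* Cauchy-Schwarz for the metric, applied to w and the i-th coordinate vector. *)
Lemma gmx_coord_le (w : chart X -> M -> 'rV[R]_n) c x i : vector_field w -> dom c x ->
  ((w c x *m gmx g c x) 0 i) ^+ 2 <= gmx g c x i i * gnorm2 g w x.
Proof.
move=> vw cx; rewrite (gnorm2E vw cx).
set G := gmx g c x; set v := w c x.
have Gs : G^T = G by exact: gmx_sym.
have pos (a : 'rV[R]_n) : 0 <= (a *m G *m a^T) 0 0.
  have [->|a0] := eqVneq a 0; first by rewrite !mul0mx mxE.
  exact/ltW/gmx_pos.
have vs : (v *m G *m (std R i)^T) 0 0 = (v *m G) 0 i.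
  by rewrite trmx_delta -colE mxE.
have sv : (std R i *m G *m v^T) 0 0 = (v *m G) 0 i.
  rewrite -vs; have -> : std R i *m G *m v^T = (v *m G *m (std R i)^T)^T.
    by rewrite !trmx_mul trmxK Gs mulmxA.
  by rewrite mxE.
have ss : (std R i *m G *m (std R i)^T) 0 0 = G i i.
  by rewrite trmx_delta -colE mxE -rowE mxE.
have e0 : 0 < G i i.
  rewrite -ss; apply: gmx_pos => //; apply/eqP => /rowP/(_ i).
  by rewrite !mxE !eqxx => /eqP; rewrite oner_eq0.
set a := (v *m G) 0 i in vs sv *; set e := G i i in ss e0 *.
have mB (A B : 'M[R]_1) : (A - B) 0 0 = A 0 0 - B 0 0 by rewrite !mxE.
have mZ k (A : 'M[R]_1) : (k *: A) 0 0 = k * A 0 0 by rewrite !mxE.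
(* This is [e] times the component of [v] orthogonal to the i-th coordinate vector, which avoids a
   division; its squared norm is e (e q - a^2). *)
have := pos (e *: v - a *: std R i).
have -> : (e *: v - a *: std R i)^T = e *: v^T - a *: (std R i)^T.
  by apply/matrixP => j k; rewrite !mxE.
rewrite mulmxBr !mulmxBl -!scalemxAr -!scalemxAl !mB !mZ vs sv ss.
set q := (v *m G *m v^T) 0 0.
have -> : e * (e * q) - e * (a * a) - (a * (e * a) - a * (a * e)) = e * (e * q - a ^+ 2) by ring.
by rewrite pmulr_rge0// subr_ge0.
Qed.

End smooth_gradient.

(** * The Riemannian volume *)

Section continuity.
Variables (R : realType) (T : topologicalType).

Lemma continuous_sum (I : finType) (P : pred I) (f : I -> T -> R) (x : T) :
  (forall i, P i -> {for x, continuous (f i)}) -> {for x, continuous (fun z => \sum_(i | P i) f i z)}.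
Proof.
move=> cf; rewrite /prop_for /continuous_at.
by apply: cvg_big => [|i Pi]; [exact: add_continuous|exact: cf].
Qed.

Lemma continuous_prod (I : finType) (P : pred I) (f : I -> T -> R) (x : T) :
  (forall i, P i -> {for x, continuous (f i)}) -> {for x, continuous (fun z => \prod_(i | P i) f i z)}.
Proof.
move=> cf; rewrite /prop_for /continuous_at.
by apply: cvg_big => [|i Pi]; [exact: mul_continuous|exact: cf].
Qed.

Lemma continuous_det n (A : T -> 'M[R]_n) (x : T) :
  (forall i j, {for x, continuous (fun z => A z i j)}) -> {for x, continuous (fun z => \det (A z))}.
Proof.
move=> cA; apply: continuous_sum => s _.
apply: (@continuousM R T (fun=> (-1) ^+ perm.odd_perm s) _ x); first exact: cst_continuous.
by apply: continuous_prod => i _; exact: cA.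
Qed.

(** The cofactor formula describes [invmx] at invertible matrices only, so invertibility is asked on
    a neighbourhood. *)
Lemma continuous_invmx n (A : T -> 'M[R]_n) (x : T) i j :
  (\forall z \near x, A z \in unitmx) ->
  (forall i j, {for x, continuous (fun z => A z i j)}) ->
  {for x, continuous (fun z => invmx (A z) i j)}.
Proof.
move=> uA cA.
have c : {for x, continuous (fun z => (\det (A z))^-1 * cofactor (A z) j i)}.
  apply: (@continuousM R T (fun z => (\det (A z))^-1) (fun z => cofactor (A z) j i) x).
    apply: continuousV; last exact: continuous_det.
    by have := nbhs_singleton uA; rewrite unitmxE unitfE.
  apply: (@continuousM R T (fun=> (-1) ^+ (j + i)) (fun z => \det (row' j (col' i (A z)))) x).
    exact: cst_continuous.
  apply: continuous_det => k l.
  by rewrite (_ : (fun z => _) = (fun z => A z (lift j k) (lift i l)))//; apply/funext => z; rewrite !mxE.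
have E : {near x, (fun z => (\det (A z))^-1 * cofactor (A z) j i) =1 (fun z => invmx (A z) i j)}.
  by apply: filterS uA => z uz; rewrite /invmx uz !mxE.
by rewrite /prop_for /continuous_at -(nbhs_singleton E); exact: cvg_trans (near_eq_cvg E) c.
Qed.

End continuity.

(* The determinant does not vanish on the segment from 1 to A, which consists of
   positive definite matrices. *)
Lemma posdef_det_gt0 (R : realType) n (A : 'M[R]_n) :
  (forall v : 'rV[R]_n, v != 0 -> 0 < (v *m A *m v^T) 0 0) -> 0 < \det A.
Proof.
move=> pA; pose B (t : R) : 'M[R]_n := t *: A + (1 - t) *: 1%:M.
have p1 (v : 'rV[R]_n) : v != 0 -> 0 < (v *m v^T) 0 0.
  move=> v0; have [i vi] : exists i, v 0 i != 0.
    apply/not_existsP => h; move/eqP: v0; apply; apply/rowP => i; rewrite mxE.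
    by apply: contrapT => /eqP; exact: h.
  rewrite mxE (bigD1 i)//= ltr_pwDl//.
    by rewrite mxE -expr2 exprn_even_gt0.
  by apply: sumr_ge0 => j _; rewrite mxE -expr2 sqr_ge0.
have dB t : 0 <= t -> t <= 1 -> \det (B t) != 0.
  move=> t0 t1; apply/negP => /det0P[v v0 vB].
  have : (v *m B t *m v^T) 0 0 = 0 by rewrite vB mul0mx mxE.
  rewrite /B mulmxDr mulmxDl -!scalemxAr mulmx1 -!scalemxAl mxE [X in X + _]mxE [X in _ + X]mxE.
  have := pA v v0; have := p1 v v0; set a := (v *m v^T) 0 0; set b := (v *m A *m v^T) 0 0.
  by move=> a0 b0; apply/eqP; rewrite gt_eqF//; nra.
have cB : continuous (fun t : R => \det (B t)).
  move=> t; apply: continuous_det => i j.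
  rewrite (_ : (fun z => _) = (fun z => z * A i j + (1 - z) * (1%:M : 'M[R]_n) i j)); last first.
    by apply/funext => z; rewrite !mxE.
  by apply: cvgD; apply: cvgM; try exact: cvg_cst; [|apply: cvgB; [exact: cvg_cst|]]; exact: cvg_id.
have B0 : \det (B 0) = 1 by rewrite /B scale0r add0r subr0 scale1r det1.
have B1 : \det (B 1) = \det A by rewrite /B subrr scale0r addr0 scale1r.
rewrite ltNge; apply/negP => dA.
have [|t t01 /eqP] := @IVT R (fun t => \det (B t)) 0 1 0 ler01 (continuous_subspaceT cB).
  by rewrite B0 B1 ge_min dA orbT le_max ler01.
apply/negP; move: t01; rewrite in_itv/= => /andP[? ?]; exact: dB.
Qed.

(** * Borel sets of a compact space *)

Section borel_sets.
Variables (R : realType) (M : ptopologicalType).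

Lemma open_borel (U : set M) : open U -> measurable (U : set (borel M)).
Proof. by move=> oU; exact: sub_sigma_algebra. Qed.

Lemma measurable_fun_borel (D : set M) (f : M -> R) : open D ->
  (forall x, D x -> {for x, continuous f}) -> measurable_fun (D : set (borel M)) (f : borel M -> R).
Proof.
move=> oD cf; apply: measurable_fun_open_itv => a b; apply: open_borel.
rewrite openE => x [Dx fx]; apply: filterI; first exact: open_nbhs_nbhs.
by apply: (cf _ Dx); apply: open_nbhs_nbhs; split=> //; exact: interval_open.
Qed.

Hypothesis cM : compact [set: M].

(** The atlas may be uncountable; compactness is what lets properties checked chart by chart be
    glued within a sigma-algebra. *)
Lemma finite_subcover (D : M -> set M) : (forall x, open (D x)) -> (forall x, D x x) ->
  exists s : seq M, forall x, exists2 z, z \in s & D z x.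
Proof.
move=> oD Dx; have := cM; rewrite compact_cover => /(_ M setT D (fun x _ => oD x)).
case=> [x _|s _ sD]; first by exists x.
exists (finmap.enum_fset s) => x; have [z zs Dz] := sD x I; exists z => //.
Qed.

Lemma measurable_fun_cover (D : M -> set M) (f : borel M -> R) :
  (forall x, open (D x)) -> (forall x, D x x) ->
  (forall x, measurable_fun (D x : set (borel M)) f) -> measurable_fun setT f.
Proof.
move=> oD Dx mf; have [s sD] := finite_subcover oD Dx.
move=> _ Y mY; rewrite setTI.
rewrite (_ : f @^-1` Y = \big[setU/set0]_(z <- s) (D z `&` f @^-1` Y)).
  apply: bigsetU_measurable => z _; apply: mf => //; exact: open_borel.
rewrite -bigcup_seq; apply/seteqP; split=> [x fx|x [z _ []]//].
by have [z zs Dz] := sD x; exists z.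
Qed.

Lemma measure_cover0 (mu : {measure set (borel M) -> \bar R}) (D : M -> set M) (A : set (borel M)) :
  (forall x, open (D x)) -> (forall x, D x x) -> measurable A ->
  (forall x, mu (A `&` D x) = 0%E) -> mu A = 0%E.
Proof.
move=> oD Dx mA muA; have [s sD] := finite_subcover oD Dx.
have mAD z : measurable (A `&` (D z : set (borel M))) by apply: measurableI => //; exact: open_borel.
rewrite (_ : A = \big[setU/set0]_(z <- s) (A `&` D z)).
  elim: s {sD} => [|z s IH]; first by rewrite big_nil measure0.
  rewrite big_cons null_set_setU//; exact: bigsetU_measurable.
rewrite -bigcup_seq; apply/seteqP; split=> [x fx|x [z _ []]//].
by have [z zs Dz] := sD x; exists z.
Qed.

Lemma measure_cover_finite (mu : {measure set (borel M) -> \bar R}) (D : M -> set M) :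
  (forall x, open (D x)) -> (forall x, D x x) ->
  (forall x, mu (D x) < +oo)%E -> (mu setT < +oo)%E.
Proof.
move=> oD Dx muA; have [s sD] := finite_subcover oD Dx.
have mAD z : measurable (D z : set (borel M)) by exact: open_borel.
rewrite (_ : setT = \big[setU/set0]_(z <- s) (D z : set (borel M))).
  elim: s {sD} => [|z s IH]; first by rewrite big_nil measure0.
  rewrite big_cons; apply: le_lt_trans (lte_add_pinfty (muA z) IH).
  by apply: measureU2 => //; exact: bigsetU_measurable.
rewrite -bigcup_seq; apply/seteqP; split=> // x _.
by have [z zs Dz] := sD x; exists z.
Qed.

End borel_sets.

(** * Continuity and volume inside one chart *)

Section chart_analysis.
Variables (R : realType) (n : nat) (M : ptopologicalType).
Variables (X : manifold R n M) (g : metric X).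
Implicit Types (c d : chart X) (u : M -> R) (x : M).
Local Notation RM := (measurableTypeR R).

Lemma coord_near c x (U : set 'rV[R]_n) : dom c x -> nbhs (coord c x) U ->
  \forall z \near x, U (coord c z) /\ dom c z.
Proof.
move=> cx nU; apply: filterI; first exact: (coord_cvg cx).
by apply: open_nbhs_nbhs; split=> //; exact: dom_open.
Qed.

Lemma smooth_on_coord_continuous c f x : smooth_on (img c) f -> dom c x ->
  {for x, continuous (fun z => f (coord c z))}.
Proof.
move=> sf cx; have [ O [F [oO Oy sF Ff]]] := sf _ (img_coord cx).
have cF : {for x, continuous (fun z => F (coord c z))}.
  apply: (@continuous_comp _ _ _ (coord c) F); first exact: coord_cvg.
  exact: smooth_open_continuous sF Oy.
have E : {near x, (fun z => F (coord c z)) =1 (fun z => f (coord c z))}.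
  apply: filterS (coord_near cx (open_nbhs_nbhs (conj oO Oy))) => z [Oz cz].
  by apply: Ff => //; exact: img_coord.
by rewrite /prop_for /continuous_at -(nbhs_singleton E); exact: cvg_trans (near_eq_cvg E) cF.
Qed.

Lemma smooth_continuous u : smooth X u -> continuous u.
Proof.
move=> su x; set c := chart_at X x; have cx : dom c x by exact: dom_chart_at.
have cu := smooth_on_coord_continuous (su c) cx.
have E : {near x, (fun z => u (param c (coord c z))) =1 u}.
  by apply: filterS (coord_near cx filterT) => z [_ cz]; rewrite coordK.
by rewrite /continuous_at -(nbhs_singleton E); exact: cvg_trans (near_eq_cvg E) cu.
Qed.

Lemma gmx_continuous c i j x : dom c x -> {for x, continuous (fun z => gmx g c z i j)}.
Proof.
move=> cx; have cu := smooth_on_coord_continuous (@gmx_smooth R n M X g c i j) cx.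
have E : {near x, (fun z => gmx g c (param c (coord c z)) i j) =1 (fun z => gmx g c z i j)}.
  by apply: filterS (coord_near cx filterT) => z [_ cz]; rewrite coordK.
by rewrite /prop_for /continuous_at -(nbhs_singleton E); exact: cvg_trans (near_eq_cvg E) cu.
Qed.

Lemma rpartial_coord_continuous c f x i : smooth_on (img c) f -> dom c x ->
  {for x, continuous (fun z => rpartial f (coord c z) i)}.
Proof.
move=> sf cx; have [ O [F [oO Oy sF Ff]]] := sf _ (img_coord cx).
have cF : {for x, continuous (fun z => 'D_(std R i) F (coord c z))}.
  apply: (@continuous_comp _ _ _ (coord c) ('D_(std R i) F)); first exact: coord_cvg.
  exact: smooth_open_partial_continuous sF Oy.
have E : {near x, (fun z => 'D_(std R i) F (coord c z)) =1 (fun z => rpartial f (coord c z) i)}.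
  apply: filterS (coord_near cx (open_nbhs_nbhs (conj oO Oy))) => z [Oz cz].
  rewrite (rpartialE (relatively_open_chart c) (img_coord cz) oO Oz Ff)//.
  exact: smooth_on_derivable sF Oz.
by rewrite /prop_for /continuous_at -(nbhs_singleton E); exact: cvg_trans (near_eq_cvg E) cF.
Qed.

Lemma du_continuous u c x i : smooth X u -> dom c x ->
  {for x, continuous (fun z => du u c z 0 i)}.
Proof.
move=> su cx; rewrite (_ : (fun z => _) =
    fun z => rpartial (fun y => u (param c y)) (coord c z) i); last by apply/funext => z; rewrite mxE.
exact: rpartial_coord_continuous (su c) cx.
Qed.

Lemma gmx_unit_near c x : dom c x -> \forall z \near x, gmx g c z \in unitmx.
Proof.
by move=> cx; apply: filterS (coord_near cx filterT) => z [_ cz]; exact: gmx_unit.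
Qed.

Lemma sgrad_continuous u c x i : smooth X u -> dom c x ->
  {for x, continuous (fun z => sgrad g u c z 0 i)}.
Proof.
move=> su cx; rewrite (_ : (fun z => _) =
    fun z => \sum_j du u c z 0 j * invmx (gmx g c z) j i); last by apply/funext => z; rewrite mxE.
apply: continuous_sum => j _.
apply: (@continuousM R M (fun z => du u c z 0 j) (fun z => invmx (gmx g c z) j i) x).
  exact: du_continuous.
by apply: continuous_invmx; [exact: gmx_unit_near|move=> k l; exact: gmx_continuous].
Qed.

Definition sqrt_det c x : R := Num.sqrt (\det (gmx g c x)).

Lemma sqrt_det_gt0 c x : dom c x -> 0 < sqrt_det c x.
Proof.
move=> cx; rewrite sqrtr_gt0; apply: posdef_det_gt0 => v v0; exact: gmx_pos.
Qed.

Lemma sqrt_det_continuous c x : dom c x -> {for x, continuous (sqrt_det c)}.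
Proof.
move=> cx; apply: (@continuous_comp _ _ _ (fun z => \det (gmx g c z)) Num.sqrt).
  by apply: (@continuous_det R M n (gmx g c) x) => i j; exact: gmx_continuous.
exact: sqrt_continuous.
Qed.

Lemma param_within_continuous c (K : set 'rV[R]_n) (f : M -> R) : K `<=` img c ->
  (forall x, dom c x -> {for x, continuous f}) -> {within K, continuous (fun y => f (param c y))}.
Proof.
move=> Kc cf; apply/subspace_continuousP => y Ky.
have iy := Kc _ Ky; have [dy _] := img_param iy.
have h : param c z @[z --> within K (nbhs y)] --> param c y.
  apply: cvg_trans (param_cvg iy); apply: cvg_app => A h.
  by apply: (@filterS _ (nbhs y) _ _ _ _ h) => z hz /Kc.
exact: (cvg_comp _ _ h (cf _ dy)).
Qed.

Lemma param_bound c (K : set 'rV[R]_n) (f : M -> R) : compact K -> K `<=` img c ->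
  (forall x, dom c x -> {for x, continuous f}) ->
  exists2 C, 0 <= C & forall y, K y -> `|f (param c y)| <= C.
Proof.
by move=> cK Kc cf; exact: (continuous_compact_bound cK (param_within_continuous Kc cf)).
Qed.

Lemma sqrt_det_bounds c (K : set 'rV[R]_n) : compact K -> K `<=` img c ->
  exists m S, [/\ 0 < m, 0 <= S & forall y, K y -> m <= sqrt_det c (param c y) <= S].
Proof.
move=> cK Kc.
have [S S0 hS] := param_bound cK Kc (@sqrt_det_continuous c).
have [S' S'0 hS'] := @param_bound c K (fun x => (sqrt_det c x)^-1) cK Kc (fun x cx =>
  continuousV (lt0r_neq0 (sqrt_det_gt0 cx)) (sqrt_det_continuous cx)).
(* The lower bound is an upper bound for the inverse density; the added 1 makes it invertible when
   [S'] is 0. *)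
exists (S' + 1)^-1, S; split=> // [|y Ky]; first by rewrite invr_gt0 ltr_wpDl.
have [dy _] := img_param (Kc _ Ky); have s0 := sqrt_det_gt0 dy.
have := hS _ Ky; have := hS' _ Ky.
rewrite (gtr0_norm s0) gtr0_norm ?invr_gt0// => h1 ->.
rewrite andbT -[X in _ <= X]invrK lef_pV2 ?posrE ?invr_gt0 ?ltr_wpDl//.
by apply: (le_trans h1); rewrite lerDl.
Qed.

Definition IMG c : set (n.-tuple RM) := [set t | img c (vec t)].
(** The parametrization read on tuples, with values in [borel M] so that its measurability can be
    stated. *)
Definition par c (t : n.-tuple RM) : borel M := param c (vec t).

Lemma halfspace_closed : closed (@halfspace R n).
Proof.
rewrite (_ : @halfspace R n = \bigcap_(i in [set i : 'I_n | val i = 0%N]) [set y : 'rV[R]_n | 0 <= y 0 i]).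
  apply: closed_bigI => i _.
  apply: (@closed_comp _ _ (fun y : 'rV[R]_n => y 0 i) [set x | 0 <= x]); last exact: closed_ge.
  by move=> y _; exact: matrix_normedtype.coord_continuous.
by apply/seteqP; split=> y h i; exact: h.
Qed.

Lemma measurable_relatively_open V : relatively_open V ->
  measurable [set t : n.-tuple RM | V (vec t)].
Proof.
move=> [ O oO ->]; rewrite (_ : [set t | _] = [set t : n.-tuple RM | O (vec t)] `&` [set t | halfspace (vec t)])//.
apply: measurableI; first exact: measurable_vec_open.
by apply: measurable_vec_closed; exact: halfspace_closed.
Qed.

Lemma measurable_IMG c : measurable (IMG c).
Proof. exact: (measurable_relatively_open (relatively_open_chart c)). Qed.

Lemma par_dom c t : IMG c t -> dom c (par c t).
Proof. by move=> /img_param[]. Qed.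

Lemma coord_par c t : IMG c t -> coord c (par c t) = vec t.
Proof. by move=> /img_param[]. Qed.

Lemma measurable_par c : measurable_fun (IMG c) (par c).
Proof.
move=> mI; apply: (@measurability _ _ _ _ (IMG c) (par c) (@open M)) => //.
move=> _ [U oU <-].
rewrite (_ : _ `&` _ = [set t : n.-tuple RM | (coord c @` (dom c `&` U)) (vec t)]).
  by apply: measurable_relatively_open; exact: relatively_open_img.
apply/seteqP; split=> t /=.
  by move=> [ct Ut]; exists (par c t); [split=> //; exact: par_dom|exact: coord_par].
move=> [x [cx Ux] E]; rewrite /IMG /par/= -E coordK//; split=> //; exact: img_coord.
Qed.

Lemma image_par c (A : set (borel M)) : A `<=` dom c ->
  [set t : n.-tuple RM | (coord c @` A) (vec t)] = IMG c `&` par c @^-1` A.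
Proof.
move=> Ac; apply/seteqP; split=> t /=.
  move=> [x Ax E]; rewrite /IMG /par/= -E coordK; last exact: Ac.
  by split=> //; apply: img_coord; exact: Ac.
by move=> [ct At]; exists (par c t) => //; exact: coord_par.
Qed.

Lemma measurable_preimage_par c (A : set (borel M)) : measurable A ->
  measurable (IMG c `&` par c @^-1` A).
Proof. by move=> mA; apply: measurable_par => //; exact: measurable_IMG. Qed.

Lemma measurable_sqrt_det_par c : measurable_fun (IMG c) (fun t => sqrt_det c (par c t)).
Proof.
have ms : measurable_fun (dom c : set (borel M)) (sqrt_det c : borel M -> R).
  apply: measurable_fun_borel; first exact: dom_open.
  by move=> x; exact: sqrt_det_continuous.
apply: (measurable_comp _ _ ms (@measurable_par c)).
  by apply: open_borel; exact: dom_open.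
by move=> _ [t ct <-]; exact: par_dom.
Qed.

Variable vol : {measure set (borel M) -> \bar R}.
Hypothesis hvol : is_riemannian_volume g vol.

Lemma volE c (A : set (borel M)) : measurable A -> A `<=` dom c ->
  vol A = (\int[leb R n]_(t in IMG c `&` par c @^-1` A) (sqrt_det c (par c t))%:E)%E.
Proof. by move=> mA Ac; rewrite (hvol mA Ac) image_par. Qed.

Lemma vol_null c (A : set (borel M)) : measurable A -> A `<=` dom c ->
  (leb R n).-negligible (IMG c `&` par c @^-1` A) -> vol A = 0%E.
Proof.
move=> mA Ac nA; rewrite (volE mA Ac); apply: null_set_integral.
- exact: measurable_preimage_par.
- apply/measurable_EFinP; apply: measurable_funS (@measurable_sqrt_det_par c); last by move=> t [].
  exact: measurable_IMG.
- by apply: measure_negligible => //; exact: measurable_preimage_par.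
Qed.

Lemma vol_le c (A : set (borel M)) (S : R) : measurable A -> A `<=` dom c ->
  (forall t, IMG c t -> A (par c t) -> sqrt_det c (par c t) <= S) ->
  (vol A <= S%:E * leb R n (IMG c `&` par c @^-1` A))%E.
Proof.
move=> mA Ac hS; rewrite (volE mA Ac).
have mA' := measurable_preimage_par c mA.
rewrite -integral_cst//; apply: ge0_le_integral => //.
- by move=> t _; rewrite lee_fin sqrtr_ge0.
- apply/measurable_EFinP; apply: measurable_funS (@measurable_sqrt_det_par c); last by move=> t [].
  exact: measurable_IMG.
- by move=> t [ct At]; rewrite lee_fin; exact: hS.
Qed.

Hypothesis hM : hausdorff_space M.

Lemma compact_param c (K : set 'rV[R]_n) : compact K -> K `<=` img c -> compact (param c @` K).
Proof.
move=> cK Kc; apply: continuous_compact => //.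
apply/subspace_continuousP => y Ky.
apply: cvg_trans (param_cvg (Kc _ Ky)); apply: cvg_app => A h.
by apply: (@filterS _ (nbhs y) _ _ _ _ h) => z hz /Kc.
Qed.

Lemma measurable_param_image c (K : set 'rV[R]_n) : compact K -> K `<=` img c ->
  measurable (param c @` K : set (borel M)).
Proof.
move=> cK Kc; rewrite -[X in measurable X]setCK; apply: measurableC; apply: open_borel.
by apply: closed_openC; apply: compact_closed => //; exact: compact_param.
Qed.

(** [A] may leave the chart: only its part in the image of [K] is measured, and that image is
    compact, hence closed and Borel. *)
Lemma vol_ge c (K : set 'rV[R]_n) (m : R) (A : set (borel M)) : compact K -> K `<=` img c -> 0 <= m ->
  (forall y, K y -> m <= sqrt_det c (param c y)) -> measurable A ->
  (m%:E * leb R n ([set t : n.-tuple RM | K (vec t)] `&` par c @^-1` A) <= vol A)%E.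
Proof.
move=> cK Kc m0 hm mA; have mK := measurable_param_image cK Kc.
have mAK : measurable (A `&` (param c @` K : set (borel M))) by exact: measurableI.
have AKc : A `&` (param c @` K : set (borel M)) `<=` dom c.
  by move=> x [_ [y Ky <-]]; have [] := img_param (Kc _ Ky).
have E : [set t : n.-tuple RM | K (vec t)] `&` par c @^-1` A =
    IMG c `&` par c @^-1` (A `&` (param c @` K : set (borel M))).
  apply/seteqP; split=> t /=.
    by move=> [Kt At]; split; [exact: Kc|split=> //; exists (vec t)].
  move=> [ct [At [y Ky E]]]; split=> //.
  by rewrite -(coord_par ct) -E; have [_ ->] := img_param (Kc _ Ky).
apply: (@le_trans _ _ (vol (A `&` (param c @` K : set (borel M))))); last first.
  by apply: le_measure; rewrite ?inE//; exact: subIsetl.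
rewrite (volE mAK AKc) -E -integral_cst//; last by rewrite E; exact: measurable_preimage_par.
apply: ge0_le_integral => //.
- by rewrite E; exact: measurable_preimage_par.
- apply/measurable_EFinP; apply: measurable_funS (@measurable_sqrt_det_par c).
    exact: measurable_IMG.
  by rewrite E => t [].
- by move=> t [Kt _]; rewrite lee_fin hm.
Qed.

End chart_analysis.

(** * Finiteness of the volume and comparison of integrals *)

Section volume.
Variables (R : realType) (n : nat) (M : ptopologicalType).
Variables (X : manifold R n M) (g : metric X).
Variable vol : {measure set (borel M) -> \bar R}.
Hypothesis hvol : is_riemannian_volume g vol.
Implicit Types (c d : chart X) (u : M -> R) (x : M).
Local Notation RM := (measurableTypeR R).

(** Balls of the maximum norm are cubes, whose measure is given by [leb_cube]. *)
Definition cball (z : 'rV[R]_n) (r : R) : set 'rV[R]_n := [set y | forall i, `|y 0 i - z 0 i| <= r].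
Definition oball (z : 'rV[R]_n) (r : R) : set 'rV[R]_n := [set y | forall i, `|y 0 i - z 0 i| < r].

Lemma oball_cball z r : oball z r `<=` cball z r.
Proof. by move=> y h i; exact/ltW/h. Qed.

Lemma oball_open z r : open (oball z r).
Proof.
rewrite openE => y hy.
have near_lt i : nbhs y [set w : 'rV[R]_n | `|w 0 i - z 0 i| < r].
  have c : {for y, continuous (fun w : 'rV[R]_n => `|w 0 i - z 0 i|)}.
    apply: (@continuous_comp _ _ _ (fun w : 'rV[R]_n => w 0 i - z 0 i) (fun x : R => `|x|) y); last exact: norm_continuous.
    apply: (@continuousB _ _ _ (fun w : 'rV[R]_n => w 0 i) (fun=> z 0 i) y); last exact: cst_continuous.
    exact: matrix_normedtype.coord_continuous.
  have := @cvgr_lt R 'rV[R]_n (nbhs y) _ _ _ c; move=> h; apply: h; exact: hy.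
exact: (@filter_forall _ _ (fun i => [set w : 'rV[R]_n | `|w 0 i - z 0 i| < r]) (nbhs y) _ near_lt).
Qed.

Lemma cball_sub (O : set 'rV[R]_n) z : open O -> O z -> exists2 r, 0 < r & cball z r `<=` O.
Proof.
move=> oO Oz; have /nbhs_ballP[e /= e0 eO] := open_nbhs_nbhs (conj oO Oz).
exists (e / 2) => [|y hy]; first by rewrite divr_gt0.
apply: eO; rewrite -ball_normE/=; apply/rV_norm_ltP => // i.
rewrite !mxE distrC; apply: le_lt_trans (hy i) _; lra.
Qed.

Lemma open_coord_preimage c (U : set 'rV[R]_n) : open U -> open (dom c `&` coord c @^-1` U).
Proof.
move=> oU; rewrite openE => x [cx Ux].
apply: filterS (coord_near cx (open_nbhs_nbhs (conj oU Ux))) => z [? ?]; by split.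
Qed.

Lemma img_compact_nbhd c y : img c y -> exists r, [/\ 0 < r,
  compact (cball y r `&` @halfspace R n) & cball y r `&` @halfspace R n `<=` img c].
Proof.
have [ O oO E] := coord_dom c; rewrite /img E => -[Oy hy].
have [r r0 rO] := cball_sub oO Oy; exists r; split=> //.
  apply: (subclosed_compact _ (@compact_ball_rV _ _ y r)); last by move=> z [].
  by apply: closedI; [exact: closed_ball_rV|exact: halfspace_closed].
by move=> z [/rO Oz hz].
Qed.

Lemma cube_cball (z : 'rV[R]_n) r : cube (fun i => z 0 i) r = [set t : n.-tuple RM | cball z r (vec t)].
Proof. by apply/seteqP; split=> t h i; have := h i; rewrite mxE. Qed.

(** Near each point the coordinates range over a cube and the density is bounded. At boundary points
    the compact set behind this bound is a cube cut by the half-space. *)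
Lemma vol_finite : compact [set: M] -> (vol setT < +oo)%E.
Proof.
move=> cM.
have ex x : exists D : set M, [/\ open D, D x & (vol (D : set (borel M)) < +oo)%E].
  set c := chart_at X x; have cx : dom c x by exact: dom_chart_at.
  have [r [r0 cK Kc]] := img_compact_nbhd (img_coord cx).
  have [m [S [m0 S0 hS]]] := sqrt_det_bounds g cK Kc.
  have oD := open_coord_preimage c (@oball_open (coord c x) r).
  exists (dom c `&` coord c @^-1` (oball (coord c x) r)); split=> //.
    by split=> // i; rewrite subrr normr0.
  have mD := open_borel oD.
  have halfc t : IMG c t -> halfspace (vec t).
    by rewrite /IMG/= /img; have [ O oO ->] := coord_dom c; move=> [].
  apply: (le_lt_trans (vol_le hvol mD (@subIsetl _ _ _) (S := S) _)).
    move=> t ct [_ /= bt].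
    have Kt : (cball (coord c x) r `&` @halfspace R n) (vec t).
      by split; [rewrite -(coord_par ct); exact: oball_cball|exact: halfc].
    by have /andP[] := hS _ Kt.
  have B : (S%:E * leb R n (cube (fun i => coord c x 0%R i) r) < +oo)%E.
    by rewrite [X in (_ * X)%E](leb_cube _ (ltW r0)) -EFinM ltry.
  apply: le_lt_trans B; rewrite lee_pmul// le_measure// ?inE//; first exact: measurable_preimage_par.
    exact: measurable_cube.
  by move=> t [ct [_ /= bt]]; rewrite cube_cball/= -(coord_par ct); exact: oball_cball.
have [D hD] := choice ex.
by apply: (@measure_cover_finite R M cM vol D) => x; case: (hD x).
Qed.

Hypothesis hM : hausdorff_space M.

(** The image under [par c] of Lebesgue measure on [K], multiplied by [m], is a measure below [vol]
    by [vol_ge]; integrals of nonnegative functions follow. *)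
Lemma integral_par_le c (K : set 'rV[R]_n) (m : R) (h : borel M -> \bar R) :
  compact K -> K `<=` img c -> 0 <= m ->
  (forall y, K y -> m <= sqrt_det g c (param c y)) ->
  measurable_fun setT h -> (forall x, 0 <= h x)%E ->
  (m%:E * \int[leb R n]_(t in [set t : n.-tuple RM | K (vec t)]) h (par c t) <= \int[vol]_x h x)%E.
Proof.
move=> cK Kc m0 hm mh h0.
pose KK : set (n.-tuple RM) := [set t | K (vec t)].
have mKK : measurable KK.
  by apply: measurable_vec_closed; apply: compact_closed => //; exact: rV_hausdorff.
have KI : KK `<=` IMG c by move=> t Kt; exact: Kc.
have mpar : measurable_fun KK (par c).
  by apply: measurable_funS (measurable_par (c := c)) => //; exact: measurable_IMG.
(* A pushforward needs a map that is measurable on the whole space, hence the default [point] off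
   [K]. *)
pose phi (t : n.-tuple RM) : borel M := if t \in KK then par c t else point.
have mphi : measurable_fun setT phi.
  move=> _ Y mY; rewrite setTI.
  rewrite (_ : phi @^-1` Y = (KK `&` par c @^-1` Y) `|` (~` KK `&` [set t | Y point])).
    apply: measurableU; first exact: mpar.
    apply: measurableI; first exact: measurableC.
    have [Yp|Yp] := pselect (Y point).
      by rewrite (_ : [set _ | _] = setT)//; apply/seteqP; split.
    by rewrite (_ : [set _ | _] = set0)//; apply/seteqP; split.
  apply/seteqP; split=> t; rewrite /phi /=.
    by case: ifPn => [/set_mem|/negP tK] ?; [left|right; split=> // ?; apply: tK; exact: mem_set].
  by case=> [[tK Yt]|[tK Yt]]; [rewrite mem_set|rewrite memNset].
pose phi_mfun : {mfun _ >-> _} := HB.pack phi (isMeasurableFun.Build _ _ _ _ phi mphi).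
pose rst := mrestr (leb R n) mKK.
pose nu := pushforward rst phi_mfun.
have nuE A : nu A = leb R n (KK `&` par c @^-1` A).
  rewrite /nu /pushforward /rst /mrestr; congr (leb R n _).
  apply/seteqP; split=> t /=; rewrite /phi; first by move=> [+ tK]; rewrite mem_set.
  by move=> [tK At]; rewrite mem_set.
have I1 : (\int[leb R n]_(t in KK) h (par c t) <= \int[nu]_x h x)%E.
  have -> : (\int[leb R n]_(t in KK) h (par c t) = \int[rst]_(t in KK) h (phi t))%E.
    transitivity (\int[rst]_(t in KK) h (par c t))%E.
      apply: eq_measure_integral => A mA AK.
      by rewrite -[RHS]/(leb R n (A `&` KK)) (setIidl AK).
    by apply: eq_integral => t tK; rewrite /phi tK.
  rewrite (ge0_integral_pushforward mphi rst measurableT mh (fun x _ => h0 x)).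
  rewrite preimage_setT; apply: (ge0_subset_integral rst mKK measurableT) => //.
  exact: (measurableT_comp mh mphi).
apply: (@le_trans _ _ (\int[mscale (NngNum m0) nu]_x h x)%E).
  rewrite ge0_integral_mscale//=; apply: lee_wpmul2l => //.
apply: ge0_le_measure_integral => // A mA.
by rewrite -[X in (X <= _)%E]/(m%:E * nu A)%E nuE; exact: (vol_ge hvol hM cK Kc m0 hm mA).
Qed.
End volume.

(** * Weak gradients *)

Section weak_gradients.
Variables (R : realType) (n : nat) (M : ptopologicalType).
Variables (X : manifold R n M) (g : metric X).
Variable vol : {measure set (borel M) -> \bar R}.
Hypothesis hvol : is_riemannian_volume g vol.
Hypothesis cM : compact [set: M].
Hypothesis hM : hausdorff_space M.
Implicit Types (c d : chart X) (u : M -> R) (x : M) (w : chart X -> M -> 'rV[R]_n).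
Local Notation RM := (measurableTypeR R).

Lemma gnorm2_sum w c x : vector_field w -> dom c x ->
  gnorm2 g w x = \sum_j (\sum_k w c x 0 k * gmx g c x k j) * w c x 0 j.
Proof.
move=> vw cx; rewrite (gnorm2E _ vw cx) mxE; apply: eq_bigr => j _; rewrite !mxE.
by congr (_ * _).
Qed.

Lemma gnorm2_sgrad_continuous u : smooth X u -> continuous (gnorm2 g (sgrad g u)).
Proof.
move=> su x; set c := chart_at X x; have cx : dom c x by exact: dom_chart_at.
have vw := sgrad_vector_field g su.
have E : {near x, (fun z => \sum_j (\sum_k sgrad g u c z 0 k * gmx g c z k j) * sgrad g u c z 0 j)
    =1 gnorm2 g (sgrad g u)}.
  by apply: filterS (coord_near cx filterT) => z [_ cz]; rewrite -gnorm2_sum.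
rewrite /continuous_at -(nbhs_singleton E); apply: cvg_trans (near_eq_cvg E) _.
apply: continuous_sum => j _.
apply: (@continuousM R M (fun z => \sum_k sgrad g u c z 0 k * gmx g c z k j) (fun z => sgrad g u c z 0 j) x).
  apply: continuous_sum => k _.
  apply: (@continuousM R M (fun z => sgrad g u c z 0 k) (fun z => gmx g c z k j) x).
    exact: sgrad_continuous.
  exact: gmx_continuous.
exact: sgrad_continuous.
Qed.

Lemma continuous_bounded (f : M -> R) : continuous f -> exists2 C, 0 <= C & forall x, `|f x| <= C.
Proof.
move=> cf; have /compact_bounded[C [_ hC]] := continuous_compact (continuous_subspaceT cf) cM.
exists (`|C| + 1) => [|y]; first by rewrite addr_ge0.
by apply: (hC (`|C| + 1)); [rewrite (le_lt_trans (ler_norm C))// ltrDl|exists y].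
Qed.

Lemma continuous_integrable (f : M -> R) : continuous f ->
  vol.-integrable setT (fun x : borel M => (f x)%:E).
Proof.
move=> cf; have [C C0 hC] := continuous_bounded cf.
have mf : measurable_fun setT (f : borel M -> R).
  by apply: measurable_fun_borel; [exact: openT|move=> x _; exact: cf].
apply/integrableP; split; first exact/measurable_EFinP.
apply: (@le_lt_trans _ _ (\int[vol]_x (cst C%:E) x)%E).
  apply: ge0_le_integral => //.
    by apply: measurableT_comp => //; exact/measurable_EFinP.
  by move=> x _; rewrite /= lee_fin.
by rewrite integral_cst// lte_mul_pinfty ?lee_fin// (vol_finite hvol cM).
Qed.

Section interior_chart.
Variable c : chart X.
Let V := interior (img c).

(** In the interior of a chart, a local extension coincides with f on a full neighbourhood, so f
    inherits its regularity. *)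
Lemma interior_partial f y (i : 'I_n) : smooth_on (img c) f -> V y ->
  [/\ {for y, continuous f}, derivable f y (std R i),
      {for y, continuous ('D_(std R i) f)} & rpartial f y i = 'D_(std R i) f y].
Proof.
move=> sf Vy; have iy := interior_subset Vy.
have [ O [F [oO Oy sF Ff]]] := sf y iy.
have oOV : open (O `&` V) by apply: openI => //; exact: open_interior.
have near_E z : O z -> V z -> {near z, F =1 f}.
  move=> Oz Vz; apply: filterS (open_nbhs_nbhs (conj oOV (conj Oz Vz))) => w [Ow Vw].
  by apply: Ff => //; exact: interior_subset.
have Ey := near_E y Oy Vy.
have dE : {near y, 'D_(std R i) F =1 'D_(std R i) f}.
  apply: filterS (open_nbhs_nbhs (conj oOV (conj Oy Vy))) => w [Ow Vw].
  by apply: near_eq_derive; exact: near_E.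
have dF : derivable F y (std R i) by exact: smooth_on_derivable sF Oy.
split.
- rewrite /prop_for /continuous_at -(Ff _ Oy iy).
  exact: cvg_trans (near_eq_cvg Ey) (smooth_open_continuous sF Oy).
- exact: near_eq_derivable Ey dF.
- rewrite /prop_for /continuous_at -(nbhs_singleton dE).
  by apply: cvg_trans (near_eq_cvg dE) _; exact: smooth_open_partial_continuous sF Oy.
rewrite (rpartialE (relatively_open_chart c) iy oO Oy Ff dF).
exact: near_eq_derive.
Qed.

End interior_chart.

Lemma weak_gradient_sgrad u : smooth X u -> weak_gradient g vol u (sgrad g u).
Proof.
move=> su; split.
- exact: sgrad_vector_field.
- move=> c i; apply: measurable_fun_borel; first exact: dom_open.
  by move=> x cx; exact: sgrad_continuous.
- have /integrableP[_] := continuous_integrable (gnorm2_sgrad_continuous su).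
  by under eq_integral do rewrite gee0_abs ?lee_fin ?gnorm2_ge0//.
move=> c i eta V teta; have oV : open V by exact: open_interior.
rewrite (@integral_by_parts R n V i (fun y => u (param c y)) eta oV _ _ _ teta).
- congr (- _); apply: eq_Rintegral => t /set_mem Vt; congr (_ * _).
  have [dt ct] := img_param (interior_subset Vt).
  rewrite sgrad_gmx// mxE ct.
  by have [_ _ _ ->] := interior_partial i (su c) Vt.
- by move=> y Vy; have [] := interior_partial i (su c) Vy.
- by move=> y Vy; have [] := interior_partial i (su c) Vy.
- by move=> y Vy; have [] := interior_partial i (su c) Vy.
Qed.

Section weak_gradient_properties.
Variables (u : M -> R) (w : chart X -> M -> 'rV[R]_n).
Hypothesis hw : weak_gradient g vol u w.

Lemma weak_gradient_gmx_measurable c i :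
  measurable_fun (dom c : set (borel M)) (fun x : borel M => (w c x *m gmx g c x) 0 i).
Proof.
have [_ mw _ _] := hw.
rewrite (_ : (fun x => _) = fun x : borel M => \sum_j w c x 0 j * gmx g c x j i); last first.
  by apply/funext => x; rewrite mxE.
apply: measurable_sum => j; apply: measurable_funM; first exact: mw.
by apply: measurable_fun_borel; [exact: dom_open|move=> x cx; exact: gmx_continuous].
Qed.

Lemma gnorm2_measurable : measurable_fun setT (gnorm2 g w : borel M -> R).
Proof.
have [vw mw _ _] := hw.
apply: (@measurable_fun_cover R M cM (fun x => dom (chart_at X x))).
- by move=> x; exact: dom_open.
- by move=> x; exact: dom_chart_at.
move=> x; set c := chart_at X x.
apply: (@eq_measurable_fun _ _ _ _ _ (fun z : borel M => \sum_j (w c z *m gmx g c z) 0 j * w c z 0 j)).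
  by move=> z /set_mem cz; rewrite (gnorm2E _ vw cz) mxE; apply: eq_bigr => j _; rewrite !mxE.
apply: measurable_sum => j; apply: measurable_funM; last exact: mw.
exact: weak_gradient_gmx_measurable.
Qed.

(** The i-th component, in coordinates, of the weak differential dual to [w]; this is the quantity
    that [weak_gradient] tests. *)
Definition flux c i (t : n.-tuple RM) : R := (w c (par c t) *m gmx g c (par c t)) 0 i.

Lemma flux_measurable c i : measurable_fun (IMG c) (flux c i).
Proof.
rewrite (_ : flux c i = (fun x : borel M => (w c x *m gmx g c x) 0 i) \o par c)//.
have mw := @weak_gradient_gmx_measurable c i.
have md : measurable (dom c : set (borel M)) by apply: open_borel; exact: dom_open.
have sub : par c @` IMG c `<=` dom c by move=> _ [t ct <-]; exact: par_dom.
exact: (measurable_comp md sub mw (@measurable_par R n M X c)).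
Qed.

Lemma measurable_compact_vec (K : set 'rV[R]_n) : compact K -> measurable [set t : n.-tuple RM | K (vec t)].
Proof.
by move=> cK; apply: measurable_vec_closed; apply: compact_closed => //; exact: rV_hausdorff.
Qed.

Lemma leb_compact_finite (K : set 'rV[R]_n) : compact K ->
  (leb R n [set t : n.-tuple RM | K (vec t)] < +oo)%E.
Proof.
move=> cK; have [B B0 hB] := compact_norm_bounded cK.
have fin : (leb R n (cube (fun=> 0%R) B) < +oo)%E.
  by rewrite [X in (X < _)%E](leb_cube (fun=> 0%R) B0) ltry.
apply: le_lt_trans fin; apply: le_measure; rewrite ?inE; first exact: measurable_compact_vec.
  exact: measurable_cube.
by move=> t /hB h; exact: (iffRL (cube_normP t B0)).
Qed.

(** By [gmx_coord_le] the squared flux is at most g_ii |w|^2, and |a| <= 1 + a^2 turns square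
    integrability into integrability on a set of finite measure. *)
Lemma flux_integrable c i (K : set 'rV[R]_n) : compact K -> K `<=` img c ->
  (leb R n).-integrable [set t : n.-tuple RM | K (vec t)] (EFin \o flux c i).
Proof.
move=> cK Kc; set KK := [set t | _].
have mKK : measurable KK by exact: measurable_compact_vec.
have KI : KK `<=` IMG c by move=> t; exact: Kc.
have [m [S [m0 S0 hS]]] := sqrt_det_bounds g cK Kc.
have [C C0 hC] := param_bound cK Kc (fun x cx => @gmx_continuous R n M X g c i i x cx).
have [vw _ iw _] := hw.
have mpar : measurable_fun KK (par c).
  by apply: measurable_funS (measurable_par (c := c)) => //; exact: measurable_IMG.
have mg : measurable_fun KK (fun t => gnorm2 g w (par c t)).
  exact: (measurableT_comp gnorm2_measurable mpar).
have ig : (leb R n).-integrable KK (fun t => (gnorm2 g w (par c t))%:E).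
  apply/integrableP; split; first exact/measurable_EFinP.
  under eq_integral do rewrite gee0_abs ?lee_fin ?gnorm2_ge0//.
  have hm y : K y -> m <= sqrt_det g c (param c y) by move=> /hS/andP[].
  have := @integral_par_le R n M X g vol hvol hM c K m (fun x => (gnorm2 g w x)%:E) cK Kc (ltW m0) hm.
  have mE : measurable_fun setT (fun x : borel M => (gnorm2 g w x)%:E).
    by apply/measurable_EFinP; exact: gnorm2_measurable.
  have gE x : (0 <= (gnorm2 g w x)%:E)%E by rewrite lee_fin gnorm2_ge0.
  move=> /(_ mE gE) /le_lt_trans /(_ iw).
  (* If [J] were infinite then so would be m J, since m > 0, against the finite bound. *)
  set J := (\int[_]_(_ in _) _)%E => h; rewrite ltNge; apply/negP => /=.
  by rewrite leye_eq => /eqP JE; move: h; rewrite JE mulry gtr0_sg// mul1e ltxx.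
have i1 : (leb R n).-integrable KK (EFin \o cst 1%R).
  apply/integrableP; split; first exact/measurable_EFinP.
  under eq_integral do rewrite /= normr1.
  by rewrite integral_cst// mul1e; exact: leb_compact_finite.
have iD : (leb R n).-integrable KK ((EFin \o cst 1%R) \+ (fun t => C%:E * (gnorm2 g w (par c t))%:E))%E.
  by apply: integrableD => //; exact: integrableZl.
apply: (le_integrable mKK _ _ iD).
  apply/measurable_EFinP; apply: measurable_funS (@flux_measurable c i) => //.
  exact: measurable_IMG.
move=> t Kt; rewrite /= lee_fin.
have dt : dom c (par c t) by apply: par_dom; exact: KI.
have h := @gmx_coord_le R n M X g w c (par c t) i vw dt.
have G0 : 0 <= gnorm2 g w (par c t) by exact: gnorm2_ge0.
have h2 : (flux c i t) ^+ 2 <= C * gnorm2 g w (par c t).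
  apply: (le_trans h); apply: ler_wpM2r => //.
  by apply: le_trans (ler_norm _) (hC _ _); exact: Kt.
rewrite [leRHS]ger0_norm ?addr_ge0 ?mulr_ge0//.
apply: le_trans (_ : 1 + (flux c i t) ^+ 2 <= _); last by rewrite lerD2l.
by rewrite -[X in _ <= 1 + X]real_normK ?num_real//; set a := `|_|; nra.
Qed.

End weak_gradient_properties.

(** Both fluxes have the same integral against every test function, so their difference satisfies
    the du Bois-Reymond hypothesis. Each product with [eta] is first shown integrable, so that the
    integral of the difference splits. *)
Lemma weak_gradient_flux_negligible u w w' c i : weak_gradient g vol u w -> weak_gradient g vol u w' ->
  (leb R n).-negligible ([set t : n.-tuple RM | interior (img c) (vec t)] `&`
    [set t | flux w c i t - flux w' c i t != 0]).
Proof.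
move=> hw hw'; set V := interior (img c).
have oV : open V by exact: open_interior.
have VI : V `<=` img c by exact: interior_subset.
pose VV := [set t : n.-tuple RM | V (vec t)].
have mVV : measurable VV by exact: measurable_vec_open.
have mfl v : weak_gradient g vol u v -> measurable_fun VV (flux v c i).
  move=> hv; apply: measurable_funS (@flux_measurable u v hv c i); first exact: measurable_IMG.
  by move=> t; exact: VI.
apply: du_bois_reymond => //.
- by apply: measurable_funB; exact: mfl.
- move=> z r QV; rewrite cube_cball.
  have cK := @compact_ball_rV R n z r.
  rewrite (_ : EFin \o _ = (EFin \o flux w c i) \- (EFin \o flux w' c i))%E; last by apply/funext.
  have KI : cball z r `<=` img c by exact: subset_trans VI.
  apply: integrableB => //; first exact: measurable_compact_vec.
    exact: (flux_integrable hw i cK KI).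
  exact: (flux_integrable hw' i cK KI).
move=> eta teta.
have [seta cK KV] := teta; set K := closure _ in cK KV.
have KI : K `<=` img c by exact: subset_trans VI.
pose KK := [set t : n.-tuple RM | K (vec t)].
have mKK : measurable KK by exact: measurable_compact_vec.
have KKV : KK `<=` VV by move=> t; exact: KV.
have eta0 y : ~ K y -> eta y = 0.
  by move=> Ky; apply: contrapT => /eqP e; apply: Ky; exact: subset_closure.
have ceta : continuous eta by move=> y; have [] := seta [::] y I.
have [C C0 hC] := continuous_support_bound cK ceta eta0.
have meta D : measurable D -> measurable_fun D (fun t : n.-tuple RM => eta (vec t)).
  move=> mD; have := @measurable_fun_vec R n setT eta openT (fun y _ => ceta y).
  by rewrite (_ : [set t | _] = setT)//; exact: measurable_funTS.
have iv v : weak_gradient g vol u v ->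
    (leb R n).-integrable VV (EFin \o (fun t => flux v c i t * eta (vec t))).
  move=> hv; have iK := flux_integrable hv i cK KI.
  have iK' : (leb R n).-integrable KK (EFin \o (fun t => flux v c i t * eta (vec t))).
    apply: (le_integrable mKK _ _ (integrableZl mKK C iK)).
      apply/measurable_EFinP; apply: measurable_funM; last exact: meta.
      by apply: measurable_funS (mfl _ hv).
    move=> t _; rewrite /= lee_fin !normrM mulrC (ger0_norm C0).
    by apply: ler_wpM2r.
  apply/(integrable_mkcond _ mVV); move/(integrable_mkcond _ mKK) : iK'.
  congr (_.-integrable _ _); apply/funext => t; rewrite !patchE.
  have [tK|tK] := boolP (t \in KK); first by rewrite ifT//; apply/mem_set/KKV/set_mem.
  case: ifP => // _; rewrite /= eta0 ?mulr0// => Kt.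
  by move/negP: tK; apply; exact: mem_set.
have [_ _ _ E] := hw; have [_ _ _ E'] := hw'.
have := E c i eta teta; rewrite (E' c i eta teta) => /oppr_inj EE.
rewrite (_ : (fun t => _) = fun t => flux w c i t * eta (vec t) - flux w' c i t * eta (vec t)); last first.
  by apply/funext => t; rewrite mulrBl.
by rewrite RintegralB//; [apply/eqP; rewrite subr_eq0; apply/eqP; exact: (esym EE)|exact: iv|exact: iv].
Qed.

Hypothesis n0 : (0 < n)%N.

Lemma interior_img c y (i : 'I_n) : val i = 0%N -> img c y -> y 0 i != 0 -> interior (img c) y.
Proof.
move=> i0; rewrite /img; have [ O oO ->] := coord_dom c => -[Oy hy] yi.
have oU : open [set z : 'rV[R]_n | 0 < z 0 i].
  apply: (@open_comp _ _ (fun z : 'rV[R]_n => z 0 i) [set x | 0 < x]); last exact: open_gt.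
  by move=> z _; exact: matrix_normedtype.coord_continuous.
have yU : (O `&` [set z : 'rV[R]_n | 0 < z 0 i]) y.
  by split=> //=; rewrite lt_neqAle eq_sym yi hy.
apply: filterS (open_nbhs_nbhs (conj (openI oO oU) yU)) => z [Oz /= z0]; split=> // j j0.
by rewrite (_ : j = i) ?ltW//; apply: val_inj; rewrite j0 i0.
Qed.

(* Weak gradients are only tested in the interior of the charts, but the remaining
   points of a chart have first coordinate 0, hence form a null set. *)
Lemma weak_gradient_gnorm2_unique u w w' : weak_gradient g vol u w -> weak_gradient g vol u w' ->
  vol [set x : borel M | gnorm2 g w x != gnorm2 g w' x] = 0%E.
Proof.
move=> hw hw'; set N := [set x | _].
have mN : measurable N.
  rewrite (_ : N = setT `&` (fun x : borel M => gnorm2 g w x - gnorm2 g w' x) @^-1` (~` [set 0])); last first.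
    rewrite setTI; apply/seteqP; split=> x /= h.
      by move=> /subr0_eq e; move: h; rewrite /N /= e eqxx.
    by apply/eqP => e; apply: h; rewrite e subrr.
  apply: (measurable_funB (gnorm2_measurable hw) (gnorm2_measurable hw')) => //.
  exact: measurableC.
apply: (@measure_cover0 R M cM vol (fun x => dom (chart_at X x))) => //.
- by move=> x; exact: dom_open.
- by move=> x; exact: dom_chart_at.
move=> x; set c := chart_at X x.
have md : measurable (dom c : set (borel M)) by apply: open_borel; exact: dom_open.
apply: (vol_null hvol (measurableI _ _ mN md) (@subIsetr _ _ _)).
pose i0 : 'I_n := Ordinal n0.
have n1 : (leb R n).-negligible [set t : n.-tuple RM | tnth t i0 = 0].
  apply/negligibleP; last by apply: leb_hyperplane.
  have := @measurable_tnth _ (measurableTypeR R) n i0 measurableT [set 0] (measurable_set1 0).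
  by rewrite setTI.
pose A (i : 'I_n) := [set t : n.-tuple RM | interior (img c) (vec t)] `&`
  [set t | flux w c i t - flux w' c i t != 0].
(* The finitely many exceptional sets, padded with empty ones into a sequence. *)
pose F (k : nat) : set (n.-tuple RM) := if insub k is Some i then A i else set0.
have nF k : (leb R n).-negligible (F k).
  rewrite /F; case: insub => [i|]; last exact: negligible_set0.
  exact: weak_gradient_flux_negligible hw hw'.
apply: negligibleS (negligibleU n1 (negligible_bigcup nF)) => t [ct [Nt dt]].
have [t0|/eqP t0] := pselect (tnth t i0 = 0); [by left|right].
have Vt : interior (img c) (vec t).
  by apply: (@interior_img c (vec t) i0) => //; rewrite mxE.
apply: contrapT => h.
have E i : flux w c i t = flux w' c i t.
  apply: contrapT => e; apply: h; exists (val i) => //; rewrite /F valK; split=> //=.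
  by rewrite subr_eq0; apply/eqP.
have ww : w c (par c t) = w' c (par c t).
  apply: (can_inj (mulmxK (gmx_unit g dt))); apply/rowP => i; exact: E.
have [[vw _ _ _] [vw' _ _ _]] := (hw, hw').
by move: Nt; rewrite /N /= (gnorm2E g vw dt) (gnorm2E g vw' dt) ww eqxx.
Qed.

End weak_gradients.

(** * Upper bounds for the variational eigenvalues *)

Section linear_combinations.
Variables (R : realType) (n : nat) (M : ptopologicalType).
Variables (X : manifold R n M) (g : metric X).
Implicit Types (c d : chart X) (x : M).
Variables (I : finType) (u : I -> M -> R).
Hypothesis su : forall i, smooth X (u i).

(** The constant term serves the densities, which have the form e + sum_i a_i psi_i. *)
Lemma smooth_affine (b : R) (a : I -> R) : smooth X (fun x => b + \sum_i a i * u i x).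
Proof.
move=> c y cy.
have ex i : exists OF : set 'rV[R]_n * ('rV[R]_n -> R), [/\ open OF.1, OF.1 y, smooth_open OF.1 OF.2 &
    forall z, OF.1 z -> img c z -> OF.2 z = u i (param c z)].
  by have [ O [F [? ? ? ?]]] := su i cy; exists (O, F).
have [OF hOF] := choice ex.
pose O := interior [set z : 'rV[R]_n | forall i, (OF i).1 z].
have OO i : O `<=` (OF i).1 by move=> z /interior_subset; exact.
exists O, (fun z => b + \sum_i a i * (OF i).2 z); split.
- exact: open_interior.
- rewrite /O /interior /=.
  have : \forall z \near (y : 'rV[R]_n), forall i, (OF i).1 z.
    apply: (@filter_forall _ _ (fun i => (OF i).1) (nbhs y)) => i.
    by case: (hOF i) => oO Oy _ _; exact: open_nbhs_nbhs.
  exact.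
- apply/smooth_openP => k; have oO : open O by exact: open_interior.
  apply: Ck_add => //; first exact: Ck_cst.
  apply: Ck_sum => // i _; apply: Ck_mul => //; first exact: Ck_cst.
  by apply: (Ck_sub (@OO i)); case: (hOF i) => _ _ /smooth_openP.
move=> z Oz cz; congr (_ + _); apply: eq_bigr => i _.
by case: (hOF i) => _ _ _ -> //; exact: OO.
Qed.

Lemma smooth_sum (a : I -> R) : smooth X (fun x => \sum_i a i * u i x).
Proof.
by have := smooth_affine 0 a; under eq_fun do rewrite add0r.
Qed.

Lemma du_sum (a : I -> R) c x : dom c x ->
  du (fun x => \sum_i a i * u i x) c x = \sum_i a i *: du (u i) c x.
Proof.
move=> cx; apply/rowP => j; rewrite mxE summxE; under eq_bigr do rewrite !mxE.
have iy := img_coord cx; apply: cvg_lim => //.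
have : (fun h : R => \sum_i a i * ((u i (param c (coord c x + h *: std R j)) - u i (param c (coord c x))) / h))
    @ (0:R)^'+ --> \sum_i a i * rpartial (fun y => u i (param c y)) (coord c x) j.
  apply: cvg_big => [|i _]; first exact: add_continuous.
  apply: cvgM; first exact: cvg_cst.
  exact: (@smooth_on_rpartial_cvg R n (img c) (fun y => u i (param c y)) _ j (relatively_open_chart c) (@su i c) iy).
apply: cvg_trans; apply: near_eq_cvg; apply: nearW => h.
by rewrite -sumrB mulr_suml; apply: eq_bigr => i _; rewrite -mulrBr mulrA.
Qed.

(** At most one differential is nonzero at [x], so cross terms vanish. This serves twice: for
    functions [u_i] with disjoint supports, and for cutoffs at one centre whose gradients live on
    disjoint annuli. *)
Lemma gnorm2_orthogonal (a : I -> R) c x i0 : dom c x -> (forall j, j != i0 -> du (u j) c x = 0) ->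
  gnorm2 g (sgrad g (fun x => \sum_i a i * u i x)) x =
  \sum_i a i ^+ 2 * gnorm2 g (sgrad g (u i)) x.
Proof.
move=> cx h; rewrite (gnorm2_sgrad g (smooth_sum a) cx) du_sum//.
rewrite (bigD1 i0)//= big1 ?addr0; last by move=> j /h ->; rewrite scaler0.
rewrite [RHS](bigD1 i0)//= [X in _ + X]big1 ?addr0; last first.
  by move=> j /h hj; rewrite (gnorm2_sgrad g (su j) cx) hj !mul0mx mxE mulr0.
rewrite (gnorm2_sgrad g (su i0) cx); set v := du (u i0) c x; set G := invmx _.
have -> : (a i0 *: v)^T = a i0 *: v^T by apply/matrixP => k l; rewrite !mxE.
by rewrite -!scalemxAl -scalemxAr mxE mxE mulrA expr2.
Qed.

Lemma sqr_disjoint (a : I -> R) x i0 : (forall j, j != i0 -> u j x = 0) ->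
  (\sum_i a i * u i x) ^+ 2 = \sum_i a i ^+ 2 * u i x ^+ 2.
Proof.
move=> h; rewrite (bigD1 i0)//= big1 ?addr0; last by move=> j /h ->; rewrite mulr0.
rewrite [RHS](bigD1 i0)//= [X in _ + X]big1 ?addr0 ?exprMn//.
by move=> j /h ->; rewrite expr0n mulr0.
Qed.

End linear_combinations.

(** * Bounds for [mu_k] from below and from above *)

Section variational.
Variables (R : realType) (n : nat) (M : ptopologicalType).
Variables (X : manifold R n M) (g : metric X).
Variable vol : {measure set (borel M) -> \bar R}.
Hypothesis hvol : is_riemannian_volume g vol.
Hypothesis cM : compact [set: M].
Hypothesis n0 : (0 < n)%N.
Implicit Types (c d : chart X) (x : M).
Let hM : hausdorff_space M := @manifold_hausdorff _ _ _ X.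

Lemma rayleigh_ge0 rho sigma (u : M -> R) : (forall x, 0 <= rho x) -> (forall x, 0 <= sigma x) ->
  (0 <= rayleigh g vol rho sigma u)%E.
Proof.
move=> r0 s0; apply: mule_ge0; first by apply: integral_ge0 => x _; rewrite lee_fin mulr_ge0 ?gnorm2_ge0.
by rewrite inve_ge0; apply: integral_ge0 => x _; rewrite lee_fin mulr_ge0 ?sqr_ge0.
Qed.

(** Over an empty set the supremum would be -oo; independence modulo null sets ensures that the
    first basis vector is an admissible function. *)
Lemma mu_k_ge0 k rho sigma : (forall x, 0 <= rho x) -> (forall x, 0 <= sigma x) ->
  (0 <= mu_k g vol k rho sigma)%E.
Proof.
move=> r0 s0; apply: le_ereal_inf_tmp => _ [E [b [_ bind ->]] <-].
apply: (@le_trans _ _ (rayleigh g vol rho sigma (b ord0))); first exact: rayleigh_ge0.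
apply: ereal_sup_ubound; exists (b ord0) => //; split.
  exists (fun i => (i == ord0)%:R); apply/funext => x.
  rewrite (bigD1 ord0)//= mul1r big1 ?addr0// => i /negbTE ->; by rewrite mul0r.
move=> b0.
have := bind (fun i => (i == ord0)%:R).
rewrite (_ : (fun x => _) = b ord0); last first.
  apply/funext => x.
  rewrite (bigD1 ord0)//= mul1r big1 ?addr0// => i /negbTE ->; by rewrite mul0r.
by move=> /(_ b0 ord0)/eqP; rewrite eqxx oner_eq0.
Qed.

Lemma smooth_H1 (u : M -> R) : smooth X u -> H1 g vol u.
Proof.
move=> su; split; last by exists (sgrad g u); exact: weak_gradient_sgrad.
have cu := smooth_continuous su.
have mu : measurable_fun setT (u : borel M -> R).
  by apply: measurable_fun_borel; [exact: openT|move=> x _; exact: cu].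
have cu2 : continuous (fun x => u x ^+ 2).
  by move=> x; apply: (@continuousM R M u u x); exact: cu.
have /integrableP[_] := continuous_integrable hvol cM cu2.
move=> i2; rewrite inE; apply/andP; split; rewrite inE//=.
rewrite /finite_norm unlock poweR_lty//; apply: le_lt_trans i2.
rewrite le_eqVlt; apply/orP; left; apply/eqP; apply: eq_integral => x _.
by rewrite /= powR_mulrn// [in RHS]ger0_norm ?sqr_ge0// -normrX ger0_norm ?sqr_ge0.
Qed.

Section upper_bound.
Variables (k : nat) (u : 'I_k.+1 -> M -> R) (rho sigma : M -> R) (delta : R).
Hypothesis su : forall i, smooth X (u i).
Hypothesis disj : forall x, exists c i, dom c x /\
  forall j, j != i -> u j x = 0 /\ du (u j) c x = 0.
Hypothesis rho0 : forall x, 0 <= rho x.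
Hypothesis sigma0 : forall x, 0 <= sigma x.
Hypothesis mrho : measurable_fun setT (rho : borel M -> R).
Hypothesis msigma : measurable_fun setT (sigma : borel M -> R).
Let A i := (\int[vol]_x (gnorm2 g (sgrad g (u i)) x * sigma x)%:E)%E.
Let B i := (\int[vol]_x (u i x ^+ 2 * rho x)%:E)%E.
Hypothesis B_gt0 : forall i, (0 < B i)%E.
Hypothesis B_lty : forall i, (B i < +oo)%E.
Hypothesis AB : forall i, (A i <= delta%:E * B i)%E.

Let comb (a : 'I_k.+1 -> R) x := \sum_i a i * u i x.

Let mu_ i : measurable_fun setT (u i : borel M -> R).
Proof.
by apply: measurable_fun_borel; [exact: openT|move=> x _; exact: (smooth_continuous (su i))].
Qed.

Let mgn (v : M -> R) : smooth X v -> measurable_fun setT (gnorm2 g (sgrad g v) : borel M -> R).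
Proof.
move=> sv; apply: measurable_fun_borel; first exact: openT.
by move=> x _; exact: gnorm2_sgrad_continuous.
Qed.

Let scomb a : smooth X (comb a). Proof. exact: smooth_sum. Qed.

Lemma integral_comb_sqr a :
  (\int[vol]_x (comb a x ^+ 2 * rho x)%:E = \sum_i (a i ^+ 2)%:E * B i)%E.
Proof.
transitivity (\int[vol]_x (\sum_i (a i ^+ 2)%:E * (u i x ^+ 2 * rho x)%:E))%E.
  apply: eq_integral => x _; have [c [i [_ h]]] := disj x.
  rewrite (@sqr_disjoint R M _ u a x i); last by move=> j /h[].
  rewrite mulr_suml -sumEFin; apply: eq_bigr => j _; by rewrite -mulrA EFinM.
have m2 i : measurable_fun setT (fun x : borel M => (u i x ^+ 2 * rho x)%:E).
  by apply/measurable_EFinP; apply: measurable_funM => //; exact: measurable_funX.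
rewrite ge0_integral_sum//.
- apply: eq_bigr => i _; rewrite ge0_integralZl_EFin// ?sqr_ge0//.
  by move=> x _; rewrite lee_fin mulr_ge0 ?sqr_ge0.
- by move=> i; exact: measurable_funeM.
- move=> i x _; rewrite -EFinM lee_fin; apply: mulr_ge0; first exact: sqr_ge0.
  by rewrite mulr_ge0 ?sqr_ge0.
Qed.

Lemma integral_comb_grad a :
  (\int[vol]_x (gnorm2 g (sgrad g (comb a)) x * sigma x)%:E = \sum_i (a i ^+ 2)%:E * A i)%E.
Proof.
transitivity (\int[vol]_x (\sum_i (a i ^+ 2)%:E * (gnorm2 g (sgrad g (u i)) x * sigma x)%:E))%E.
  apply: eq_integral => x _; have [c [i [cx h]]] := disj x.
  rewrite (@gnorm2_orthogonal R n M X g _ u su a c x i cx); last by move=> j /h[].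
  rewrite mulr_suml -sumEFin; apply: eq_bigr => j _; by rewrite -mulrA EFinM.
have m2 i : measurable_fun setT (fun x : borel M => (gnorm2 g (sgrad g (u i)) x * sigma x)%:E).
  by apply/measurable_EFinP; apply: measurable_funM => //; exact: mgn.
rewrite ge0_integral_sum//.
- apply: eq_bigr => i _; rewrite ge0_integralZl_EFin// ?sqr_ge0//.
  by move=> x _; rewrite lee_fin mulr_ge0 ?gnorm2_ge0.
- by move=> i; exact: measurable_funeM.
- move=> i x _; rewrite -EFinM lee_fin; apply: mulr_ge0; first exact: sqr_ge0.
  by rewrite mulr_ge0 ?gnorm2_ge0.
Qed.

(** [grad] is some weak gradient, not necessarily [sgrad]; their norms agree almost everywhere,
    which is enough under the integral. *)
Lemma integral_grad (v : M -> R) : smooth X v ->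
  (\int[vol]_x (gnorm2 g (grad g vol v) x * sigma x)%:E =
   \int[vol]_x (gnorm2 g (sgrad g v) x * sigma x)%:E)%E.
Proof.
move=> sv; have w1 : weak_gradient g vol v (sgrad g v) by exact: weak_gradient_sgrad.
(* Since a weak gradient exists, [xget] returns one and not its default 0. *)
have w2 : weak_gradient g vol v (grad g vol v).
  by apply: (@xgetPex _ (fun _ _ => 0) [set w | weak_gradient g vol v w]); exists (sgrad g v).
have mw2 : measurable_fun setT (gnorm2 g (grad g vol v) : borel M -> R) by exact: gnorm2_measurable w2.
apply: ge0_ae_eq_integral => //.
- by apply/measurable_EFinP; exact: measurable_funM.
- by apply/measurable_EFinP; apply: measurable_funM => //; exact: mgn.
- by move=> x _; rewrite lee_fin mulr_ge0 ?gnorm2_ge0.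
- by move=> x _; rewrite lee_fin mulr_ge0 ?gnorm2_ge0.
exists [set x : borel M | gnorm2 g (grad g vol v) x != gnorm2 g (sgrad g v) x]; split.
- rewrite (_ : [set x | _] = setT `&` (fun x : borel M => gnorm2 g (grad g vol v) x - gnorm2 g (sgrad g v) x) @^-1` (~` [set 0])); last first.
    rewrite setTI; apply/seteqP; split=> x /= h.
      by move=> /subr0_eq e; move: h; rewrite e eqxx.
    by apply/eqP => e; apply: h; rewrite e subrr.
  apply: (measurable_funB mw2 (mgn sv)) => //.
  exact: measurableC.
- exact: (weak_gradient_gnorm2_unique hvol cM hM n0 w2 w1).
by move=> x /= h; apply/eqP => e; apply: h => _; rewrite e.
Qed.

Lemma sum_B_gt0 a i : a i != 0 -> (0 < \sum_i (a i ^+ 2)%:E * B i)%E.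
Proof.
move=> ai; rewrite (bigD1 i)//=; apply: lt_le_trans (leeDl _ _).
  by rewrite mule_gt0// lte_fin exprn_even_gt0.
by apply: sume_ge0 => j _; rewrite mule_ge0 ?lee_fin ?sqr_ge0// ltW.
Qed.

(** On the span of the [u_i] both integrals are diagonal with the same weights a_i^2, so the
    inequalities [AB] add up. *)
Lemma mu_k_le : (mu_k g vol k rho sigma <= delta%:E)%E.
Proof.
apply: (@le_trans _ _ (ereal_sup [set rayleigh g vol rho sigma v |
  v in [set v | (exists a : 'I_k.+1 -> R, v = comb a) /\ ~ ae_zero vol v]])).
  apply: ereal_inf_lbound; exists [set v | exists a : 'I_k.+1 -> R, v = comb a] => //.
  exists u; split=> //; first by move=> i; exact: smooth_H1.
  (* Independence comes from the denominator: a nonzero coefficient gives the combination a positive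
     mass. *)
  move=> a a0 i; apply: contrapT => /eqP ai.
  have := sum_B_gt0 ai; rewrite -integral_comb_sqr.
  rewrite (_ : (\int[vol]_x _)%E = 0%E) ?ltxx//.
  rewrite -[RHS](integral0 vol setT); apply: ge0_ae_eq_integral => //.
  - apply/measurable_EFinP; apply: measurable_funM => //; apply: measurable_funX.
    by apply: measurable_sum => j; exact: measurable_funM.
  - by move=> x _; rewrite lee_fin mulr_ge0 ?sqr_ge0.
  by apply: filterS a0 => x h _; have /= h' := h I; rewrite /comb h' expr0n mul0r.
apply: ge_ereal_sup => _ [v [[a ->] av] <-].
have [i ai] : exists i, a i != 0.
  apply: contrapT => /forallNP h; apply: av.
  apply: aeW => x _; rewrite /comb/= big1// => i _.
  by move: (h i) => /negP/negPn/eqP ->; rewrite mul0r.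
rewrite /rayleigh (integral_grad (scomb a)).
rewrite integral_comb_grad integral_comb_sqr.
have S0 := sum_B_gt0 ai.
have Sfin : (\sum_i (a i ^+ 2)%:E * B i)%E \is a fin_num.
  by apply/sum_fin_numP => j _ _; rewrite fin_numM// ge0_fin_numE// ltW.
set S := (\sum_i (a i ^+ 2)%:E * B i)%E in S0 Sfin *.
have s0 : 0 < fine S by rewrite fine_gt0// S0 ltey_eq Sfin.
rewrite -(fineK Sfin) inver gt_eqF// lee_pdivrMr// fineK//.
rewrite /S ge0_sume_distrr; last by move=> j _; rewrite mule_ge0 ?lee_fin ?sqr_ge0// ltW.
apply: lee_sum => j _; rewrite muleCA; apply: lee_wpmul2l; last exact: AB.
by rewrite lee_fin sqr_ge0.
Qed.

End upper_bound.
End variational.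

(** * Cutoff functions *)

Section lift.
Variables (R : realType) (n : nat) (M : ptopologicalType).
Variables (X : manifold R n M).
Let hM : hausdorff_space M := @manifold_hausdorff _ _ _ X.
Implicit Types (d : chart X) (x : M).
Variable c : chart X.

Definition lift (f : 'rV[R]_n -> R) x : R := if `[< dom c x >] then f (coord c x) else 0.

Lemma lift_dom f x : dom c x -> lift f x = f (coord c x).
Proof. by move=> cx; rewrite /lift asboolT. Qed.

Lemma lift_out f x : ~ dom c x -> lift f x = 0.
Proof. by move=> cx; rewrite /lift asboolF. Qed.

Variables (f : 'rV[R]_n -> R) (K : set 'rV[R]_n).
Hypothesis sf : smooth_open setT f.
Hypothesis cK : compact K.
Hypothesis Kc : K `<=` img c.
Hypothesis f0 : forall y, ~ K y -> f y = 0.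

Let S : set M := param c @` K.

Let closedS : closed S.
Proof. by apply: compact_closed => //; exact: compact_param. Qed.

Let lift_outS x : ~ S x -> lift f x = 0.
Proof.
move=> Sx; have [cx|cx] := pselect (dom c x); last exact: lift_out.
rewrite lift_dom// f0// => Kx; apply: Sx; exists (coord c x) => //; exact: coordK.
Qed.

(** At points of [dom c], compose f with the transition map. The other points avoid the image of
    [K], which is closed because M is Hausdorff, and the lift is 0 off that image. *)
Lemma lift_smooth : smooth X (lift f).
Proof.
move=> d y dy; have [dx dxE] := img_param dy; set x := param d y in dx dxE.
have [cx|cx] := pselect (dom c x); last first.
  have Sx : ~ S x by move=> [z Kz zx]; apply: cx; rewrite -zx; case: (img_param (Kc Kz)).
  have [ O oO OE] := img_open_trace d (closed_openC closedS).
  have Oy : (O `&` img d) y by rewrite OE; exists x.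
  exists O, (fun=> 0); split=> //; first by case: Oy.
    by apply/smooth_openP => k; exact: Ck_cst.
  move=> z Oz dz; have : (O `&` img d) z by split.
  by rewrite OE => -[w [dw Sw] <-]; rewrite coordK// lift_outS.
have yV : (coord d @` (dom d `&` dom c)) y by exists x.
have ex (j : 'I_n) : exists OF : set 'rV[R]_n * ('rV[R]_n -> R), [/\ open OF.1, OF.1 y, smooth_open OF.1 OF.2 &
    forall z, OF.1 z -> (coord d @` (dom d `&` dom c)) z -> OF.2 z = coord c (param d z) 0 j].
  have [ O [F [? ? ? ?]]] := @transition_smooth _ _ _ X d c j y yV; by exists (O, F).
have [OF hOF] := choice ex.
have [ O' oO' OE'] := img_open_trace d (@dom_open _ _ _ X c).
pose O := O' `&` interior [set z : 'rV[R]_n | forall j, (OF j).1 z].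
have oO : open O by apply: openI => //; exact: open_interior.
(* A smooth extension of the transition map beyond the chart image; as f is smooth on the whole
   space, any value of [Phi] is acceptable. *)
pose Phi (z : 'rV[R]_n) : 'rV[R]_n := \row_j (OF j).2 z.
exists O, (fun z => f (Phi z)); split => //.
- split; first by have : (O' `&` img d) y; [rewrite OE'; exists x|case].
  apply: (@filter_forall _ _ (fun j => (OF j).1) (nbhs y)) => j.
  by case: (hOF j) => oO1 Oy _ _; exact: open_nbhs_nbhs.
- apply/smooth_openP => k.
  apply: (@Ck_comp R n n k O setT f Phi) => //; first exact: openT.
    move=> j; apply: (@Ck_eq _ _ _ _ (OF j).2) => //; first by move=> z _; rewrite mxE.
    apply: (@Ck_sub R n k (OF j).1); first by move=> z [_ /interior_subset]; exact.
    by case: (hOF j) => _ _ /smooth_openP.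
  exact: (iffLR (smooth_openP _ _) sf k).
move=> z [ O'z /interior_subset hz] dz.
have Vz : (coord d @` (dom d `&` dom c)) z by rewrite -OE'.
have [w [dw cw] wz] := Vz; rewrite lift_dom -?wz ?coordK//; congr f; rewrite wz.
apply/rowP => j; rewrite mxE; have [_ _ _ E] := hOF j.
by rewrite (E z (hz j) Vz) -wz coordK.
Qed.

Lemma du_lift x : dom c x -> du (lift f) c x = \row_i 'D_(std R i) f (coord c x).
Proof.
move=> cx; apply/rowP => i; rewrite !mxE.
apply: (rpartialE (relatively_open_chart c) (img_coord cx) openT) => //.
  by move=> z _ cz; have [dz dE] := img_param cz; rewrite lift_dom// dE.
by case: (sf [::] I (y := coord c x)).
Qed.

Lemma du_lift_out d x : ~ dom c x -> dom d x -> du (lift f) d x = 0.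
Proof.
move=> cx dx; have Sx : ~ S x by move=> [z Kz zx]; apply: cx; rewrite -zx; case: (img_param (Kc Kz)).
have oS := closed_openC closedS.
have rV := relatively_open_img d oS.
have Vx : (coord d @` (dom d `&` ~` S)) (coord d x) by exists x.
apply/rowP => i; rewrite !mxE (@eq_rpartial R n _ _ (fun=> 0) _ i rV Vx).
  rewrite (@rpartialE R n _ setT (fun=> 0) (fun=> 0) _ i rV Vx openT)//; first exact: derive_cst.
by move=> z [w [dw Sw] <-]; rewrite coordK// lift_outS.
Qed.

End lift.

(** * The radial cutoff and its scaling *)

Section bump_profile.
Variables (R : realType) (n : nat).
Implicit Types (y z : 'rV[R]_n) (l : R).

(** Squared Euclidean distance at scale l: it is a polynomial in the coordinates, unlike the maximum
    norm of ['rV], which is not smooth. *)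
Definition scaled_dist2 l z y : R := \sum_i (l * (y 0 i - z 0 i)) ^+ 2.

Lemma flat1_homo (x y : R) : x <= y -> flat 1 x <= flat 1 y.
Proof.
move=> xy; rewrite /flat; case: ifPn => x0; last exact: flat1_ge0.
rewrite (lt_le_trans x0 xy) !hornerC !mul1r ler_expR lerN2 lef_pV2// posrE//.
exact: lt_le_trans xy.
Qed.

(* With h = flat 1, that is h(x) = exp(-1/x) for x > 0 and 0 otherwise, the
   function t |-> h(1/e - h(t - 1)) is constant for t <= 1 and vanishes for t >= 2. *)
Definition bump l z y : R :=
  (flat 1 (expR (-1)))^-1 * flat 1 (expR (-1) - flat 1 (scaled_dist2 l z y - 1)).

Lemma bump_plateau l z y : scaled_dist2 l z y <= 1 -> bump l z y = 1.
Proof.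
move=> h; rewrite /bump [X in _ - X](_ : _ = 0) ?subr0 ?mulVf//.
  by rewrite gt_eqF// flat1_gt0 expR_gt0.
by rewrite /flat ifF//; apply/negbTE; rewrite -leNgt subr_le0.
Qed.

Lemma bump_eq0 l z y : 2 <= scaled_dist2 l z y -> bump l z y = 0.
Proof.
move=> h; rewrite /bump [X in _ * X](_ : _ = 0) ?mulr0//.
rewrite {1}/flat ifF//; apply/negbTE; rewrite -leNgt subr_le0.
have E : flat 1 (1:R) = expR (-1) by rewrite /flat ltr01 hornerC mul1r invr1.
by rewrite -E; apply: flat1_homo; rewrite lerBrDr.
Qed.

Lemma bump_ge0 l z y : 0 <= bump l z y.
Proof. by rewrite /bump mulr_ge0 ?invr_ge0 ?flat1_ge0. Qed.

Lemma bump_le1 l z y : bump l z y <= 1.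
Proof.
rewrite /bump mulrC ler_pdivrMr ?flat1_gt0 ?expR_gt0// mul1r.
by apply: flat1_homo; rewrite gerBl flat1_ge0.
Qed.

Lemma Ck_scaled_dist2 k l z : Ck k setT (scaled_dist2 l z).
Proof.
apply: Ck_sum => [|i _]; first exact: openT.
have c1 : Ck k setT (fun y => l * (y 0 i - z 0 i)).
  apply: Ck_mul; [exact: openT|exact: Ck_cst|].
  by apply: Ck_add; [exact: openT|exact: Ck_coord|exact: Ck_cst].
by apply: Ck_mul => //; exact: openT.
Qed.

Lemma bump_smooth l z : smooth_open setT (bump l z).
Proof.
apply/smooth_openP => k; have oT : open [set: 'rV[R]_n] by exact: openT.
apply: Ck_mul => //; first exact: Ck_cst.
apply: Ck_flat => //; apply: Ck_add => //; first exact: Ck_cst.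
apply: (@Ck_eq _ _ _ _ (fun y => -1 * flat 1 (scaled_dist2 l z y - 1))) => //.
  by move=> y _; rewrite mulN1r.
apply: Ck_mul => //; first exact: Ck_cst.
apply: Ck_flat => //; apply: Ck_add => //; last exact: Ck_cst.
exact: Ck_scaled_dist2.
Qed.

Lemma scaled_dist2_continuous l z : continuous (scaled_dist2 l z).
Proof. by move=> y; exact: (Ck_continuous (Ck_scaled_dist2 0 l z)). Qed.

Lemma bump_partial_neq0 l z y i : 'D_(std R i) (bump l z) y != 0 -> 1 <= scaled_dist2 l z y <= 2.
Proof.
have c := @scaled_dist2_continuous l z y.
move=> h; apply/andP; split; rewrite leNgt; apply: contraNN h => h; apply/eqP.
  have nb : nbhs y [set w | scaled_dist2 l z w < 1].
    by have := @cvgr_lt R 'rV[R]_n (nbhs y) _ _ _ c; apply.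
  have E : {near y, cst 1 =1 bump l z}.
    by apply: (@filterS _ (nbhs y) _ _ _ _ nb) => w /= hw; rewrite bump_plateau// ltW.
  by rewrite -(near_eq_derive _ E) derive_cst.
have nb : nbhs y [set w | 2 < scaled_dist2 l z w].
  by have := @cvgr_gt R 'rV[R]_n (nbhs y) _ _ _ c; apply.
have E : {near y, cst 0 =1 bump l z}.
  by apply: (@filterS _ (nbhs y) _ _ _ _ nb) => w /= hw; rewrite bump_eq0// ltW.
by rewrite -(near_eq_derive _ E) derive_cst.
Qed.

Lemma scaled_dist2_cball l z y : 0 < l -> scaled_dist2 l z y <= 2 -> cball z (2 / l) y.
Proof.
move=> l0 h i.
(* The sharp bound is 2; rounding it up to 4 gives the radius 2/l without a square root. *)
have : (l * (y 0 i - z 0 i)) ^+ 2 <= 2 ^+ 2.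
  apply: (@le_trans _ _ 2); last by rewrite expr2; lra.
  apply: le_trans h; rewrite /scaled_dist2 (bigD1 i)//= lerDl.
  by apply: sumr_ge0 => j _; exact: sqr_ge0.
rewrite -ler_sqrt ?exprn_ge0// !sqrtr_sqr normrM (gtr0_norm l0) (ger0_norm (ler0n R 2)).
by rewrite ler_pdivlMr// mulrC.
Qed.

(** In this cube each of the n squares is at most 1/n^2, hence at most 1/n. *)
Lemma cball_scaled_dist2 l z y : 0 < l -> (0 < n)%N -> cball z (n%:R * l)^-1 y -> scaled_dist2 l z y <= 1.
Proof.
move=> l0 n0 h; apply: (@le_trans _ _ (\sum_(i < n) (n%:R^-1 : R))).
  apply: ler_sum => i _.
  have nR : 1 <= n%:R :> R by rewrite ler1n.
  have : `|l * (y 0 i - z 0 i)| <= n%:R^-1.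
    rewrite normrM gtr0_norm// -ler_pdivlMl//; apply: le_trans (h i) _.
    by rewrite invfM mulrC.
  move=> hi; rewrite -real_normK ?num_real// expr2.
  apply: le_trans (ler_pM _ _ hi hi) _ => //.
  by rewrite -[X in _ <= X]mulr1 ler_wpM2l ?invr_ge0// invf_le1//; lra.
by rewrite sumr_const card_ord -[n%:R^-1 *+ n]mulr_natl mulfV// pnatr_eq0 -lt0n.
Qed.

Lemma scaled_dist2M a l z y : scaled_dist2 (a * l) z y = a ^+ 2 * scaled_dist2 l z y.
Proof.
by rewrite /scaled_dist2 mulr_sumr; apply: eq_bigr => i _; rewrite -mulrA exprMn.
Qed.

Lemma derive_rescale (f : 'rV[R]_n -> R) l z y i : smooth_open setT f ->
  'D_(std R i) (fun w => f (l *: (w - z))) y = l * 'D_(std R i) f (l *: (y - z)).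
Proof.
move=> sf; pose Phi (w : 'rV[R]_n) := l *: (w - z).
have dP j : is_derive y (std R i) (fun w => Phi w 0 j) (l * (i == j)%:R).
  have d1 : is_derive y (std R i) (fun w : 'rV[R]_n => w 0 j - z 0 j) (std R i 0 j - 0).
    by apply: is_deriveB; exact: is_derive_coord.
  have d2 := is_deriveZ l d1.
  rewrite (_ : (fun w => Phi w 0 j) = l \*: (fun w : 'rV[R]_n => w 0 j - z 0 j)).
    by apply: is_derive_eq d2 _; rewrite subr0 /GRing.scale/= !mxE eqxx eq_sym.
  by apply/funext => w; rewrite !mxE.
have cPhi : {for y, continuous Phi}.
  apply: continuous_rV => j.
  rewrite (_ : (fun w => Phi w 0 j) = (fun w : 'rV[R]_n => l * (w 0 j - z 0 j))); last first.
    by apply/funext => w; rewrite !mxE.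
  have c : Ck 0 setT (fun w : 'rV[R]_n => l * (w 0 j - z 0 j)).
    apply: Ck_mul; [exact: openT|exact: Ck_cst|].
    by apply: Ck_add; [exact: openT|exact: Ck_coord|exact: Ck_cst].
  exact: (Ck_continuous c I).
have C1 := Ck_C1_at openT (iffLR (smooth_openP _ _) sf 1%N) (I : setT (Phi y)).
have D := is_derive_comp C1 cPhi (fun j => @ex_derive _ _ _ _ _ _ _ (dP j)).
rewrite (@derive_val _ _ _ _ _ _ _ D) (bigD1 i)//= big1 ?addr0.
  by rewrite (@derive_val _ _ _ _ _ _ _ (dP i)) eqxx mulr1.
by move=> j ji; rewrite (@derive_val _ _ _ _ _ _ _ (dP j)) eq_sym (negbTE ji) mulr0 mul0r.
Qed.

Lemma bump_partial_scale l z y i :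
  'D_(std R i) (bump l z) y = l * 'D_(std R i) (bump 1 0) (l *: (y - z)).
Proof.
rewrite (_ : bump l z = (fun w => bump 1 0 (l *: (w - z)))).
  by rewrite derive_rescale//; exact: bump_smooth.
apply/funext => w; rewrite /bump /scaled_dist2; congr (_ * flat 1 (_ - flat 1 (_ - 1))).
by apply: eq_bigr => j _; rewrite !mxE subr0 mul1r.
Qed.

(** All bumps are rescalings of [bump 1 0], whose partials are continuous with compact support; the
    chain rule contributes the factor l. *)
Lemma bump_partial_bound : exists2 C, 0 <= C & forall l z y i, 0 <= l ->
  `|'D_(std R i) (bump l z) y| <= C * l.
Proof.
have ex i : exists C, 0 <= C /\ forall y, `|'D_(std R i) (bump 1 0) y| <= C.
  have cD : continuous ('D_(std R i) (bump 1 0)).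
    by move=> y; exact: (smooth_open_partial_continuous (bump_smooth 1 0) (y := y)).
  have D0 y : ~ cball 0 (2 / 1) y -> 'D_(std R i) (bump 1 0) y = 0.
    move=> hy; apply: contrapT => /eqP /bump_partial_neq0 /andP[_ h].
    exact/hy/scaled_dist2_cball.
  have [C C0 hC] := continuous_support_bound (@compact_ball_rV R n 0 (2 / 1)) cD D0.
  by exists C.
have [C hC] := choice ex.
exists (\sum_i C i) => [|l z y i l0]; first by apply: sumr_ge0 => i _; case: (hC i).
rewrite bump_partial_scale normrM (ger0_norm l0) mulrC ler_wpM2r//.
apply: (@le_trans _ _ (C i)); first by case: (hC i) => _; exact.
by rewrite (bigD1 i)//= lerDl sumr_ge0// => j _; case: (hC j).
Qed.

End bump_profile.

(** * Cutoffs on the manifold and their energy *)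

Section bump_on_manifold.
Variables (R : realType) (n : nat) (M : ptopologicalType).
Variables (X : manifold R n M) (g : metric X).
Variable vol : {measure set (borel M) -> \bar R}.
Hypothesis hvol : is_riemannian_volume g vol.
Hypothesis cM : compact [set: M].
Hypothesis n2 : (2 <= n)%N.
Let hM : hausdorff_space M := @manifold_hausdorff _ _ _ X.
Implicit Types (d : chart X) (x : M) (z y : 'rV[R]_n) (l : R).
Local Notation RM := (measurableTypeR R).
Variable c : chart X.

Lemma compact_cball z r : compact (cball z r).
Proof. exact: compact_ball_rV. Qed.

Lemma bump_off l z y : 0 < l -> ~ cball z (2 / l) y -> bump l z y = 0.
Proof.
move=> l0 h; apply: bump_eq0; apply/ltW; rewrite ltNge; apply/negP => h'.
exact/h/scaled_dist2_cball.
Qed.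

Lemma bump_partial_off l z y i : 0 < l -> ~ cball z (2 / l) y -> 'D_(std R i) (bump l z) y = 0.
Proof.
move=> l0 h; apply: contrapT => /eqP /bump_partial_neq0 /andP[_ h'].
exact/h/scaled_dist2_cball.
Qed.

Section one_bump.
Variables (l : R) (z : 'rV[R]_n).
Hypothesis l0 : 0 < l.
Hypothesis Kc : cball z (2 / l) `<=` img c.

Lemma lift_bump_smooth : smooth X (lift c (bump l z)).
Proof.
by apply: (lift_smooth (bump_smooth l z) (@compact_cball z (2 / l)) Kc) => y; exact: bump_off.
Qed.

Lemma du_lift_bump x : dom c x ->
  du (lift c (bump l z)) c x = \row_i 'D_(std R i) (bump l z) (coord c x).
Proof. by move=> cx; apply: du_lift => //; exact: bump_smooth. Qed.

Lemma du_lift_bump_out d x : ~ dom c x -> dom d x -> du (lift c (bump l z)) d x = 0.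
Proof.
by apply: (du_lift_out (@compact_cball z (2 / l)) Kc) => y; exact: bump_off.
Qed.

Lemma du_lift_bump_off d x : dom d x -> ~ (dom c x /\ cball z (2 / l) (coord c x)) ->
  gnorm2 g (sgrad g (lift c (bump l z))) x = 0.
Proof.
move=> dx h; have [cx|cx] := pselect (dom c x); last first.
  by rewrite (gnorm2_sgrad g lift_bump_smooth dx) du_lift_bump_out// !mul0mx mxE.
rewrite (gnorm2_sgrad g lift_bump_smooth cx) du_lift_bump//.
rewrite (_ : \row_i _ = 0) ?mul0mx ?mxE//; apply/rowP => i; rewrite !mxE.
by apply: bump_partial_off => // hy; apply: h.
Qed.

Lemma lift_bump_ge0 x : 0 <= lift c (bump l z) x.
Proof. by rewrite /lift; case: ifP => // _; exact: bump_ge0. Qed.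

Lemma lift_bump_le1 x : lift c (bump l z) x <= 1.
Proof. by rewrite /lift; case: ifP => // _; exact: bump_le1. Qed.

(** The bump is 1 on the image of a small cube, whose volume is positive because the density is
    bounded below there. *)
Lemma integral_lift_bump_gt0 : (0 < \int[vol]_x (lift c (bump l z) x)%:E)%E.
Proof.
have n0 : (0 < n)%N by exact: leq_trans n2.
have nl0 : 0 < n%:R * l by rewrite mulr_gt0 ?ltr0n.
pose r := (n%:R * l)^-1; have r0 : 0 < r by rewrite invr_gt0.
have sub : cball z r `<=` cball z (2 / l).
  move=> y h; apply: scaled_dist2_cball => //; apply: le_trans (cball_scaled_dist2 l0 n0 h) _.
  by rewrite ler1n.
have Kr : cball z r `<=` img c by exact: subset_trans Kc.
have cKr := @compact_cball z r.
have [m [S [m0 S0 hS]]] := sqrt_det_bounds g cKr Kr.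
pose A : set (borel M) := param c @` cball z r.
have mA : measurable A by exact: (measurable_param_image hM cKr Kr).
have hm y : cball z r y -> m <= sqrt_det g c (param c y) by move=> /hS/andP[].
have vA : (0 < vol A)%E.
  apply: lt_le_trans (vol_ge hvol hM cKr Kr (ltW m0) hm mA).
  rewrite (_ : _ `&` _ = cube (fun i => z 0 i) r); last first.
    rewrite cube_cball; apply/seteqP; split=> t /=; first by move=> [].
    by move=> h; split=> //; exists (vec t).
  by rewrite [X in (_ < _ * X)%E](leb_cube _ (ltW r0)) -EFinM lte_fin mulr_gt0// exprn_gt0// mulr_gt0.
apply: (lt_le_trans vA).
have -> : vol A = (\int[vol]_x (\1_A x)%:E)%E by rewrite integral_indic ?setIT.
apply: ge0_le_integral => //.
- by apply/measurable_EFinP; exact: measurable_indic.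
- apply/measurable_EFinP; apply: measurable_fun_borel; first exact: openT.
  by move=> x _; exact: (smooth_continuous lift_bump_smooth).
move=> x _; rewrite lee_fin indicE; have [/set_mem[y hy <-]|_] := boolP (x \in A); last exact: lift_bump_ge0.
have [dy dE] := img_param (Kr _ hy).
by rewrite lift_dom// dE bump_plateau// cball_scaled_dist2.
Qed.
End one_bump.

Lemma quadratic_form_bound (v : 'rV[R]_n) (G : 'M[R]_n) (b Gm : R) : 0 <= b -> 0 <= Gm ->
  (forall i, `|v 0 i| <= b) -> (forall i j, `|G i j| <= Gm) ->
  (v *m G *m v^T) 0 0 <= n%:R ^+ 2 * Gm * b ^+ 2.
Proof.
move=> b0 Gm0 vb GG; rewrite mxE.
have h j i : `|v 0 i * G i j * v 0 j| <= b * Gm * b.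
  by rewrite !normrM; apply: ler_pM => //; apply: ler_pM.
apply: (@le_trans _ _ (\sum_(j < n) \sum_(i < n) b * Gm * b)).
  apply: ler_sum => j _; rewrite !mxE mulr_suml; apply: ler_sum => i _.
  exact: le_trans (ler_norm _) (h j i).
rewrite !sumr_const card_ord -mulrnA -[_ *+ (n * n)]mulr_natr natrM.
by rewrite le_eqVlt; apply/orP; left; apply/eqP; ring.
Qed.

Variable K0 : set 'rV[R]_n.
Hypothesis cK0 : compact K0.
Hypothesis K0c : K0 `<=` img c.

(** The constant depends on the compact set [K0] only, not on the scale or the centre: this
    uniformity is what makes averaging over scales pay off. *)
Lemma bump_energy : exists2 E, 0 <= E & forall l z, 1 <= l -> cball z (2 / l) `<=` K0 ->
  (\int[vol]_x (gnorm2 g (sgrad g (lift c (bump l z))) x)%:E <= E%:E)%E.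
Proof.
have exG (ij : 'I_n * 'I_n) : exists C, 0 <= C /\ forall y, K0 y -> `|invmx (gmx g c (param c y)) ij.1 ij.2| <= C.
  have cinv x : dom c x -> {for x, continuous (fun x => invmx (gmx g c x) ij.1 ij.2)}.
    move=> cx; apply: (@continuous_invmx R M n (gmx g c) x ij.1 ij.2 (gmx_unit_near g cx)) => k l.
    exact: (@gmx_continuous R n M X g c k l x cx).
  have [C C0 hC] := param_bound cK0 K0c cinv.
  by exists C.
have [CG hCG] := choice exG.
pose Gm := \sum_ij CG ij.
have Gm0 : 0 <= Gm by apply: sumr_ge0 => ij _; case: (hCG ij).
have hG y i j : K0 y -> `|invmx (gmx g c (param c y)) i j| <= Gm.
  move=> Ky; apply: (@le_trans _ _ (CG (i, j))); first by case: (hCG (i, j)) => _; exact.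
  by rewrite /Gm (bigD1 (i, j))//= lerDl sumr_ge0// => ij _; case: (hCG ij).
have [Cp Cp0 hCp] := bump_partial_bound R n.
have [m [S [m0 S0 hS]]] := sqrt_det_bounds g cK0 K0c.
(* The bound n^2 Gm (Cp l)^2 on the squared gradient times the bound S (4/l)^n on the volume,
   without the powers of l. *)
exists (n%:R ^+ 2 * Gm * Cp ^+ 2 * (S * 4 ^+ n)) => [|l z l1 zK].
  by rewrite !mulr_ge0// ?exprn_ge0.
have l0 : 0 < l by exact: lt_le_trans l1.
have Kc : cball z (2 / l) `<=` img c by exact: subset_trans K0c.
pose A : set (borel M) := param c @` cball z (2 / l).
have mA : measurable A by exact: (measurable_param_image hM (@compact_cball z (2 / l)) Kc).
have Ac : A `<=` dom c by move=> x [y hy <-]; have [] := img_param (Kc _ hy).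
pose D := n%:R ^+ 2 * Gm * (Cp * l) ^+ 2.
have D0 : 0 <= D by rewrite /D; apply: mulr_ge0; [apply: mulr_ge0 => //; exact: sqr_ge0|exact: sqr_ge0].
have ptw x : gnorm2 g (sgrad g (lift c (bump l z))) x <= D * \1_A x.
  rewrite indicE; have [/set_mem xA|xA] := boolP (x \in A).
    have cx := Ac _ xA; rewrite mulr1 (gnorm2_sgrad g (lift_bump_smooth l0 Kc) cx).
    apply: quadratic_form_bound => //; first by rewrite mulr_ge0// ltW.
      by move=> i; rewrite du_lift_bump// mxE hCp// ltW.
    move=> i j; rewrite -(coordK cx); apply: hG; apply: zK.
    by have [y hy <-] := xA; have [_ ->] := img_param (Kc _ hy).
  rewrite mulr0 (@du_lift_bump_off l z l0 Kc (chart_at X x))//; first exact: dom_chart_at.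
  move=> [cx hx]; move/negP: xA; apply; apply/mem_set; exists (coord c x) => //; exact: coordK.
have mgn : measurable_fun setT (gnorm2 g (sgrad g (lift c (bump l z))) : borel M -> R).
  apply: measurable_fun_borel; first exact: openT.
  by move=> x _; apply: gnorm2_sgrad_continuous; exact: lift_bump_smooth.
have m1 : measurable_fun setT (fun x : borel M => (\1_A x : R)%:E).
  by apply/measurable_EFinP; exact: measurable_indic.
apply: (@le_trans _ _ (\int[vol]_x (D%:E * (\1_A x)%:E))%E).
  apply: ge0_le_integral => //.
  - by move=> x _; rewrite lee_fin gnorm2_ge0.
  - exact/measurable_EFinP.
  - exact: measurable_funeM.
  - by move=> x _; rewrite -EFinM lee_fin.
rewrite ge0_integralZl_EFin// integral_indic// setIT.
have vA : (vol A <= (S * (2 * (2 / l)) ^+ n)%:E)%E.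
  apply: (@le_trans _ _ (S%:E * leb R n (IMG c `&` par c @^-1` A))%E).
    apply: (vol_le hvol mA Ac) => t ct [y hy E].
    have /andP[_] := hS _ (zK _ hy); by rewrite E.
  have r0 : 0 <= 2 / l by rewrite divr_ge0// ltW.
  rewrite EFinM -[X in (_ <= _ * X)%E](leb_cube (fun i => z 0%R i) r0).
  apply: lee_wpmul2l; rewrite ?lee_fin//; apply: le_measure; rewrite ?inE//.
  - exact: measurable_preimage_par.
  - exact: measurable_cube.
  move=> t [ct [y hy E]]; rewrite cube_cball/= -(coord_par ct) -E.
  by have [_ ->] := img_param (Kc _ hy).
apply: (@le_trans _ _ (D%:E * (S * (2 * (2 / l)) ^+ n)%:E)%E); first exact: lee_wpmul2l.
rewrite -EFinM lee_fin /D exprMn.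
have -> : 2 * (2 / l) = 4 * l^-1 by rewrite mulrA -natrM.
rewrite [(4 * _) ^+ n]exprMn.
(* Dimension at least 2 enters here, as l^2 <= l^n for l >= 1. *)
have ln : l ^+ 2 * l^-1 ^+ n <= 1.
  rewrite exprVn -[X in _ <= X](@mulfV _ (l ^+ n)); last by rewrite expf_neq0// gt_eqF.
  by apply: ler_wpM2r; [rewrite invr_ge0 exprn_ge0// ltW|rewrite ler_weXn2l].
have -> : n%:R ^+ 2 * Gm * (Cp ^+ 2 * l ^+ 2) * (S * (4 ^+ n * l^-1 ^+ n)) =
  (n%:R ^+ 2 * Gm * Cp ^+ 2 * (S * 4 ^+ n)) * (l ^+ 2 * l^-1 ^+ n) by ring.
by rewrite ler_piMr// !mulr_ge0// ?exprn_ge0.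
Qed.

End bump_on_manifold.

(** * Test functions and densities *)

Section disjoint_balls.
Variables (R : realType) (n : nat).
Hypothesis n0 : (0 < n)%N.
Implicit Types (y z : 'rV[R]_n) (r : R).

Lemma sub_cball z r r' : r <= r' -> cball z r `<=` cball z r'.
Proof. by move=> rr y h i; exact: le_trans (h i) rr. Qed.

(** [x] may be a boundary point, so the centre is shifted by r/2 in every coordinate: the cube of
    radius r/2 then stays in the half-space. The cap at 1 will make the scales at least 1. *)
Lemma cball_in_chart (M : ptopologicalType) (X : manifold R n M) (c : chart X) x : dom c x ->
  exists z r, 0 < r <= 1 /\ cball z r `<=` img c.
Proof.
move=> cx; have [ O oO OE] := coord_dom c; have : img c (coord c x) by exact: img_coord.
rewrite /img OE => -[Oy hy]; have [r r0 rO] := cball_sub oO Oy.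
set y := coord c x in Oy hy rO.
have m0 : 0 < Num.min (r / 2) 1 by rewrite lt_min divr_gt0//= ltr01.
exists (y + const_mx (r / 2)), (Num.min (r / 2) 1); split; first by rewrite m0 ge_min lexx orbT.
move=> w hw; have hw' i : `|w 0 i - (y 0 i + r / 2)| <= r / 2.
  by have := hw i; rewrite !mxE => /le_trans; apply; rewrite ge_min lexx.
split; first by apply: rO => i; have := hw' i; rewrite !ler_norml => /andP[? ?]; apply/andP; split; lra.
by move=> i i0; have := hy i i0; have := hw' i; rewrite !ler_norml => /andP[? ?]; lra.
Qed.

(** The centres lie on the first axis through [z] with spacing d = r/(2(k+1)), so the last one is
    still within r/2 of [z]. The scale 8/d gives cubes of radius d/4, too small to meet. *)
Lemma disjoint_cballs k z r : 0 < r <= 1 -> exists (Z : 'I_k.+1 -> 'rV[R]_n) l,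
  [/\ 1 <= l, forall i, cball (Z i) (2 / l) `<=` cball z r &
      forall i j y, cball (Z i) (2 / l) y -> cball (Z j) (2 / l) y -> i = j].
Proof.
move=> /andP[r0 r1]; pose d := r / (2 * k.+1%:R).
have k1 : 1 <= k.+1%:R :> R by rewrite ler1n.
have d0 : 0 < d by rewrite divr_gt0// mulr_gt0.
have dr : k.+1%:R * d = r / 2.
  by rewrite /d; field; rewrite addrC natr1 pnatr_eq0.
have d1 : d <= 1.
  have : d <= k.+1%:R * d by rewrite ler_peMl// ltW.
  by rewrite dr; lra.
pose i0 := Ordinal n0.
exists (fun i => z + (i%:R * d) *: delta_mx 0 i0), (8 / d).
have -> : 2 / (8 / d) = d / 4 by field; rewrite gt_eqF.
split.
- by rewrite ler_pdivlMr//; lra.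
- move=> i y hy j; have := hy j; rewrite !mxE eqxx/=.
  have hi : 0 <= i%:R * d by rewrite mulr_ge0// ltW.
  have hi' : i%:R * d + d <= r / 2.
    by rewrite -dr -[X in _ + X]mul1r -mulrDl natr1 ler_wpM2r ?ler_nat// ltW.
  by case: (j == i0); rewrite ?mulr1 ?mulr0 !ler_norml => /andP[? ?]; apply/andP; split; lra.
have key (i j : nat) (y : R) : (i < j)%N -> `|y - i%:R * d| <= d / 4 -> `|y - j%:R * d| <= d / 4 -> False.
  move=> ij; rewrite !ler_norml => /andP[_ ?] /andP[? _].
  have : i%:R * d + d <= j%:R * d.
    by rewrite -[X in _ + X]mul1r -mulrDl natr1 ler_wpM2r ?ler_nat// ltW.
  lra.
move=> i j y hi hj; have := hi i0; have := hj i0; rewrite !mxE !eqxx/= !mulr1 !opprD !addrA.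
by move=> h2 h1; apply/val_inj; case: (ltngtP i j) => // ij; exfalso; [exact: key ij h1 h2|exact: key ij h2 h1].
Qed.
End disjoint_balls.

(** * Averages of cutoffs at dyadic scales *)

Section plateaus.
Variables (R : realType) (n : nat) (M : ptopologicalType).
Variables (X : manifold R n M) (g : metric X).
Variable vol : {measure set (borel M) -> \bar R}.
Hypothesis hvol : is_riemannian_volume g vol.
Hypothesis n2 : (2 <= n)%N.
Implicit Types (d : chart X) (x : M) (z y : 'rV[R]_n) (l : R).
Variables (c : chart X) (k : nat) (Z : 'I_k.+1 -> 'rV[R]_n) (l0 : R).
Hypothesis l0_ge1 : 1 <= l0.
Hypothesis Zc : forall i, cball (Z i) (2 / l0) `<=` img c.
Hypothesis Zdisj : forall i j y, cball (Z i) (2 / l0) y -> cball (Z j) (2 / l0) y -> i = j.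

Let L (m : nat) : R := 2 ^+ m * l0.
Let v i m := lift c (bump (L m) (Z i)).

Let l0_gt0 : 0 < l0. Proof. exact: lt_le_trans l0_ge1. Qed.

Let L_gt0 m : 0 < L m. Proof. by rewrite mulr_gt0// exprn_gt0. Qed.

Let L_ge1 m : 1 <= L m.
Proof. by rewrite -[X in X <= _]mulr1 ler_pM// exprn_ege1// ler1n. Qed.

Let ballL i m : cball (Z i) (2 / L m) `<=` cball (Z i) (2 / l0).
Proof.
apply: sub_cball; rewrite ler_pM2l// lef_pV2 ?posrE//.
by rewrite /L ler_peMl ?exprn_ege1 ?ler1n// ltW.
Qed.

Let ballLc i m : cball (Z i) (2 / L m) `<=` img c.
Proof. by move=> y /(@ballL i m); exact: Zc. Qed.

Let smooth_v i m : smooth X (v i m).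
Proof. exact: lift_bump_smooth. Qed.

Let v_off i m x : dom c x -> ~ cball (Z i) (2 / l0) (coord c x) -> v i m x = 0 /\ du (v i m) c x = 0.
Proof.
move=> cx h; have h' : ~ cball (Z i) (2 / L m) (coord c x) by move=> /(@ballL i m).
rewrite /v lift_dom// bump_off//; split=> //; rewrite du_lift_bump//.
by apply/rowP => j; rewrite !mxE bump_partial_off.
Qed.

Let du_v_neq0 i m x : dom c x -> du (v i m) c x != 0 -> 1 <= scaled_dist2 (L m) (Z i) (coord c x) <= 2.
Proof.
move=> cx; rewrite du_lift_bump// => /rV0Pn[j]; rewrite mxE; exact: bump_partial_neq0.
Qed.

(** Doubling the scale multiplies the squared distance by 4, while a cutoff varies only where it is
    between 1 and 2. So different scales vary on disjoint annuli, and the support of a finer cutoff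
    lies inside the plateau of a coarser one. *)
Let scale_lt m m' z y : (m < m')%N -> 4 * scaled_dist2 (L m) z y <= scaled_dist2 (L m') z y.
Proof.
move=> mm; rewrite !scaled_dist2M mulrA ler_wpM2r//.
  by apply: sumr_ge0 => j _; exact: sqr_ge0.
have -> : 4 * (2 ^+ m) ^+ 2 = (2 ^+ m.+1) ^+ 2 :> R by rewrite [2 ^+ m.+1]exprS; ring.
by rewrite ler_pXn2r ?nnegrE ?exprn_ge0// ler_weXn2l// ler1n.
Qed.

(** The chart and the index work for all scales [m] at once, hence also for averages over [m]. *)
Lemma plateau_cover x : exists d i, dom d x /\
  forall j, j != i -> forall m, v j m x = 0 /\ du (v j m) d x = 0.
Proof.
have [cx|cx] := pselect (dom c x); last first.
  exists (chart_at X x), ord0; split; first exact: dom_chart_at.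
  move=> j _ m; rewrite /v lift_out//; split=> //.
  by apply: du_lift_bump_out => //; exact: dom_chart_at.
have [[i hi]|h] := pselect (exists i, cball (Z i) (2 / l0) (coord c x)).
  exists c, i; split=> // j ji m; apply: v_off => // hj.
  by move: ji; rewrite (Zdisj hi hj) eqxx.
by exists c, ord0; split=> // j _ m; apply: v_off => // hj; apply: h; exists j.
Qed.

Lemma plateau_gradients i x : exists d m, dom d x /\ forall m', m' != m -> du (v i m') d x = 0.
Proof.
have [cx|cx] := pselect (dom c x); last first.
  exists (chart_at X x), 0%N; split; first exact: dom_chart_at.
  by move=> m _; apply: du_lift_bump_out => //; exact: dom_chart_at.
have [[m hm]|h] := pselect (exists m, du (v i m) c x != 0); last first.
  exists c, 0%N; split=> // m _; apply: contrapT => /eqP hm; apply: h; by exists m.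
exists c, m; split=> // m' m'm; apply: contrapT => /eqP hm'.
have /andP[a1 a2] := du_v_neq0 cx hm; have /andP[b1 b2] := du_v_neq0 cx hm'.
move: m'm; rewrite neq_ltn => /orP[] /scale_lt h.
  have := h (Z i) (coord c x); lra.
have := h (Z i) (coord c x); lra.
Qed.

Variable N : nat.
Hypothesis N0 : (0 < N)%N.

Let u i x := \sum_(m < N) N%:R^-1 * v i m x.
Let psi i := v i N.

Let smooth_u i : smooth X (u i).
Proof. by apply: smooth_sum => m; exact: smooth_v. Qed.

Let du_u i d x : dom d x -> (forall m : 'I_N, du (v i m) d x = 0) -> du (u i) d x = 0.
Proof.
move=> dx h; rewrite (du_sum (fun m : 'I_N => @smooth_v i m) _ dx) big1// => m _.
by rewrite h scaler0.
Qed.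

Let psi_neq0 i x : psi i x != 0 -> [/\ dom c x, cball (Z i) (2 / l0) (coord c x) &
  scaled_dist2 (L N) (Z i) (coord c x) < 2].
Proof.
have [cx|cx] := pselect (dom c x); last by rewrite /psi /v lift_out// eqxx.
rewrite /psi /v lift_dom// => h; split=> //; apply: contraNP h => h.
  by rewrite bump_off// => /(@ballL i N).
by rewrite bump_eq0// leNgt; apply/negP.
Qed.

(** The inequality is strict, so [x] is interior to the plateau; [plateau_family] uses it both for
    the value 1 and for the vanishing of the gradient. *)
Let inner i x m : psi i x != 0 -> (m < N)%N -> scaled_dist2 (L m) (Z i) (coord c x) < 1.
Proof.
move=> /psi_neq0[cx _ h] mN; have := scale_lt (Z i) (coord c x) mN; lra.
Qed.

Lemma plateau_family E : 
  (forall i m, \int[vol]_x (gnorm2 g (sgrad g (v i m)) x)%:E <= E%:E)%E ->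
  exists u psi : 'I_k.+1 -> M -> R,
  [/\ forall i, smooth X (u i) /\ smooth X (psi i),
      forall i, (\int[vol]_x (gnorm2 g (sgrad g (u i)) x)%:E <= (E / N%:R)%:E)%E,
      forall i, [/\ forall x, 0 <= psi i x <= 1, (0 < \int[vol]_x (psi i x)%:E)%E &
        forall x, psi i x != 0 -> u i x = 1],
      forall i j x, gnorm2 g (sgrad g (u i)) x != 0 -> psi j x = 0 &
      forall x, exists (d : chart X) i, dom d x /\ forall j, j != i -> u j x = 0 /\ du (u j) d x = 0].
Proof.
move=> hE; exists u, psi; split.
- by move=> i; split; [exact: smooth_u|exact: smooth_v].
- move=> i.
  have mg m : measurable_fun setT (fun x : borel M => (gnorm2 g (sgrad g (v i m)) x)%:E).
    apply/measurable_EFinP; apply: measurable_fun_borel; first exact: openT.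
    by move=> x _; apply: gnorm2_sgrad_continuous; exact: smooth_v.
  (* Without cross terms, the average has energy at most N * (E / N^2) = E / N. *)
  rewrite (_ : (\int[vol]_x _)%E =
      (\int[vol]_x (\sum_(m < N) (N%:R^-1 ^+ 2)%:E * (gnorm2 g (sgrad g (v i m)) x)%:E))%E); last first.
    apply: eq_integral => x _; have [d [m0 [dx h]]] := plateau_gradients i x.
    have [m1 hm1] : exists m1 : 'I_N, forall m : 'I_N, m != m1 -> du (v i m) d x = 0.
      have [mN|mN] := ltnP m0 N; first by exists (Ordinal mN) => m hm; exact: h.
      (* The only scale that may vary at [x] is not part of the average, so all its terms have zero
         differential and any index will do. *)
      by exists (Ordinal N0) => m _; apply: h; rewrite neq_ltn (leq_trans (ltn_ord m) mN).
    rewrite (@gnorm2_orthogonal R n M X g _ _ (fun m : 'I_N => @smooth_v i m) _ d x m1 dx hm1).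
    by rewrite -sumEFin; apply: eq_bigr => m _; rewrite EFinM.
  rewrite ge0_integral_sum//.
  + apply: (@le_trans _ _ (\sum_(m < N) (N%:R^-1 ^+ 2 * E)%:E)%E).
      apply: lee_sum => m _; rewrite ge0_integralZl_EFin//.
      * by rewrite [leRHS]EFinM; apply: lee_wpmul2l; rewrite ?lee_fin ?sqr_ge0.
      * by move=> x _; rewrite lee_fin gnorm2_ge0.
    rewrite sumEFin lee_fin sumr_const card_ord -mulr_natl le_eqVlt; apply/orP; left; apply/eqP.
    by field; rewrite pnatr_eq0 -lt0n.
  + by move=> m; exact: measurable_funeM.
  + by move=> m x _; rewrite -EFinM lee_fin mulr_ge0 ?sqr_ge0 ?gnorm2_ge0.
- move=> i; split.
  + by move=> x; rewrite /psi /v lift_bump_ge0 lift_bump_le1.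
  + exact: (integral_lift_bump_gt0 hvol n2 (L_gt0 N) (@ballLc i N)).
  + move=> x px; have [cx _ _] := psi_neq0 px.
    rewrite /u (eq_bigr (fun=> N%:R^-1)); last first.
      move=> m _; rewrite /v lift_dom// bump_plateau ?mulr1//.
      by apply/ltW; exact: inner px _.
    by rewrite sumr_const card_ord -[_ *+ N]mulr_natl mulfV// pnatr_eq0 -lt0n.
- move=> i j x; apply: contraNeq => px; have [cx hj _] := psi_neq0 px.
  rewrite (gnorm2_sgrad g (smooth_u i) cx) du_u ?mul0mx ?mxE// => m.
  (* For different centres the balls are disjoint; for the same centre, every scale of the average
     is on its plateau. *)
  have [ij|ij] := eqVneq i j; last first.
    by have [] // := @v_off i m x cx _; move=> hi; move: ij; rewrite (Zdisj hi hj) eqxx.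
  apply: contrapT => /eqP /(du_v_neq0 cx)/andP[h _].
  by have := inner px (ltn_ord m); rewrite -ij ltNge h.
move=> x; have [d [i [dx h]]] := plateau_cover x; exists d, i; split=> // j ji; split.
  by rewrite /u big1// => m _; have [-> _] := h j ji m; rewrite mulr0.
by apply: du_u => // m; have [_ ->] := h j ji m.
Qed.

End plateaus.

Section test_families.
Variables (R : realType) (n : nat) (M : ptopologicalType).
Variables (X : manifold R n M) (g : metric X).
Variable vol : {measure set (borel M) -> \bar R}.
Hypothesis hvol : is_riemannian_volume g vol.
Hypothesis n2 : (2 <= n)%N.

(** [C] is chosen before [N], so the energy C/N can be made arbitrarily small with [k] fixed. *)
Lemma test_family k : exists2 C, 0 <= C & forall N, (0 < N)%N ->
  exists u psi : 'I_k.+1 -> M -> R,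
  [/\ forall i, smooth X (u i) /\ smooth X (psi i),
      forall i, (\int[vol]_x (gnorm2 g (sgrad g (u i)) x)%:E <= (C / N%:R)%:E)%E,
      forall i, [/\ forall x, 0 <= psi i x <= 1, (0 < \int[vol]_x (psi i x)%:E)%E &
        forall x, psi i x != 0 -> u i x = 1],
      forall i j x, gnorm2 g (sgrad g (u i)) x != 0 -> psi j x = 0 &
      forall x, exists (d : chart X) i, dom d x /\ forall j, j != i -> u j x = 0 /\ du (u j) d x = 0].
Proof.
have n0 : (0 < n)%N by exact: leq_trans n2.
have [z [r [r01 rc]]] := cball_in_chart (dom_chart_at X point).
have [Z [l0 [l1 Zr Zd]]] := disjoint_cballs n0 k z r01.
have [E E0 hE] := bump_energy hvol n2 (compact_cball (r := r)) rc.
exists E => // N N0.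
apply: (plateau_family hvol n2 l1 _ Zd N0) => [i|i m]; first exact: subset_trans (Zr i) rc.
have L1 : 1 <= 2 ^+ m * l0 by rewrite -[X in X <= _]mulr1 ler_pM// exprn_ege1// ler1n.
apply: hE => //; apply: subset_trans (Zr i); apply: sub_cball.
rewrite ler_pM2l// lef_pV2 ?posrE; [|exact: lt_le_trans L1|exact: lt_le_trans l1].
by rewrite ler_peMl ?exprn_ege1 ?ler1n// (le_trans _ l1).
Qed.
End test_families.

(** * Concentrated densities and the common estimate *)

Section small_rayleigh_quotients.
Variables (R : realType) (n : nat) (M : ptopologicalType).
Variables (X : manifold R n M) (g : metric X).
Variable vol : {measure set (borel M) -> \bar R}.
Hypothesis hvol : is_riemannian_volume g vol.
Hypothesis cM : compact [set: M].
Hypothesis n2 : (2 <= n)%N.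
Variable k : nat.
Implicit Types (x : M) (e : R).

Let continuous_measurable (f : M -> R) : continuous f -> measurable_fun setT (f : borel M -> R).
Proof. by move=> cf; apply: measurable_fun_borel; [exact: openT|move=> x _; exact: cf]. Qed.

Lemma continuous_integral_lty (f : M -> R) : continuous f -> (forall x, 0 <= f x) ->
  (\int[vol]_x (f x)%:E < +oo)%E.
Proof.
move=> cf f0; have /integrableP[_] := continuous_integrable hvol cM cf.
by under eq_integral do rewrite gee0_abs ?lee_fin//.
Qed.

Section densities.
Variable psi : 'I_k.+1 -> M -> R.
Hypothesis spsi : forall i, smooth X (psi i).
Hypothesis psi01 : forall i x, 0 <= psi i x <= 1.
Hypothesis psi_gt0 : forall i, (0 < \int[vol]_x (psi i x)%:E)%E.

Let mpsi i : measurable_fun setT (fun x : borel M => (psi i x)%:E).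
Proof. by apply/measurable_EFinP; apply: continuous_measurable; exact: smooth_continuous. Qed.

Let psi_ge0 i x : 0 <= psi i x. Proof. by have /andP[] := psi01 i x. Qed.

Let psi_lty i : (\int[vol]_x (psi i x)%:E < +oo)%E.
Proof. by apply: continuous_integral_lty => //; exact: smooth_continuous. Qed.

Let I i : R := fine (\int[vol]_x (psi i x)%:E).

Let IE i : (\int[vol]_x (psi i x)%:E = (I i)%:E)%E.
Proof. by rewrite fineK// ge0_fin_numE// ltW. Qed.

Let I_gt0 i : 0 < I i.
Proof. by rewrite -lte_fin -IE. Qed.

Let V : R := fine (vol setT).

Let VE : vol setT = V%:E.
Proof. by rewrite fineK// ge0_fin_numE// (vol_finite hvol). Qed.

Lemma volume_gt0 : 0 < V.
Proof.
rewrite -lte_fin -VE; apply: lt_le_trans (psi_gt0 ord0) _.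
rewrite -[X in (_ <= X)%E]mul1e -(integral_cst vol measurableT); apply: ge0_le_integral => //.
- by move=> x _; rewrite lee_fin.
- by move=> x _; rewrite lee_fin; have /andP[] := psi01 ord0 x.
Qed.

(** The k + 1 bumps share the mass (1 - e) V equally and the constant contributes e V, for a total
    of V. *)
Lemma concentrated_density e : 0 < e < 1 -> exists phi,
  [/\ R0 X vol phi, forall x, (forall i, psi i x = 0) -> phi x = e &
    forall i, exists2 a, 0 <= a & (forall x, a * psi i x <= phi x) /\
      (a%:E * \int[vol]_x (psi i x)%:E = ((1 - e) * (V / k.+1%:R))%:E)%E].
Proof.
have V0 := volume_gt0; move=> /andP[e0 e1]; pose a i := (1 - e) * (V / k.+1%:R) / I i.
have a0 i : 0 <= a i.
  by apply: divr_ge0; [apply: mulr_ge0; [lra|rewrite divr_ge0// ltW]|rewrite ltW].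
have aI i : a i * I i = (1 - e) * (V / k.+1%:R) by rewrite divfK// gt_eqF.
have ap i x : 0 <= a i * psi i x by exact: mulr_ge0.
exists (fun x => e + \sum_i a i * psi i x); split; last 2 first.
- by move=> x h; rewrite big1 ?addr0// => i _; rewrite h mulr0.
- move=> i; exists (a i) => //; split; last by rewrite IE -EFinM aI.
  move=> x; rewrite (bigD1 i)//= addrCA lerDl; apply: addr_ge0; [exact: ltW|exact: sumr_ge0].
split; first by move=> x; rewrite ltr_pwDl// sumr_ge0.
- exact: smooth_affine.
have -> : (\int[vol]_x (e + \sum_i a i * psi i x)%:E = V%:E)%E.
  transitivity (\int[vol]_x (e%:E + \sum_i (a i)%:E * (psi i x)%:E))%E.
    by apply: eq_integral => x _; rewrite EFinD -sumEFin.
  have m i : measurable_fun setT (fun x : borel M => (a i)%:E * (psi i x)%:E)%E by exact: measurable_funeM.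
  have p0 i x : (0 <= (a i)%:E * (psi i x)%:E)%E by rewrite -EFinM lee_fin.
  rewrite ge0_integralD//; last 3 first.
  - by move=> x _; rewrite lee_fin ltW.
  - by move=> x _; exact: sume_ge0.
  - by apply: emeasurable_sum.
  rewrite integral_cst// VE ge0_integral_sum//.
  rewrite (eq_bigr (fun=> ((1 - e) * (V / k.+1%:R))%:E)); last first.
    by move=> i _; rewrite ge0_integralZl_EFin ?IE -?EFinM ?aI// => x _; rewrite lee_fin.
  rewrite sumEFin -EFinM -EFinD sumr_const card_ord -mulr_natl; congr _%:E.
  by field; rewrite addrC natr1 pnatr_eq0.
by rewrite VE inver gt_eqF// -EFinM mulVf// gt_eqF.
Qed.

End densities.

Variables (C : R) (N : nat) (u psi : 'I_k.+1 -> M -> R).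
Hypothesis smooth_upsi : forall i, smooth X (u i) /\ smooth X (psi i).
Hypothesis energy : forall i, (\int[vol]_x (gnorm2 g (sgrad g (u i)) x)%:E <= (C / N%:R)%:E)%E.
Hypothesis plateau : forall i, [/\ forall x, 0 <= psi i x <= 1, (0 < \int[vol]_x (psi i x)%:E)%E &
  forall x, psi i x != 0 -> u i x = 1].
Hypothesis disj : forall x, exists (d : chart X) i, dom d x /\ forall j, j != i -> u j x = 0 /\ du (u j) d x = 0.

Let su i : smooth X (u i). Proof. by case: (smooth_upsi i). Qed.

(** The estimate common to all three claims: [s] bounds the weight where the gradients live, so each
    numerator is at most s C/N; [b i] bounds the mass that [rho] gives to the plateau of [u i],
    where [u i] is 1. *)
Lemma mu_k_small (rho sigma : M -> R) (s delta : R) (b : 'I_k.+1 -> R) :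
  continuous rho -> (forall x, 0 <= rho x) ->
  measurable_fun setT (sigma : borel M -> R) -> (forall x, 0 <= sigma x) ->
  0 <= s -> 0 <= delta ->
  (forall i x, gnorm2 g (sgrad g (u i)) x != 0 -> sigma x <= s) ->
  (forall i, 0 < b i) ->
  (forall i, exists2 a, 0 <= a & (forall x, a * psi i x <= rho x) /\
      ((b i)%:E <= a%:E * \int[vol]_x (psi i x)%:E)%E) ->
  (forall i, s * (C / N%:R) <= delta * b i) ->
  (mu_k g vol k rho sigma <= delta%:E)%E.
Proof.
move=> crho rho0 msigma sigma0 s0 delta0 hs b0 hrho hb.
have cu2 i : continuous (fun x => u i x ^+ 2 * rho x).
  move=> x; apply: (@continuousM R M (fun x => u i x ^+ 2) rho x); last exact: crho.
  by apply: (@continuousM R M (u i) (u i) x); exact: smooth_continuous (su i) x.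
have u2_ge0 i x : 0 <= u i x ^+ 2 * rho x by apply: mulr_ge0; [exact: sqr_ge0|].
have mgn i : measurable_fun setT (gnorm2 g (sgrad g (u i)) : borel M -> R).
  by apply: continuous_measurable => x; exact: gnorm2_sgrad_continuous.
have hB i : ((b i)%:E <= \int[vol]_x (u i x ^+ 2 * rho x)%:E)%E.
  have [a a0 [ha hba]] := hrho i; have [p01 _ pu] := plateau i.
  have mp : measurable_fun setT (psi i : borel M -> R).
    by apply: continuous_measurable; exact: smooth_continuous (smooth_upsi i).2.
  apply: (le_trans hba); rewrite -ge0_integralZl_EFin//; last 2 first.
  - by move=> x _; rewrite lee_fin; case/andP: (p01 x).
  - exact/measurable_EFinP.
  apply: ge0_le_integral => //.
  - by move=> x _; rewrite -EFinM lee_fin mulr_ge0//; case/andP: (p01 x).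
  - by apply: measurable_funeM; exact/measurable_EFinP.
  - by apply/measurable_EFinP; exact: continuous_measurable.
  move=> x _; rewrite -EFinM lee_fin; have [p0|p0] := eqVneq (psi i x) 0; first by rewrite p0 mulr0.
  by rewrite pu// expr1n mul1r.
apply: (mu_k_le hvol cM (ltnW n2) su disj rho0 sigma0 _ msigma).
- exact: continuous_measurable.
- by move=> i; apply: lt_le_trans (hB i); rewrite lte_fin.
- by move=> i; exact: continuous_integral_lty.
move=> i; apply: (@le_trans _ _ (s%:E * (C / N%:R)%:E)%E).
  apply: (@le_trans _ _ (s%:E * \int[vol]_x (gnorm2 g (sgrad g (u i)) x)%:E)%E); last first.
    by apply: lee_wpmul2l; rewrite ?lee_fin//; exact: energy.
  rewrite -ge0_integralZl_EFin//; last 2 first.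
  - by move=> x _; rewrite lee_fin gnorm2_ge0.
  - exact/measurable_EFinP.
  apply: ge0_le_integral => //.
  - by move=> x _; rewrite lee_fin mulr_ge0 ?gnorm2_ge0.
  - by apply/measurable_EFinP; exact: measurable_funM.
  - by apply: measurable_funeM; exact/measurable_EFinP.
  move=> x _; rewrite -EFinM lee_fin mulrC.
  have [->|h] := eqVneq (gnorm2 g (sgrad g (u i)) x) 0; first by rewrite !mulr0.
  by rewrite ler_wpM2r ?gnorm2_ge0//; exact: hs h.
apply: (@le_trans _ _ (delta * b i)%:E); first by rewrite -EFinM lee_fin.
by rewrite EFinM; apply: lee_wpmul2l; rewrite ?lee_fin.
Qed.

End small_rayleigh_quotients.

Lemma ereal_inf_eq0 (R : realType) (T : Type) (S : set T) (f : T -> \bar R) :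
  (forall t, S t -> 0 <= f t)%E -> (forall e : R, 0 < e -> exists2 t, S t & (f t <= e%:E)%E) ->
  ereal_inf [set f t | t in S] = 0%E.
Proof.
move=> f0 fe; apply/eqP; rewrite eq_le; apply/andP; split; last first.
  by apply: le_ereal_inf_tmp => _ [t St <-]; exact: f0.
apply/lee_addgt0Pr => e e0; rewrite add0e; have [t St] := fe e e0; apply: le_trans.
by apply: ereal_inf_lbound; exists t.
Qed.

Theorem theorem3p1 (R : realType) (n : nat) (hn : (2 <= n)%N)
  (M : ptopologicalType) (X : manifold R n M) (hM : compact [set: M])
  (g : metric X) (vol : {measure set (borel M) -> \bar R})
  (hvol : is_riemannian_volume g vol)
  (k : nat) (hk : (0 < k)%N) (p : R) (hp : 0 < p) :
  [/\ ereal_inf [set mu_k g vol k rho (cst 1) | rho in R0 X vol] = 0%E,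
      ereal_inf [set mu_k g vol k (cst 1) sigma | sigma in R0 X vol] = 0%E &
      ereal_inf [set mu_k g vol k rho (fun x => rho x `^ p) | rho in R0 X vol]
        = 0%E].
Proof.
have [C C0 hC] := test_family hvol hn k.
pose V := fine (vol setT).
(* The single scale N = 1 serves (ii) and (iii), and already shows that the volume is positive. *)
have [u [psi [sup E P G D]]] := hC 1%N isT.
have V0 : 0 < V.
  by apply: (volume_gt0 hvol hM (psi := psi)) => i; [case: (sup i)|case: (P i)|case: (P i)].
(* A lower bound for the mass (1 - eps) V / (k + 1) of each bump, valid for every eps <= 1/2. *)
pose b : R := 2^-1 * (V / k.+1%:R).
have b0 : 0 < b by rewrite mulr_gt0// divr_gt0.
have R0_ge0 phi : R0 X vol phi -> forall x, 0 <= phi x by move=> [h _ _] x; exact/ltW.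
have R0_continuous phi : R0 X vol phi -> continuous phi by move=> [_ h _]; exact: smooth_continuous h.
have cst1 : continuous (cst (1:R) : M -> R) by move=> x; exact: cvg_cst.
split; apply: ereal_inf_eq0.
- by move=> rho /R0_ge0 r0; exact: mu_k_ge0.
(* This [N] exceeds C/(e b), so that C/N <= e b. *)
- move=> e e0; pose N := (Num.truncn (C / (e * b))).+1.
  have {u psi sup E P G D} [u [psi [sup E P G D]]] := hC N isT.
  have h12 : 0 < (2^-1 : R) < 1 by apply/andP; split; lra.
  have [phi [Rphi _ hphi]] := concentrated_density hvol hM (fun i => (sup i).2)
    (fun i => let: And3 h _ _ := P i in h) (fun i => let: And3 _ h _ := P i in h) h12.
  exists phi => //.
  apply: (mu_k_small (s := 1) (b := fun=> b) hvol hM hn sup E P D) => //.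
  + exact: R0_continuous.
  + exact: R0_ge0.
  + exact: ltW.
  + move=> i; have [a a0 [h1 h2]] := hphi i; exists a => //; split=> //.
    rewrite h2 lee_fin /b -/V le_eqVlt; apply/orP; left; apply/eqP; congr (_ * _); lra.
  + move=> _; rewrite mul1r ler_pdivrMr// -ler_pdivrMl; last exact: mulr_gt0.
    by rewrite mulrC ltW// truncnS_gt.
- by move=> sigma /R0_ge0 r0; exact: mu_k_ge0.
- move=> e e0; pose I i := fine (\int[vol]_x (psi i x)%:E).
  have psi_ge0 i x : 0 <= psi i x by have [h _ _] := P i; have /andP[] := h x.
  have IE i : (\int[vol]_x (psi i x)%:E = (I i)%:E)%E.
    have [_ h _] := P i; rewrite fineK// ge0_fin_numE ?ltW//.
    apply: (continuous_integral_lty hvol hM) => //; exact: smooth_continuous (sup i).2.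
  have I0 i : 0 < I i by have [_ h _] := P i; rewrite -lte_fin -IE.
  (* With eps = 1/S, eps * C <= e * I i for all i at once. *)
  pose S := 2 + \sum_i C / (e * I i).
  have SC i : C / (e * I i) <= S.
    rewrite /S (bigD1 i)//= addrCA lerDl addr_ge0// sumr_ge0// => j _.
    by rewrite divr_ge0// ltW// mulr_gt0.
  (* The summand 2 in [S] makes 1/S an admissible eps in ]0, 1[. *)
  have S1 : 1 < S.
    have : 0 <= \sum_i C / (e * I i) by apply: sumr_ge0 => j _; rewrite divr_ge0// ltW// mulr_gt0.
    rewrite /S; lra.
  have h12 : 0 < S^-1 < 1 by rewrite invr_gt0 invf_lt1 ?S1 ?andbT; apply: lt_trans S1.
  have [phi [Rphi hphi _]] := concentrated_density hvol hM (fun i => (sup i).2)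
    (fun i => let: And3 h _ _ := P i in h) (fun i => let: And3 _ h _ := P i in h) h12.
  exists phi => //; have [S0 _] := andP h12.
  apply: (mu_k_small (s := S^-1) (b := I) hvol hM hn sup E P D) => //.
  + apply: measurable_fun_borel; first exact: openT.
    by move=> x _; exact: R0_continuous.
  + exact: R0_ge0.
  + exact: ltW.
  + exact: ltW.
  + by move=> i x h; rewrite hphi// => j; exact: G h.
  + move=> i; exists 1 => //; split; last by rewrite IE mul1e.
    by move=> x; rewrite mul1r; have [h _ _] := P i; have /andP[] := h x.
  + move=> i; rewrite divr1 ler_pdivrMl; last exact: lt_trans S1.
    by rewrite -ler_pdivrMr// mulr_gt0.
- by move=> rho /R0_ge0 r0; apply: mu_k_ge0 => // x; exact: powR_ge0.
(* Chosen so that s^p (C + 1) = e b; the added 1 keeps the denominator positive when [C] is 0. *)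
move=> e e0; pose s := (e * b / (C + 1)) `^ p^-1.
have C1 : 0 < C + 1 by rewrite ltr_wpDl.
have s0 : 0 < s by rewrite powR_gt0// divr_gt0// mulr_gt0.
have sp : s `^ p = e * b / (C + 1).
  by rewrite -powRrM mulVf ?gt_eqF// powRr1// ltW// divr_gt0// mulr_gt0.
(* The cap at 1/2 guarantees that each bump keeps a mass at least [b]. *)
pose t := Num.min s 2^-1.
have t0 : 0 < t by rewrite lt_min s0 invr_gt0 ltr0n.
have t2 : t <= 2^-1 by rewrite ge_min lexx orbT.
have h12 : 0 < t < 1 by rewrite t0; lra.
have [phi [Rphi hphi1 hphi2]] := concentrated_density hvol hM (fun i => (sup i).2)
  (fun i => let: And3 h _ _ := P i in h) (fun i => let: And3 _ h _ := P i in h) h12.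
exists phi => //.
apply: (mu_k_small (s := t `^ p) (b := fun=> b) hvol hM hn sup E P D) => //.
- exact: R0_continuous.
- exact: R0_ge0.
- apply: (measurableT_comp (f := @powR R ^~ p)); first exact: measurable_powR.
  by apply: measurable_fun_borel; [exact: openT|move=> x _; exact: R0_continuous].
- by move=> x; exact: powR_ge0.
- exact: powR_ge0.
- exact: ltW.
- by move=> i x h; rewrite hphi1// => j; exact: G h.
- move=> i; have [a a0 [h1 h2]] := hphi2 i; exists a => //; split=> //.
  rewrite h2 lee_fin /b -/V; apply: ler_wpM2r; first by rewrite divr_ge0// ltW.
  lra.
move=> _; rewrite divr1; apply: (@le_trans _ _ (s `^ p * (C + 1))).
  apply: ler_pM => //; [exact: powR_ge0| |by rewrite lerDl].
  by apply: ge0_ler_powR; rewrite ?nnegrE; [exact: ltW|exact: ltW|exact: ltW|rewrite ge_min lexx].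
by rewrite sp divfK// gt_eqF.
Qed.
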